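(* Let $(B,g_B)$ be a nondegenerate semi-Riemannian manifold, let $(F_j,g_{F_j})$, $1\le j\le l$, be semi-regular semi-Riemannian manifolds, and let $f_j\in C^\infty(B)$, $1\le j\le l$. Then the multiply warped product manifold $B\times F_1\times\cdots\times F_l$ with warping functions $f_1,\dots,f_l$ is a semi-regular semi-Riemannian manifold.
   Context: A singular semi-Riemannian manifold $(M,g)$ is a smooth manifold with a smooth symmetric $(0,2)$-tensor field $g=\langle\cdot,\cdot\rangle$, possibly degenerate and of varying signature. Its Koszul form is $\mathcal K(X,Y,Z)=\tfrac12\{X\langle Y,Z\rangle+Y\langle Z,X\rangle-Z\langle X,Y\rangle-\langle X,[Y,Z]\rangle+\langle Y,[Z,X]\rangle+\langle Z,[X,Y]\rangle\}$, and $\nabla^\flat_XY:=\mathcal K(X,Y,\cdot)$. $\mathcal A^\bullet(M)$ is the set of smooth 1-forms $\omega$ such that for each $p$ there is $u\in T_pM$ with $\omega_p=\langle u,\cdot\rangle$. For covectors $\omega_p=\langle u,\cdot\rangle$, $\tau_p=\langle v,\cdot\rangle$ put $\langle\langle\omega,\tau\rangle\rangle_\bullet=\langle u,v\rangle$. If $\nabla^\flat_XY\in\mathcal A^\bullet(M)$ for all $X,Y$, then for $\omega\in\mathcal A^\bullet(M)$ one sets $(\nabla_X\omega)(Y)=X(\omega(Y))-\langle\langle\nabla^\flat_XY,\omega\rangle\rangle_\bullet$, smooth on the regions of constant signature (an open dense set); elsewhere values are understood by smooth extension when it exists. $(M,g)$ is semi-regular if $\nabla^\flat_XY\in\mathcal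 A^\bullet(M)$ and $\nabla_Z(\nabla^\flat_XY)\in\mathcal A^\bullet(M)$ for all $X,Y,Z\in\Gamma(TM)$. The multiply warped product is $B\times F_1\times\cdots\times F_l$ with the metric $\pi_B^*(g_B)+\sum_{j=1}^l(f_j\circ\pi_B)^2\pi_{F_j}^*(g_{F_j})$, where $\pi_B$, $\pi_{F_j}$ are the projections; the $f_j$ may have zeros. *)

(* Defs.v *)
From HB Require Import structures.
From mathcomp Require Import all_boot all_order all_algebra.
From mathcomp Require Import all_classical reals topology normedtype derive.
From mathcomp Require Import ring.

Set Implicit Arguments.
Unset Strict Implicit.
Unset Printing Implicit Defensive.

Import Order.TTheory GRing.Theory Num.Theory.
Import numFieldNormedType.Exports.

Local Open Scope classical_set_scope.
Local Open Scope ring_scope.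

Section SmoothOn.
Context {R : realType} {n : nat}.
Implicit Types (U V : set 'rV[R]_n) (f g : 'rV[R]_n -> R).

Definition partial (i : 'I_n) f : 'rV[R]_n -> R :=
  fun x => 'D_(delta_mx 0 i) f x.

Fixpoint Ck (k : nat) U f : Prop :=
  (forall x, U x -> {for x, continuous f}) /\
  if k is k'.+1 then
    forall i : 'I_n, (forall x, U x -> derivable f x (delta_mx 0 i)) /\
                     Ck k' U (partial i f)
  else True.

Definition smooth_on U f : Prop := forall k, Ck k U f.

Lemma Ck_cont k U f x : Ck k U f -> U x -> {for x, continuous f}.
Proof. by case: k => [|k] [cf _] /cf. Qed.

Lemma Ck_ext k U f g : open U -> (forall x, U x -> f x = g x) ->
  Ck k U f -> Ck k U g.
Proof.
move=> oU.
have near_ext f' g' x : (forall x, U x -> f' x = g' x) -> U x ->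
    \forall y \near x, f' y = g' y.
  by move=> fg Ux; exact: filterS (open_nbhs_nbhs (conj oU Ux)).
have cont_ext f' g' x : (forall x, U x -> f' x = g' x) -> U x ->
    {for x, continuous f'} -> {for x, continuous g'}.
  move=> fg Ux cf; rewrite /prop_for /continuous_at -(fg _ Ux).
  apply: cvg_trans cf; exact: (@near_eq_cvg _ _ _ (nbhs_filter x) _ _ (near_ext f' g' x fg Ux)).
elim: k f g => [|k IH] f g fg Cf.
  by split=> // x Ux; apply: cont_ext (Ck_cont Cf Ux).
split=> [x Ux|i]; first by apply: cont_ext (Ck_cont Cf Ux).
have [_ /(_ i) [D1 D2]] := Cf; split=> [x Ux|].
  by apply: near_eq_derivable (D1 x Ux); exact: (near_ext f g x fg Ux).
apply: IH D2 => x Ux.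
by rewrite /partial; apply: near_eq_derive; exact: (near_ext f g x fg Ux).
Qed.

Lemma Ck_sub k U V f : V `<=` U -> Ck k U f -> Ck k V f.
Proof.
move=> VU; elim: k f => [|k IH] f [cf Df]; split=> //; try by move=> x /VU /cf.
by move=> i; have [D1 D2] := Df i; split; [move=> x /VU /D1|exact: IH].
Qed.

Lemma CkW k U f : Ck k.+1 U f -> Ck k U f.
Proof.
elim: k f => [|k IH] f; first by case.
case=> cf Df; split=> // i; have [D1 D2] := Df i.
by split=> //; exact: IH.
Qed.

Lemma CkD k U f g : open U -> Ck k U f -> Ck k U g -> Ck k U (f \+ g).
Proof.
move=> oU.
have cD j f' g' x : Ck j U f' -> Ck j U g' -> U x -> {for x, continuous (f' \+ g')}.
  by move=> Cf Cg Ux; apply: continuousD; [exact: (Ck_cont Cf)|exact: (Ck_cont Cg)].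
elim: k f g => [|k IH] f g Cf Cg; first by split=> // x; exact: (cD 0).
split=> [x|i]; first exact: (cD k.+1).
have [_ /(_ i) [Df1 Df2]] := Cf; have [_ /(_ i) [Dg1 Dg2]] := Cg.
split=> [x Ux|]; first by apply: derivableD; [exact: Df1|exact: Dg1].
apply: (@Ck_ext k U (partial i f \+ partial i g)) => //; last exact: IH.
by move=> x Ux; rewrite /partial /= -deriveD; [|exact: Df1|exact: Dg1].
Qed.

Lemma CkM k U f g : open U -> Ck k U f -> Ck k U g -> Ck k U (f \* g).
Proof.
move=> oU.
have cM j f' g' x : Ck j U f' -> Ck j U g' -> U x -> {for x, continuous (f' \* g')}.
  by move=> Cf Cg Ux; apply: continuousM; [exact: (Ck_cont Cf)|exact: (Ck_cont Cg)].
elim: k f g => [|k IH] f g Cf Cg; first by split=> // x; exact: (cM 0).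
split=> [x|i]; first exact: (cM k.+1).
have [_ /(_ i) [Df1 Df2]] := Cf; have [_ /(_ i) [Dg1 Dg2]] := Cg.
split=> [x Ux|]; first by apply: derivableM; [exact: Df1|exact: Dg1].
apply: (@Ck_ext k U ((f \* partial i g) \+ (g \* partial i f))) => //.
  by move=> x Ux; rewrite /partial /=; rewrite deriveM; [|exact: Df1|exact: Dg1].
by apply: CkD => //; apply: IH => //; exact: CkW.
Qed.

Lemma Ck_cst k U (a : R) : Ck k U (fun=> a).
Proof.
elim: k a => [|k IH] a; first by split=> // x _; exact: (@cst_continuous _ _ a x).
split=> [x _|i]; first exact: (@cst_continuous _ _ a x).
split=> [x _|]; first exact: (derivable_cst (a : R^o)).
have -> : partial i (fun=> a) = fun=> 0.
  by apply/funext => x; rewrite /partial derive_cst.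
exact: IH.
Qed.

End SmoothOn.

Section CoordinateProjection.
Context {R : realType} {m n : nat}.
Variable pi : {linear 'rV[R]_m -> 'rV[R]_n}.
Hypothesis pi_cont : continuous pi.
Hypothesis pi_delta : forall i, pi (delta_mx 0 i) = 0 \/
  exists k, pi (delta_mx 0 i) = delta_mx 0 k.

Lemma Ck_proj k (V : set 'rV[R]_n) h : Ck k V h -> Ck k (pi @^-1` V) (h \o pi).
Proof.
have quot (h' : 'rV[R]_n -> R) v x :
    (fun t : R => t^-1 *: (((h' \o pi) \o shift x) (t *: v) - (h' \o pi) x))
  = (fun t : R => t^-1 *: ((h' \o shift (pi x)) (t *: pi v) - h' (pi x))).
  by apply/funext => t /=; rewrite (_ : pi (t *: v + x) = t *: pi v + pi x) //; exact: linearP.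
have cC j (h' : 'rV[R]_n -> R) x : Ck j V h' -> V (pi x) -> {for x, continuous (h' \o pi)}.
  by move=> Ch Vx; apply: continuous_comp; [exact: pi_cont|exact: (Ck_cont Ch)].
elim: k h => [|k IH] h Ch; first by split=> // x; exact: cC Ch.
split=> [x|i]; first exact: cC Ch.
have [_ Dh] := Ch.
have [p0|[j pj]] := pi_delta i.
  split=> [x Ux|].
    by rewrite /derivable quot p0; exact: derivable0.
  suff -> : partial i (h \o pi) = fun=> 0 by exact: Ck_cst.
  apply/funext => x; rewrite /partial /derive quot p0.
  exact: derive0.
have [D1 D2] := Dh j; split=> [x Ux|].
  by rewrite /derivable quot pj; exact: D1.
suff -> : partial i (h \o pi) = partial j h \o pi by exact: IH.
by apply/funext => x; rewrite /partial /derive quot pj.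
Qed.

End CoordinateProjection.

Section MatrixTopology.
Context {R : realType}.

Lemma cvg_mxP (T : Type) (F : set_system T) (FF : Filter F) m n
    (f : T -> 'M[R]_(m, n)) (A : 'M[R]_(m, n)) :
  (forall i j, (fun x => f x i j) @ F --> A i j) -> f @ F --> A.
Proof.
move=> fA P [Q QA QP] /=.
apply: (@filterS _ F _ (fun x => forall ij : 'I_m * 'I_n, Q ij.1 ij.2 (f x ij.1 ij.2))).
  by move=> x Qx; apply: QP => i j; exact: (Qx (i, j)).
by apply: filter_forall => -[i j]; exact: (fA i j _ (QA i j)).
Qed.

Lemma eq_continuous_at (T U : topologicalType) (f h : T -> U) x :
  f =1 h -> {for x, continuous f} -> {for x, continuous h}.
Proof. by move=> /funext ->. Qed.

Lemma pair_continuous_at (T U V : topologicalType) (f : T -> U) (h : T -> V) x :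
  {for x, continuous f} -> {for x, continuous h} ->
  {for x, continuous (fun t => (f t, h t))}.
Proof.
move=> fx hx; pose FF : Filter (nbhs x) := nbhs_filter x.
exact: (@cvg_pair _ _ _ (nbhs x) (nbhs (f x)) (nbhs (h x)) FF _ _ f h fx hx).
Qed.

Lemma mx_continuous_at (T : topologicalType) m n (f : T -> 'M[R]_(m, n)) x :
  (forall i j, {for x, continuous (fun t => f t i j)}) -> {for x, continuous f}.
Proof. by move=> fx; apply: (@cvg_mxP _ (nbhs x) (nbhs_filter x)) => i j; exact: fx. Qed.

Lemma mx_entry_continuous m n (i : 'I_m) (j : 'I_n) :
  continuous (fun A : 'M[R]_(m, n) => A i j).
Proof.
move=> A P PA /=.
exists (fun i' j' => if (i' == i) && (j' == j) then P else setT) => [i' j'|B BP].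
  by case: ifPn => [/andP[/eqP-> /eqP->]//|_]; exact: filterT.
by have := BP i j; rewrite !eqxx.
Qed.

Lemma cvg_prod_topology (T : Type) (F : set_system T) (FF : Filter F)
    (I : Type) (K : I -> topologicalType) (f : T -> prod_topology K)
    (x : prod_topology K) :
  (forall i, (fun t => f t i) @ F --> x i) -> f @ F --> x.
Proof.
move=> fx; apply/cvg_sup => i.
move=> P [Q [[W oW WQ] Qx QP]] /=.
have Wx : W (x i) by rewrite -WQ in Qx.
have FW : F [set t | W (f t i)] by apply: (fx i W); exact: open_nbhs_nbhs.
by apply: (@filterS _ F _ [set t | W (f t i)]) => // t Wt; apply: QP; rewrite -WQ.
Qed.

Lemma prod_topology_continuous_at (T : topologicalType)
    (I : Type) (K : I -> topologicalType) (f : T -> prod_topology K) x :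
  (forall i, {for x, continuous (fun t => f t i)}) -> {for x, continuous f}.
Proof.
by move=> fx; apply: (@cvg_prod_topology _ (nbhs x) (nbhs_filter x)) => i; exact: fx.
Qed.

Lemma nbhs_prod_topology (I : eqType) (K : I -> topologicalType)
    (x : prod_topology K) (V : set (prod_topology K)) : nbhs x V ->
  exists2 W : forall i, set (K i), (forall i, nbhs (x i) (W i)) &
    [set y : prod_topology K | forall i, W i (y i)] `<=` V.
Proof.
set G : set_system (prod_topology K) := filter_from
  [set W : forall i, set (K i) | forall i, nbhs (x i) (W i)]
  (fun W => [set y : prod_topology K | forall i, W i (y i)]).
have FG : Filter G.
  apply: filter_from_filter => [|W W' xW xW'].
    by exists (fun=> setT) => i; exact: filterT.
  exists (fun i => W i `&` W' i) => [i|y yW]; first exact: filterI.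
  by split=> i; have [] := yW i.
move=> xV; apply: (@cvg_prod_topology _ G FG _ K id x _ V xV) => i P xP.
exists (dfwith (fun k => setT : set (K k)) i P) => [k|y /(_ i)].
  by case: dfwithP => // ? _; exact: filterT.
by rewrite dfwithin.
Qed.

Lemma proj_topology_continuous (I : eqType) (K : I -> topologicalType) (i : I) :
  continuous (fun x : prod_topology K => x i).
Proof. exact: proj_continuous. Qed.

End MatrixTopology.

Section Manifold.
Context {R : realType}.

(* The total functions cfwd and cbwd are relevant only on cdom and cimg. *)
Record chart (M : topologicalType) (n : nat) := Chart {
  cdom : set M;
  cimg : set 'rV[R]_n;
  cfwd : M -> 'rV[R]_n;
  cbwd : 'rV[R]_n -> M;
  cdom_open : open cdom;
  cimg_open : open cimg;
  cfwd_img : forall p, cdom p -> cimg (cfwd p);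
  cbwd_dom : forall y, cimg y -> cdom (cbwd y);
  cfwdK : forall p, cdom p -> cbwd (cfwd p) = p;
  cbwdK : forall y, cimg y -> cfwd (cbwd y) = y;
  cfwd_cont : forall p, cdom p -> {for p, continuous cfwd};
  cbwd_cont : forall y, cimg y -> {for y, continuous cbwd} }.

Definition smooth_transition (M : topologicalType) n (c d : chart M n) : Prop :=
  forall i, smooth_on (cimg c `&` cbwd c @^-1` cdom d)
                      (fun y => cfwd d (cbwd c y) 0 i).

End Manifold.
Arguments chart : clear implicits.
Arguments cdom_open {R M n} c : rename.
Arguments cimg_open {R M n} c : rename.

(* A smooth atlas determines a unique maximal one, and every notion below
   depends on it only through the smooth functions; maximality is not
   required. *)
Record manifold (R : realType) := Manifold {
  mcarrier :> topologicalType;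
  mdim : nat;
  matlas : set (chart R mcarrier mdim);
  m_hausdorff : hausdorff_space mcarrier;
  m_second_countable : @second_countable mcarrier;
  m_cover : forall p, exists2 c, matlas c & cdom c p;
  m_compat : forall c d, matlas c -> matlas d -> smooth_transition c d }.

Section Tangent.
Context {R : realType} {M : manifold R}.
Implicit Types (f h : M -> R) (p : M).

Definition smooth f : Prop :=
  forall c, matlas c -> smooth_on (cimg c) (f \o cbwd c).

Lemma smoothD f h : smooth f -> smooth h -> smooth (f \+ h).
Proof.
by move=> sf sh c ac k; apply: CkD; [exact: cimg_open|exact: sf|exact: sh].
Qed.

Lemma smoothM f h : smooth f -> smooth h -> smooth (f \* h).
Proof.
by move=> sf sh c ac k; apply: CkM; [exact: cimg_open|exact: sf|exact: sh].
Qed.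

Lemma smooth_cst (a : R) : smooth (fun=> a).
Proof. by move=> c ac k; exact: Ck_cst. Qed.

Lemma smoothZ a f : smooth f -> smooth (a \*o f).
Proof. by move=> sf; exact: (smoothM (smooth_cst a) sf). Qed.

(* Tangent vectors are derivations of the algebra of smooth functions.  They
   act on all functions, with value 0 on those that are not smooth, so that
   two derivations agreeing on smooth functions are equal. *)
Record tangent (p : M) := Tangent {
  tact :> (M -> R) -> R;
  tactD : forall f h, smooth f -> smooth h -> tact (f \+ h) = tact f + tact h;
  tactZ : forall a f, smooth f -> tact (a \*o f) = a * tact f;
  tactM : forall f h, smooth f -> smooth h ->
    tact (f \* h) = f p * tact h + h p * tact f;
  tact_out : forall f, ~ smooth f -> tact f = 0 }.

Lemma tangent_ext p (u v : tangent p) :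
  (forall f, smooth f -> u f = v f) -> u = v.
Proof.
move=> uv; have : tact u = tact v.
  apply/funext => f; have [/uv//|nf] := pselect (smooth f).
  by rewrite !tact_out.
case: u v {uv} => u u1 u2 u3 u4 [v v1 v2 v3 v4] /= uv.
by rewrite -uv in v1 v2 v3 v4 *; congr Tangent; exact: Prop_irrelevance.
Qed.

HB.instance Definition _ p := gen_eqMixin (tangent p).
HB.instance Definition _ p := gen_choiceMixin (tangent p).

Section TangentSpace.
Local Obligation Tactic := idtac.
Variable p : M.

Program Definition tzero : tangent p := @Tangent p (fun=> 0) _ _ _ _.
Next Obligation. by move=> * /=; rewrite addr0. Qed.
Next Obligation. by move=> * /=; rewrite mulr0. Qed.
Next Obligation. by move=> * /=; rewrite !mulr0 addr0. Qed.
Next Obligation. by []. Qed.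

Program Definition topp (u : tangent p) : tangent p :=
  @Tangent p (fun f => - u f) _ _ _ _.
Next Obligation. by move=> u f h sf sh /=; rewrite tactD// opprD. Qed.
Next Obligation. by move=> u a f sf /=; rewrite tactZ// mulrN. Qed.
Next Obligation. by move=> u f h sf sh /=; rewrite tactM// opprD !mulrN. Qed.
Next Obligation. by move=> u f nf /=; rewrite tact_out// oppr0. Qed.

Program Definition tadd (u v : tangent p) : tangent p :=
  @Tangent p (fun f => u f + v f) _ _ _ _.
Next Obligation. by move=> u v f h sf sh /=; rewrite !tactD// addrACA. Qed.
Next Obligation. by move=> u v a f sf /=; rewrite !tactZ// mulrDr. Qed.
Next Obligation.
by move=> u v f h sf sh /=; rewrite !tactM// !mulrDr addrACA.
Qed.
Next Obligation. by move=> u v f nf /=; rewrite !tact_out// addr0. Qed.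

Program Definition tscale (a : R) (u : tangent p) : tangent p :=
  @Tangent p (fun f => a * u f) _ _ _ _.
Next Obligation. by move=> a u f h sf sh /=; rewrite tactD// mulrDr. Qed.
Next Obligation. by move=> a u b f sf /=; rewrite tactZ// mulrCA. Qed.
Next Obligation.
move=> a u f h sf sh /=; rewrite tactM// mulrDr.
by rewrite (mulrCA a (f p)) (mulrCA a (h p)).
Qed.
Next Obligation. by move=> a u f nf /=; rewrite tact_out// mulr0. Qed.

Lemma taddA : associative tadd.
Proof. by move=> u v w; apply: tangent_ext => f _ /=; rewrite addrA. Qed.
Lemma taddC : commutative tadd.
Proof. by move=> u v; apply: tangent_ext => f _ /=; rewrite addrC. Qed.
Lemma tadd0 : left_id tzero tadd.
Proof. by move=> u; apply: tangent_ext => f _ /=; rewrite add0r. Qed.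
Lemma taddN : left_inverse tzero topp tadd.
Proof. by move=> u; apply: tangent_ext => f _ /=; rewrite addNr. Qed.

HB.instance Definition _ :=
  GRing.isZmodule.Build (tangent p) taddA taddC tadd0 taddN.

Lemma tscaleA a b (u : tangent p) : tscale a (tscale b u) = tscale (a * b) u.
Proof. by apply: tangent_ext => f _ /=; rewrite mulrA. Qed.
Lemma tscale1 : left_id 1 tscale.
Proof. by move=> u; apply: tangent_ext => f _ /=; rewrite mul1r. Qed.
Lemma tscaleDr : right_distributive tscale +%R.
Proof. by move=> a u v; apply: tangent_ext => f _ /=; rewrite mulrDr. Qed.
Lemma tscaleDl (u : tangent p) : {morph tscale^~ u : a b / a + b}.
Proof. by move=> a b; apply: tangent_ext => f _ /=; rewrite mulrDl. Qed.

HB.instance Definition _ := GRing.Zmodule_isLmodule.Build R (tangent p)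
  tscaleA tscale1 tscaleDr tscaleDl.

End TangentSpace.

Definition tbasis p n (e : 'I_n -> tangent p) : Prop :=
  forall v, exists! a : {ffun 'I_n -> R}, v = \sum_i a i *: e i.

Record vfield := VField {
  vval :> forall p, tangent p;
  vval_smooth : forall f, smooth f -> smooth (fun p => vval p f) }.

Definition lie (X : vfield) f : M -> R := fun p => X p f.

Lemma lieD (X : vfield) f h : smooth f -> smooth h ->
  lie X (f \+ h) = lie X f \+ lie X h.
Proof. by move=> sf sh; apply/funext => p; rewrite /lie/= tactD. Qed.

Lemma lieZ (X : vfield) a f : smooth f -> lie X (a \*o f) = a \*o lie X f.
Proof. by move=> sf; apply/funext => p; rewrite /lie/= tactZ. Qed.

Lemma lieM (X : vfield) f h : smooth f -> smooth h ->
  lie X (f \* h) = (f \* lie X h) \+ (h \* lie X f).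
Proof. by move=> sf sh; apply/funext => p; rewrite /lie/= tactM. Qed.

Lemma smooth_lie (X : vfield) f : smooth f -> smooth (lie X f).
Proof. exact: vval_smooth. Qed.

Section Bracket.
Variables X Y : vfield.

Definition bracket_act p f : R :=
  if `[< smooth f >] then X p (lie Y f) - Y p (lie X f) else 0.

Lemma bracket_actE p f : smooth f ->
  bracket_act p f = X p (lie Y f) - Y p (lie X f).
Proof. by move=> sf; rewrite /bracket_act asboolT. Qed.

Lemma bracket_actD p f h : smooth f -> smooth h ->
  bracket_act p (f \+ h) = bracket_act p f + bracket_act p h.
Proof.
move=> sf sh; rewrite !bracket_actE//; last exact: smoothD.
rewrite !lieD// !tactD; try exact: smooth_lie.
by rewrite opprD addrACA.
Qed.

Lemma bracket_actZ p a f : smooth f -> bracket_act p (a \*o f) = a * bracket_act p f.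
Proof.
move=> sf; rewrite !bracket_actE//; last exact: smoothZ.
rewrite !lieZ// !tactZ; try exact: smooth_lie.
by rewrite mulrBr.
Qed.

Lemma bracket_actM p f h : smooth f -> smooth h ->
  bracket_act p (f \* h) = f p * bracket_act p h + h p * bracket_act p f.
Proof.
move=> sf sh; rewrite !bracket_actE//; last exact: smoothM.
have sX := smooth_lie X; have sY := smooth_lie Y; have sM := smoothM.
rewrite !lieM//.
rewrite (tactD (X p)) ?(tactM (X p)); auto.
rewrite (tactD (Y p)) ?(tactM (Y p)); auto.
rewrite /lie /=; ring.
Qed.

Lemma bracket_act_out p f : ~ smooth f -> bracket_act p f = 0.
Proof. by move=> nf; rewrite /bracket_act asboolF. Qed.

Definition bracket_val p : tangent p :=
  Tangent (@bracket_actD p) (@bracket_actZ p) (@bracket_actM p)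
          (@bracket_act_out p).

Lemma bracket_smooth f : smooth f -> smooth (fun p => bracket_val p f).
Proof.
move=> sf; have -> : (fun p => bracket_val p f) =
    lie X (lie Y f) \+ ((-1) \*o lie Y (lie X f)).
  by apply/funext => p /=; rewrite bracket_actE// mulN1r.
by apply: smoothD; last apply: smoothZ; do 2 apply: smooth_lie.
Qed.

Definition bracket : vfield := VField bracket_smooth.

End Bracket.

End Tangent.
Arguments vfield {R} M.

Section SemiRiemannian.
Context {R : realType} {M : manifold R}.
Implicit Types X Y Z T : vfield M.

Definition tensor02 := forall p : M, tangent p -> tangent p -> R.

(* The metric may be degenerate and its signature may vary. *)
Definition semi_riemannian (g : tensor02) : Prop :=
  [/\ forall p u v, g p u v = g p v u,
      forall p v, scalar (fun u => g p u v)
    & forall X Y, smooth (fun p => g p (X p) (Y p))].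

Definition nondegenerate_metric (g : tensor02) : Prop :=
  forall p u, (forall v, g p u v = 0) -> u = 0.

(* Sylvester type of g at p: r, s, t count the null, negative and positive
   vectors of an orthogonal basis. *)
Definition has_signature (g : tensor02) (p : M) (r s t : nat) : Prop :=
  exists e : 'I_(mdim M) -> tangent p,
    [/\ tbasis e, forall i j, i != j -> g p (e i) (e j) = 0,
        #|[pred i | g p (e i) (e i) == 0]| = r,
        #|[pred i | g p (e i) (e i) < 0]| = s
      & #|[pred i | g p (e i) (e i) > 0]| = t].

Definition constant_signature_near (g : tensor02) (p : M) : Prop :=
  exists r s t, \forall q \near p, has_signature g q r s t.

Section Koszul.
Variable g : tensor02.
Arguments g : clear implicits.

Let ip X Y : M -> R := fun p => g p (X p) (Y p).

Definition koszul X Y Z : M -> R := fun p =>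
  2^-1 * (lie X (ip Y Z) p + lie Y (ip Z X) p - lie Z (ip X Y) p
          - ip X (bracket Y Z) p + ip Y (bracket Z X) p
          + ip Z (bracket X Y) p).

(* A 1-form is given by its values on vector fields, as a smooth-function-
   linear map from vector fields to smooth functions. *)
Definition preform := vfield M -> M -> R.

Definition one_form (w : preform) : Prop :=
  (forall X, smooth (w X)) /\
  forall f X Y Z, smooth f -> (forall p, Z p = f p *: X p + Y p) ->
    forall p, w Z p = f p * w X p + w Y p.

Definition represents p (u : tangent p) (w : preform) : Prop :=
  forall Y, w Y p = g p u (Y p).

Definition Abullet (w : preform) : Prop :=
  one_form w /\ forall p, exists u : tangent p, represents u w.

(* The pointwise contraction; its value does not depend on the choice of the
   representing vectors u and v, and it is 0 by convention if there are none. *)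
Definition cocontraction (w t : preform) (p : M) : R :=
  xget 0 [set a | exists u v : tangent p,
                    [/\ represents u w, represents v t & a = g p u v]].

Definition lower_deriv X Y : preform := koszul X Y.

Definition cov_deriv X (w : preform) : preform := fun Y p =>
  lie X (w Y) p - cocontraction (lower_deriv X Y) w p.

(* At points where the signature is not locally constant, the covariant
   derivative is not given by the pointwise contraction, but by the smooth
   extension from the dense open set of points where the formula applies. *)
Definition cov_deriv_in_Abullet X (w : preform) : Prop :=
  exists2 eta, Abullet eta &
    forall Y p, constant_signature_near g p -> eta Y p = cov_deriv X w Y p.

Definition semi_regular : Prop :=
  (forall X Y, Abullet (lower_deriv X Y)) /\
  (forall X Y Z, cov_deriv_in_Abullet Z (lower_deriv X Y)).

End Koszul.
End SemiRiemannian.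
Arguments tensor02 {R} M.

Section Differential.
Context {R : realType} {M N : manifold R}.

(* For maps between manifolds this is equivalent to smoothness in charts. *)
Definition smooth_map (phi : M -> N) : Prop :=
  forall h : N -> R, smooth h -> smooth (h \o phi).

Variables (phi : M -> N) (sphi : smooth_map phi) (p : M) (u : tangent p).

Definition differential_act (h : N -> R) : R :=
  if `[< smooth h >] then u (h \o phi) else 0.

Lemma differential_actE h : smooth h -> differential_act h = u (h \o phi).
Proof. by move=> sh; rewrite /differential_act asboolT. Qed.

Lemma differential_actD h k : smooth h -> smooth k ->
  differential_act (h \+ k) = differential_act h + differential_act k.
Proof.
move=> sh sk; rewrite !differential_actE//; last exact: smoothD.
by rewrite -tactD//; apply: sphi.
Qed.

Lemma differential_actZ a h : smooth h ->
  differential_act (a \*o h) = a * differential_act h.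
Proof.
move=> sh; rewrite !differential_actE//; last exact: smoothZ.
by rewrite -tactZ//; apply: sphi.
Qed.

Lemma differential_actM h k : smooth h -> smooth k ->
  differential_act (h \* k) =
    h (phi p) * differential_act k + k (phi p) * differential_act h.
Proof.
move=> sh sk; rewrite !differential_actE//; last exact: smoothM.
by have := tactM u (sphi sh) (sphi sk).
Qed.

Lemma differential_act_out h : ~ smooth h -> differential_act h = 0.
Proof. by move=> nh; rewrite /differential_act asboolF. Qed.

Definition differential : tangent (phi p) :=
  Tangent differential_actD differential_actZ differential_actM
          differential_act_out.

End Differential.


Lemma open_forall (T : topologicalType) (I : finType) (A : I -> set T) :
  (forall i, open (A i)) -> open [set x | forall i, A i x].
Proof.
move=> oA; rewrite openE => x Ax.
apply: (@filter_forall _ I (fun i => A i) (nbhs x) (nbhs_filter x)) => i.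
exact: open_nbhs_nbhs.
Qed.

Section CoordinateBlock.
Context {R : realType} {m n : nat} (s : 'I_n -> 'I_m).
Hypothesis s_inj : injective s.

Lemma colsub_continuous : continuous (colsub s : 'rV[R]_m -> 'rV[R]_n).
Proof.
move=> x; apply: mx_continuous_at => i j.
apply: (@eq_continuous_at _ _ (fun t : 'rV[R]_m => t i (s j))) => [t|].
  by rewrite mxE.
exact: mx_entry_continuous.
Qed.

Lemma open_colsub (V : set 'rV[R]_n) : open V ->
  open ((colsub s : 'rV[R]_m -> 'rV[R]_n) @^-1` V).
Proof.
rewrite !openE => oV x Vx; apply: (@colsub_continuous x); exact: oV.
Qed.

Lemma smooth_on_colsub (V : set 'rV[R]_n) (U : set 'rV[R]_m) h :
  U `<=` colsub s @^-1` V -> smooth_on V h -> smooth_on U (h \o colsub s).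
Proof.
move=> UV sh k; apply: Ck_sub UV _; apply: Ck_proj => [|i|//].
  exact: colsub_continuous.
have [[j ij]|ni] := pselect (exists j, i = s j); [right; exists j|left].
  apply/rowP => a; rewrite !mxE ij /=; congr (_%:R).
  by rewrite (inj_eq s_inj).
apply/rowP => a; rewrite !mxE /=; case: eqP => //= ai.
by case: ni; exists a.
Qed.

End CoordinateBlock.

Section Product.
Context {R : realType} (B : manifold R) (l : nat) (F : 'I_l -> manifold R).

Definition prod_carrier : topologicalType :=
  (B * prod_topology (fun j => F j))%type.

Definition prod_dim : nat := (mdim B + \sum_j mdim (F j))%N.

Definition idxB (a : 'I_(mdim B)) : 'I_prod_dim := lshift _ a.
Definition idxF (j : 'I_l) (a : 'I_(mdim (F j))) : 'I_prod_dim :=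
  rshift _ (tagnat.Rank j a).
Arguments idxF : clear implicits.

Lemma idxB_inj : injective idxB. Proof. exact: lshift_inj. Qed.
Lemma idxF_inj j : injective (idxF j).
Proof.
by move=> a b /rshift_inj /tagnat.rank_inj /eqP; rewrite eq_Tagged => /eqP.
Qed.

Definition blockB (y : 'rV[R]_prod_dim) : 'rV[R]_(mdim B) := colsub idxB y.
Definition blockF j (y : 'rV[R]_prod_dim) : 'rV[R]_(mdim (F j)) :=
  colsub (idxF j) y.
Definition unblock (b : 'rV[R]_(mdim B)) (x : forall j, 'rV[R]_(mdim (F j))) :
  'rV[R]_prod_dim := row_mx b (\mxrow_j x j).

Lemma unblockB b x : blockB (unblock b x) = b.
Proof. by apply/rowP => a; rewrite mxE row_mxEl. Qed.

Lemma unblockF b x j : blockF j (unblock b x) = x j.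
Proof.
by rewrite -[RHS](mxrowK x); apply/rowP => a; rewrite mxE row_mxEr !mxE.
Qed.

Lemma idxP (k : 'I_prod_dim) :
  (exists a, k = idxB a) \/ (exists j a, k = idxF j a).
Proof.
case: (split_ordP k) => a ->; first by left; exists a.
by right; exists (tagnat.sig1 a), (tagnat.sig2 a); rewrite /idxF tagnat.sig2K.
Qed.

Lemma block_ext y y' :
  blockB y = blockB y' -> (forall j, blockF j y = blockF j y') -> y = y'.
Proof.
move=> yB yF; apply/rowP => k; have [[a ->]|[j [a ->]]] := idxP k.
  by move/rowP/(_ a): yB; rewrite !mxE.
by move/rowP/(_ a): (yF j); rewrite !mxE.
Qed.

Lemma fst_cvg (p : prod_carrier) : (fun q : prod_carrier => q.1) @ p --> p.1.
Proof. exact: cvg_fst. Qed.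

Lemma snd_cvg (p : prod_carrier) j :
  (fun q : prod_carrier => q.2 j) @ p --> p.2 j.
Proof.
apply: (@continuous_comp _ _ _ (fun q : prod_carrier => q.2)
  (fun x : prod_topology (fun j => F j) => x j)).
  exact: cvg_snd.
exact: proj_topology_continuous.
Qed.

Section ProductChart.
Variables (c : chart R B (mdim B)) (d : forall j, chart R (F j) (mdim (F j))).

Definition prod_dom : set prod_carrier :=
  [set p | cdom c p.1 /\ forall j, cdom (d j) (p.2 j)].
Definition prod_img : set 'rV[R]_prod_dim :=
  [set y | cimg c (blockB y) /\ forall j, cimg (d j) (blockF j y)].
Definition prod_fwd (p : prod_carrier) : 'rV[R]_prod_dim :=
  unblock (cfwd c p.1) (fun j => cfwd (d j) (p.2 j)).
Definition prod_bwd (y : 'rV[R]_prod_dim) : prod_carrier :=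
  (cbwd c (blockB y), fun j => cbwd (d j) (blockF j y)).

Lemma prod_dom_open : open prod_dom.
Proof.
apply: openI.
  by apply: (@open_comp _ _ (fun q : prod_carrier => q.1) _ _ (cdom_open c)) => p _; exact: fst_cvg.
apply: open_forall => j.
by apply: (@open_comp _ _ (fun q : prod_carrier => q.2 j) _ _ (cdom_open (d j))) => p _; exact: snd_cvg.
Qed.

Lemma prod_img_open : open prod_img.
Proof.
apply: openI.
  exact: (@open_colsub R _ _ idxB _ (cimg_open c)).
apply: open_forall => j.
exact: (@open_colsub R _ _ (idxF j) _ (cimg_open (d j))).
Qed.

Lemma prod_fwd_img p : prod_dom p -> prod_img (prod_fwd p).
Proof.
move=> [pc pd]; split=> [|j].
  by rewrite unblockB; exact: cfwd_img.
by rewrite unblockF; exact: cfwd_img.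
Qed.

Lemma prod_bwd_dom y : prod_img y -> prod_dom (prod_bwd y).
Proof. by move=> [yc yd]; split=> [|j] /=; exact: cbwd_dom. Qed.

Lemma prod_fwdK p : prod_dom p -> prod_bwd (prod_fwd p) = p.
Proof.
case: p => b x [/= pc pd]; rewrite /prod_bwd unblockB cfwdK//=; congr pair.
by apply: functional_extensionality_dep => j; rewrite unblockF cfwdK.
Qed.

Lemma prod_bwdK y : prod_img y -> prod_fwd (prod_bwd y) = y.
Proof.
move=> [yc yd]; apply: block_ext => [|j].
  by rewrite unblockB cbwdK.
by rewrite unblockF cbwdK.
Qed.

Lemma prod_fwd_cont p : prod_dom p -> {for p, continuous prod_fwd}.
Proof.
move=> [pc pd]; apply: mx_continuous_at => i k; rewrite (ord1 i) {i}.
have [[a ->]|[j [a ->]]] := idxP k.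
  have E q : prod_fwd q 0 (idxB a) = cfwd c q.1 0 a.
    by have /rowP/(_ a) := unblockB (cfwd c q.1) (fun j => cfwd (d j) (q.2 j)); rewrite mxE.
  apply: (eq_continuous_at (fun q => esym (E q))).
  apply: (@continuous_comp _ _ _ (fun q : prod_carrier => q.1) (fun b => cfwd c b 0 a)).
    exact: fst_cvg.
  apply: (@continuous_comp _ _ _ (cfwd c) (fun y => y 0 a)); first exact: cfwd_cont.
  exact: mx_entry_continuous.
have E q : prod_fwd q 0 (idxF j a) = cfwd (d j) (q.2 j) 0 a.
  by have /rowP/(_ a) := unblockF (cfwd c q.1) (fun j => cfwd (d j) (q.2 j)) j; rewrite mxE.
apply: (eq_continuous_at (fun q => esym (E q))).
apply: (@continuous_comp _ _ _ (fun q : prod_carrier => q.2 j) (fun b => cfwd (d j) b 0 a)).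
  exact: snd_cvg.
apply: (@continuous_comp _ _ _ (cfwd (d j)) (fun y => y 0 a)); first exact: cfwd_cont.
exact: mx_entry_continuous.
Qed.

Lemma prod_bwd_cont y : prod_img y -> {for y, continuous prod_bwd}.
Proof.
move=> [yc yd]; apply: pair_continuous_at.
  apply: (@continuous_comp _ _ _ blockB (cbwd c)); last exact: cbwd_cont.
  exact: colsub_continuous.
apply: prod_topology_continuous_at => j /=.
apply: (@continuous_comp _ _ _ (blockF j) (cbwd (d j))); last exact: cbwd_cont.
exact: colsub_continuous.
Qed.

Definition prod_chart : chart R prod_carrier prod_dim :=
  Chart prod_dom_open prod_img_open prod_fwd_img prod_bwd_dom prod_fwdK
    prod_bwdK prod_fwd_cont prod_bwd_cont.

End ProductChart.

Definition prod_atlas : set (chart R prod_carrier prod_dim) :=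
  [set C | exists c d, [/\ matlas c, forall j, matlas (d j) & C = prod_chart c d]].

Lemma prod_hausdorff : hausdorff_space prod_carrier.
Proof.
move=> p q pq; have pq1 : p.1 = q.1.
  apply: (@m_hausdorff _ B) => A A' pA qA'.
  have [r [/= rA rA']] := pq _ _ (fst_cvg pA) (fst_cvg qA').
  by exists r.1.
have pq2 : p.2 = q.2.
  apply: functional_extensionality_dep => j.
  apply: (@m_hausdorff _ (F j)) => A A' pA qA'.
  have [r [/= rA rA']] := pq _ _ (snd_cvg pA) (snd_cvg qA').
  by exists (r.2 j).
by rewrite [p]surjective_pairing pq1 pq2 -surjective_pairing.
Qed.

Lemma countable_basis_enum (T : topologicalType) : @second_countable T ->
  exists e : nat -> set T, (forall n, open (e n)) /\
    forall x A, nbhs x A -> exists n, e n x /\ e n `<=` A.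
Proof.
move=> [D cD [oD bD]]; have [i iP] := pcard_injP cD.
exists (fun n => xget set0 [set V | D V /\ i V = n]); split.
  by move=> n; case: xgetP => [V _ [/oD]|_] //; exact: open0.
move=> x A /bD [V [DV Vx] VA]; exists (i V); case: xgetP => [W _ [DW iW]|/(_ V)].
  suff -> : W = V by [].
  by apply: iP => //; rewrite inE.
by case; split.
Qed.

Lemma prod_second_countable : @second_countable prod_carrier.
Proof.
have [eB [oB bB]] := countable_basis_enum (@m_second_countable _ B).
have eF_ex j := cid (countable_basis_enum (@m_second_countable _ (F j))).
pose eF j := projT1 (eF_ex j).
have oF j n : open (eF j n) by case: (projT2 (eF_ex j)) => H _; exact: H.
have bF j (x : F j) A : nbhs x A -> exists n, eF j n x /\ eF j n `<=` A.
  by move: (projT2 (eF_ex j)) => [_ H]; exact: H.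
pose box (k : nat * {ffun 'I_l -> nat}) : set prod_carrier :=
  [set p | eB k.1 p.1 /\ forall j, eF j (k.2 j) (p.2 j)].
exists (range box); first exact: card_le_trans (card_image_le _ _) (countableP _).
split=> [_ [k _ <-]|p A].
  apply: openI.
    by apply: (@open_comp _ _ (fun q : prod_carrier => q.1) _ _ (oB k.1)) => p _; exact: fst_cvg.
  apply: open_forall => j.
  by apply: (@open_comp _ _ (fun q : prod_carrier => q.2 j) _ _ (oF j (k.2 j))) => p _; exact: snd_cvg.
move=> [[U V] /= [pU pV] UVA].
have [W pW WV] := nbhs_prod_topology pV.
have [nB [nB1 nB2]] := bB _ _ pU.
have nF_ex j := cid (bF j _ _ (pW j)).
pose nF := [ffun j => projT1 (nF_ex j)].
have nFP j : eF j (nF j) (p.2 j) /\ eF j (nF j) `<=` W j.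
  by rewrite ffunE; exact: projT2 (nF_ex j).
exists (box (nB, nF)).
  by split; [exists (nB, nF)|split=> // j; have [] := nFP j].
move=> [b x] [/= bU xF]; apply: (UVA (b, x)); split=> /=; first exact: nB2.
by apply: WV => j; have [_] := nFP j; apply.
Qed.

Lemma prod_cover p : exists2 C, prod_atlas C & cdom C p.
Proof.
have [c ac pc] := m_cover p.1.
have d j := cid2 (m_cover (p.2 j)).
exists (prod_chart c (fun j => s2val (d j))).
  by exists c, (fun j => s2val (d j)); split=> // j; exact: s2valP (d j).
by split=> //= j; exact: s2valP' (d j).
Qed.

Lemma prod_compat C D : prod_atlas C -> prod_atlas D -> smooth_transition C D.
Proof.
move=> [c [d [ac ad ->]]] [c' [d' [ac' ad' ->]]] k.
have [[a ->]|[j [a ->]]] := idxP k.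
  suff -> : (fun y => cfwd (prod_chart c' d') (cbwd (prod_chart c d) y) 0 (idxB a))
          = (fun y => cfwd c' (cbwd c y) 0 a) \o blockB.
    apply: (smooth_on_colsub idxB_inj _ (m_compat ac ac' a)).
    by move=> y [/= [yc _] [yc' _]].
  apply/funext => y /=.
  by have /rowP/(_ a) := unblockB (cfwd c' (cbwd c (blockB y)))
    (fun j => cfwd (d' j) (cbwd (d j) (blockF j y))); rewrite mxE.
suff -> : (fun y => cfwd (prod_chart c' d') (cbwd (prod_chart c d) y) 0 (idxF j a))
        = (fun y => cfwd (d' j) (cbwd (d j) y) 0 a) \o blockF j.
  apply: (smooth_on_colsub (@idxF_inj j) _ (m_compat (ad j) (ad' j) a)).
  by move=> y [/= [_ yd] [_ yd']]; split; [exact: yd|exact: yd'].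
apply/funext => y /=.
by have /rowP/(_ a) := unblockF (cfwd c' (cbwd c (blockB y)))
  (fun j => cfwd (d' j) (cbwd (d j) (blockF j y))) j; rewrite mxE.
Qed.

Definition product_manifold : manifold R :=
  Manifold prod_hausdorff prod_second_countable prod_cover prod_compat.

Definition projB (p : product_manifold) : B := p.1.
Definition projF j (p : product_manifold) : F j := p.2 j.

Lemma projB_smooth : smooth_map projB.
Proof.
move=> h sh _ [c [d [ac ad ->]]].
apply: (smooth_on_colsub idxB_inj _ (sh _ ac)).
by move=> y [].
Qed.

Lemma projF_smooth j : smooth_map (projF j).
Proof.
move=> h sh _ [c [d [ac ad ->]]].
apply: (smooth_on_colsub (@idxF_inj j) _ (sh _ (ad j))).
by move=> y [_]; exact.
Qed.

Definition warped_metric (gB : tensor02 B) (f : 'I_l -> B -> R)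
    (gF : forall j, tensor02 (F j)) : tensor02 product_manifold :=
  fun p u v =>
    gB (projB p) (differential projB_smooth u) (differential projB_smooth v) +
    \sum_(j < l) (f j (projB p)) ^+ 2 *
      gF j (projF j p) (differential (@projF_smooth j) u)
                       (differential (@projF_smooth j) v).

End Product.
Arguments warped_metric {R B l F} gB f gF p u v.

(* Main.v *)
(**
Near any point the product carries a frame whose fields project to fields of
[B] and of the [F j]; on such split fields the Koszul form is the one of [B]
plus, for each [j], [f_j^2] times the Koszul form of [F j] and [f_j] times
terms in [df_j] and [g_j].  As [g] contains [f_j^2 g_j], a form with a factor
[f_j] in the fibre direction is represented by [f_j^-1] times a fibre vector,
which gives the first condition of semi-regularity; no [f_j] has to be nonzero.

The same factors appear in the covariant derivative: written out where all
[f_j] are nonzero, [nabla_Z (nabla^flat_X Y)] has no denominators and every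
fibre term keeps a factor [f_j].  This explicit form is smooth and represented
everywhere, and it must be compared with the pointwise contraction at a point
of constant signature.  There the index of [g] is the index of [g_B] plus those
of the [g_j] with [f_j <> 0].  Hence if [f_j <> 0], then [g_j] has constant
signature too; and if [f_j = 0], then [f_j] vanishes nearby or [g_j] vanishes at
the point, since otherwise the index would jump up at nearby points, and either way the
terms of [F j] agree.

Locally defined extensions are glued because the points of constant signature
are dense (the indices are lower semicontinuous and bounded).
*)

From HB Require Import structures.
Require Import Defs.
From mathcomp Require Import all_boot all_order all_algebra.
From mathcomp Require Import all_classical reals topology normedtype derive.
From mathcomp Require Import ring lra.
From mathcomp Require Import all_analysis.

Set Implicit Arguments.
Unset Strict Implicit.
Unset Printing Implicit Defensive.

Import Order.TTheory GRing.Theory Num.Theory.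
Import numFieldNormedType.Exports.

Local Open Scope classical_set_scope.
Local Open Scope ring_scope.

(** * Calculus on open subsets of R^n *)

Section CkBasics.
Context {R : realType} {n : nat}.
Implicit Types (U V : set 'rV[R]_n) (f g : 'rV[R]_n -> R).

(** Tangent vectors are derivations acting on globally smooth functions, whereas charts give local
    data. Hadamard's lemma shows that a derivation is a combination of coordinate derivations, and
    bump functions turn local functions and frames into global ones. Both conditions of
    semi-regularity are then reduced to frame fields, since an arbitrary field of the product
    projects to no field of a factor. The Koszul form is not tensorial in its second slot, so this
    reduction produces Leibniz terms.

    Zeros of [f j] are handled by the convention that the inverse of 0 is 0: the identity
    [f ^+ 2 * f^-1 = f] then holds everywhere, so representing vectors and all terms of first order
    in [f^-1] need no case distinction. Only [f ^+ 2 * f^-1 ^+ 2], which is 1 or 0, depends on the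
    point; constant signature makes the terms that it multiplies vanish at the zeros of [f j].

    Nondegeneracy of the base turns the differential of [f j] and the base Koszul forms into smooth
    fields, which can enter a Koszul form again. This is how the second derivatives of the base are
    expressed tensorially. *)

Lemma Ck_local k U f :
  (forall x, U x -> exists V, [/\ open V, V x & Ck k V f]) -> Ck k U f.
Proof.
elim: k f => [|k IH] f loc.
  by split=> // x /loc[V [oV Vx Cf]]; exact: (Ck_cont Cf).
split=> [x /loc[V [oV Vx Cf]]|i]; first exact: (Ck_cont Cf).
split=> [x /loc[V [oV Vx [_ /(_ i)[D _]]]]|]; first exact: D.
by apply: IH => x /loc[V [oV Vx [_ /(_ i)[_ D]]]]; exists V.
Qed.

Lemma derivable_coord (j : 'I_n) x v : derivable (fun y : 'rV[R]_n => y 0 j) x v.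
Proof. exact/diff_derivable/differentiable_coord. Qed.

Lemma partial_coord (i j : 'I_n) x :
  partial i (fun y : 'rV[R]_n => y 0 j) x = (i == j)%:R.
Proof.
rewrite /partial deriveE; last exact: differentiable_coord.
have lin : linear (fun y : 'rV[R]_n => y 0 j : R^o).
  by move=> a u v; rewrite !mxE.
pose H := GRing.isLinear.Build R 'rV[R]_n R^o *:%R (fun y : 'rV[R]_n => y 0 j : R^o) lin.
pose L : {linear 'rV[R]_n -> R^o} := HB.pack (fun y : 'rV[R]_n => y 0 j : R^o) H.
rewrite (@diff_lin R 'rV[R]_n R^o L x); last exact: mx_entry_continuous.
by rewrite /L /= mxE eqxx eq_sym.
Qed.

Lemma Ck_coord k U (j : 'I_n) : Ck k U (fun y => y 0 j).
Proof.
case: k => [|k]; first by split=> // x _; exact: mx_entry_continuous.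
split=> [x _|i]; first exact: mx_entry_continuous.
split=> [x _|]; first exact: derivable_coord.
have -> : partial i (fun y : 'rV[R]_n => y 0 j) = fun=> (i == j)%:R.
  by apply/funext => x; exact: partial_coord.
exact: Ck_cst.
Qed.

Lemma CkZ k U (a : R) f : open U -> Ck k U f -> Ck k U (fun x => a * f x).
Proof. by move=> oU Cf; apply: (CkM oU (Ck_cst _ _ a) Cf). Qed.

Lemma CkN k U f : open U -> Ck k U f -> Ck k U (fun x => - f x).
Proof.
move=> oU Cf; apply: (@Ck_ext _ _ _ _ (fun x => -1 * f x)) => //; last exact: CkZ.
by move=> x _; rewrite mulN1r.
Qed.

Lemma CkB k U f g : open U -> Ck k U f -> Ck k U g -> Ck k U (fun x => f x - g x).
Proof. by move=> oU Cf Cg; apply: (CkD oU Cf); exact: CkN. Qed.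

Lemma Ck_sum k U (I : Type) (r : seq I) (P : pred I) (F : I -> 'rV[R]_n -> R) :
  open U -> (forall i, P i -> Ck k U (F i)) ->
  Ck k U (fun x => \sum_(i <- r | P i) F i x).
Proof.
move=> oU CF; elim: r => [|i r IH].
  by apply: (@Ck_ext _ _ _ _ (fun=> 0)) => // [x _|]; [rewrite big_nil|exact: Ck_cst].
apply: (@Ck_ext _ _ _ _ (fun x => (if P i then F i x else 0) + \sum_(i <- r | P i) F i x)) => //.
  by move=> x _; rewrite big_cons; case: ifP => //; rewrite add0r.
by apply: (CkD oU) => //; case Pi: (P i); [exact: CF|exact: Ck_cst].
Qed.

Lemma CkV k U f : open U -> (forall x, U x -> f x != 0) -> Ck k U f ->
  Ck k U (fun x => (f x)^-1).
Proof.
move=> oU f0; elim: k => [|k IH] Cf.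
  by split=> // x Ux; apply: continuousV; [exact: f0|exact: (Ck_cont Cf)].
split=> [x Ux|i]; first by apply: continuousV; [exact: f0|exact: (Ck_cont Cf)].
have [_ /(_ i)[D1 D2]] := Cf.
split=> [x Ux|]; first by apply: derivableV; [exact: f0|exact: D1].
have CV := IH (CkW Cf).
apply: (@Ck_ext _ _ _ _ (fun x => (- 1 * ((f x)^-1 * (f x)^-1)) * partial i f x)) => //.
  move=> x Ux; rewrite /partial deriveV; [|exact: f0|exact: D1].
  by rewrite -exprVn expr2 mulN1r.
by apply: (CkM oU) => //; apply: (CkZ _ oU); exact: (CkM oU CV CV).
Qed.

(** Lets one-variable theorems, such as the chain rule and differentiation under the integral sign,
    be applied along the line through [x]. *)
Lemma derive_line f x v : 'D_v f x = 'D_1 (fun h : R => f (h *: v + x)) 0.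
Proof.
rewrite /derive; set g1 := fun h => h^-1 *: _; set g2 := fun h => h^-1 *: _.
suff -> : g1 = g2 by [].
by rewrite funeqE /g1 /g2 => h /=; rewrite addr0 scale0r add0r [_%:A]mulr1.
Qed.

(* [D] lists the successive derivatives of [D 0]. *)
Lemma Ck_comp1 (D : nat -> R -> R) k U f : open U ->
  (forall m (t : R), is_derive t (1 : R) (D m : R -> R) (D m.+1 t)) -> Ck k U f ->
  forall m, Ck k U (fun x => D m (f x)).
Proof.
move=> oU DD.
have cD m t : {for t, continuous (D m)}.
  by apply: differentiable_continuous; apply/derivable1_diffP; have [] := DD m t.
have c0 m x : {for x, continuous f} -> {for x, continuous (fun x => D m (f x))}.
  by move=> cf; apply: (@continuous_comp _ _ _ f (D m)) => //; exact: cD.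
elim: k => [|k IH] Cf m; first by split=> // x Ux; apply: c0; exact: (Ck_cont Cf).
split=> [x Ux|i]; first by apply: c0; exact: (Ck_cont Cf).
have [_ /(_ i)[D1 D2]] := Cf.
have key x : U x -> is_derive x (delta_mx 0 i) (fun y => D m (f y))
    (D m.+1 (f x) * partial i f x).
  move=> Ux; have /derivable1P := D1 x Ux.
  set h : R -> R := fun t => f (t *: delta_mx 0 i + x) => dh.
  have h0 : h 0 = f x by rewrite /h scale0r add0r.
  have hd : is_derive (0 : R) 1 h (partial i f x).
    by apply: (DeriveDef dh); rewrite /partial derive_line.
  have dm : is_derive (h 0) 1 (D m) (D m.+1 (f x)) by rewrite h0; exact: DD.
  have Dh := @is_derive1_comp R (D m) h 0 _ _ dm hd.
  case: Dh => Dh1 Dh2.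
  have Ddf : derivable (fun y => D m (f y)) x (delta_mx 0 i) by apply/derivable1P.
  apply: (DeriveDef Ddf).
  by rewrite derive_line; exact: Dh2.
split=> [x /key[]//|].
apply: (@Ck_ext _ _ _ _ (fun x => D m.+1 (f x) * partial i f x)) => //.
  by move=> x /key[_]; rewrite /partial.
by apply: (CkM oU) => //; exact: (IH (CkW Cf)).
Qed.

End CkBasics.

(** * Boxes, slices and integrals along one coordinate *)

Section Box.
Context {R : realType} {n : nat}.
Implicit Types (q x : 'rV[R]_n).

(** Coordinatewise bounds are used so that moving one coordinate towards that of [q] stays
    inside. *)
Definition box q (r : R) : set 'rV[R]_n := [set x | forall j, `|x 0 j - q 0 j| < r].

Lemma box_open q r : open (box q r).
Proof.
apply: open_forall => j.
apply: (@open_comp _ _ (fun x : 'rV[R]_n => `|x 0 j - q 0 j|) [set t : R | t < r]);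
  last exact: open_lt.
move=> x _; apply: (@continuous_comp _ _ _ (fun x : 'rV[R]_n => x 0 j - q 0 j) (fun t : R => `|t|)).
  by apply: continuousB; [exact: mx_entry_continuous|exact: cst_continuous].
exact: norm_continuous.
Qed.

Lemma box_center q r : 0 < r -> box q r q.
Proof. by move=> r0 j; rewrite subrr normr0. Qed.

Lemma nbhs_box q (A : set 'rV[R]_n) : nbhs q A ->
  exists2 r, 0 < r & box q r `<=` A.
Proof.
move=> [P Pq PA].
have [r [r0 rP]] : exists r : R, 0 < r /\ forall j t, `|t - q 0 j| < r -> P 0 j t.
  have /choice[d dP] : forall j, exists d : R, 0 < d /\ forall t, `|t - q 0 j| < d -> P 0 j t.
    move=> j; have /nbhs_ballP[d /= d0 dP] := Pq 0 j.
    by exists d; split=> // t td; apply: dP; rewrite /ball/= distrC.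
  exists (\big[Order.min/1]_j d j); split.
    by apply: lt_bigmin => // j _; have [] := dP j.
  move=> j t tj; apply: (dP j).2; apply: lt_le_trans tj _.
  exact: bigmin_le_cond.
exists r => // x xq; apply: PA => i j; rewrite (ord1 i); exact: rP.
Qed.

(** Only the coordinate [a] moves, reaching that of [q] at [t = 0]. Treating one coordinate at a
    time, instead of a radial segment, keeps every derivative along the path a single partial
    derivative. *)
Definition slice q (a : 'I_n) (t : R) x : 'rV[R]_n :=
  \row_j (if j == a then q 0 a + t * (x 0 a - q 0 a) else x 0 j).

Lemma slice1 q a x : slice q a 1 x = x.
Proof. by apply/rowP => j; rewrite mxE; case: eqP => // ->; rewrite mul1r subrKC. Qed.

Lemma slice_box q a r t x : 0 <= t <= 1 -> box q r x -> box q r (slice q a t x).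
Proof.
move=> /andP[t0 t1] bx j; rewrite mxE; case: eqP => [->|_]; last exact: bx.
rewrite addrAC subrr add0r normrM ger0_norm// (le_lt_trans _ (bx a))//.
by rewrite ler_piMl.
Qed.

Lemma slice_shift q (a i : 'I_n) t s x :
  slice q a t (s *: delta_mx 0 i + x) =
  (s * (if i == a then t else 1)) *: delta_mx 0 i + slice q a t x.
Proof.
apply/rowP => j; rewrite !mxE /= [a == i]eq_sym; case: (eqVneq j a) => [->|ja].
  rewrite [a == i]eq_sym; case: eqP => _; rewrite ?mulr1 ?mulr0 ?add0r //; ring.
by case: (eqVneq j i) => [ji|_]; rewrite ?mulr0// -ji (negPf ja) !mulr1.
Qed.

Lemma slice_time q a t t0 x :
  slice q a t x = ((t - t0) * (x 0 a - q 0 a)) *: delta_mx 0 a + slice q a t0 x.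
Proof.
apply/rowP => j; rewrite !mxE /=; case: eqP => _; last by rewrite mulr0 add0r.
rewrite mulr1; ring.
Qed.

Lemma slice_cvg q a t x : (slice q a tx.1 tx.2) @[tx --> (t, x)] --> slice q a t x.
Proof.
have c1 : {for (t, x), continuous (fun tx : R * 'rV[R]_n => tx.1)} by exact: cvg_fst.
have c2 j : {for (t, x), continuous (fun tx : R * 'rV[R]_n => tx.2 0 j)}.
  apply: (@continuous_comp _ _ _ (fun tx : R * 'rV[R]_n => tx.2) (fun y => y 0 j)).
    exact: cvg_snd.
  exact: mx_entry_continuous.
apply: (@mx_continuous_at R (R * 'rV[R]_n)%type 1 n (fun tx => slice q a tx.1 tx.2) (t, x)).
move=> i j; rewrite /slice.
have -> : (fun tx : R * 'rV[R]_n => (\row_j (if j == a then q 0 a + tx.1 * (tx.2 0 a - q 0 a) else tx.2 0 j)) i j) =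
  (fun tx => if j == a then q 0 a + tx.1 * (tx.2 0 a - q 0 a) else tx.2 0 j).
  by apply/funext => tx; rewrite mxE.
case: eqP => // _.
apply: continuousD; first exact: cst_continuous.
apply: continuousM => //; apply: continuousB; [exact: c2|exact: cst_continuous].
Qed.

Lemma is_derive_line (F : 'rV[R]_n -> R) y v (c s0 : R) : derivable F y v ->
  is_derive s0 (1 : R) (fun s => F (((s - s0) * c) *: v + y)) ('D_v F y * c).
Proof.
move=> dF.
have dh : is_derive ((s0 - s0) * c) (1 : R) (fun h : R => F (h *: v + y)) ('D_v F y).
  rewrite subrr mul0r; move/derivable1P: dF => dF.
  by apply: (DeriveDef dF); rewrite -derive_line.
have dl : is_derive s0 (1 : R) (fun s => (s - s0) * c) c.
  have -> : (fun s => (s - s0) * c) = c *: ((id : R -> R) - cst s0).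
    by apply/funext => s; rewrite !fctE mulrC.
  apply: is_derive_eq.
  by rewrite subr0 /GRing.scale/= mulr1.
exact: (@is_derive1_comp R (fun h : R => F (h *: v + y)) (fun s : R => (s - s0) * c) s0 _ _ dh dl).
Qed.

(** The remainder factor in Hadamard's lemma is the case [m = 0]. The weight [t ^+ m] makes the
    family stable under partial derivatives, as the derivative along [a] brings out a factor [t]. *)
Definition slice_int q a m (F : 'rV[R]_n -> R) x : R :=
  \int[lebesgue_measure]_(t in `[0, 1]) (t ^+ m * F (slice q a t x)).

Section SliceInt.
Variables (q : 'rV[R]_n) (r : R) (a : 'I_n).
Let U := box q r.

(** Tube lemma: compactness of the time interval makes the neighbourhood of [x] independent of
    [t]. *)
Lemma slice_unif (F : 'rV[R]_n -> R) x (e : R) : (forall y, U y -> {for y, continuous F}) -> U x -> 0 < e ->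
  \forall x' \near x, forall t, 0 <= t <= 1 ->
    `|F (slice q a t x') - F (slice q a t x)| < e.
Proof.
move=> cF Ux e0.
have : near_covering [set t : R | 0 <= t <= 1].
  apply/compact_near_coveringP.
  have -> : [set t : R | 0 <= t <= 1] = `[0, 1]%classic.
    by apply/seteqP; split => t /=; rewrite in_itv.
  exact: segment_compact.
move/(_ _ (nbhs x) (fun x' t => `|F (slice q a t x') - F (slice q a t x)| < e)).
apply=> t t01.
have e2 : 0 < e / 2 by rewrite divr_gt0.
have cFt := cF _ (slice_box a t01 Ux).
have c1 : (F (slice q a tx.1 tx.2)) @[tx --> (t, x)] --> F (slice q a t x).
  exact: (cvg_comp _ _ (@slice_cvg q a t x) cFt).
have c2 : (F (slice q a s x)) @[s --> t] --> F (slice q a t x).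
  have : (fun s : R => (s, x)) @ t --> (t, x).
    by apply: (@pair_continuous_at _ _ _ id (fun=> x) t); [exact: cvg_id|exact: cvg_cst].
  by move=> /cvg_comp/(_ c1).
have /cvgrPdist_lt/(_ _ e2) n1 := c1.
have /cvgrPdist_lt/(_ _ e2) n2 := c2.
have n2' : \forall tx \near (t, x), `|F (slice q a t x) - F (slice q a tx.1 x)| < e / 2.
  exact: (cvg_fst n2).
near=> tx.
rewrite -(subrKA (F (slice q a t x))) [e]splitr (le_lt_trans (ler_normD _ _))//.
rewrite ltrD// ?(distrC (F (slice q a tx.1 tx.2))); first by near: tx; exact: n1.
by near: tx; exact: n2'.
Unshelve. all: by end_near. Qed.

Lemma slice_cont_time (F : 'rV[R]_n -> R) x (m : nat) (t : R) :
  (forall y, U y -> {for y, continuous F}) -> U x -> 0 <= t <= 1 ->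
  {for t, continuous (fun s : R => s ^+ m * F (slice q a s x))}.
Proof.
move=> cF Ux t01; apply: continuousM; first exact: exprn_continuous.
apply: (@continuous_comp _ _ _ (fun s : R => slice q a s x) F); last exact/cF/slice_box.
apply: (@continuous_comp _ _ _ (fun s : R => (s, x)) (fun tx : R * 'rV[R]_n => slice q a tx.1 tx.2)).
  by apply: (@pair_continuous_at _ _ _ id (fun=> x) t); [exact: cvg_id|exact: cvg_cst].
exact: slice_cvg.
Qed.

Lemma slice_integrable (F : 'rV[R]_n -> R) x m :
  (forall y, U y -> {for y, continuous F}) -> U x ->
  lebesgue_measure.-integrable `[0, 1] (EFin \o (fun s : R => s ^+ m * F (slice q a s x))).
Proof.
move=> cF Ux; apply: continuous_compact_integrable; first exact: segment_compact.
apply: continuous_in_subspaceT => t /set_mem /=; rewrite in_itv/= => t01.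
exact: slice_cont_time.
Qed.

Lemma slice_int_cont (F : 'rV[R]_n -> R) m x : (forall y, U y -> {for y, continuous F}) ->
  U x -> {for x, continuous (slice_int q a m F)}.
Proof.
move=> cF Ux.
suff : forall e, 0 < e -> \forall x' \near x, `|slice_int q a m F x - slice_int q a m F x'| <= e.
  by move=> H; apply/(@cvgrPdist_le R R^o _ (nbhs x) (nbhs_filter x)).
move=> e e0; near=> x'.
have Ux' : U x' by near: x'; apply: open_nbhs_nbhs; split=> //; exact: box_open.
rewrite /slice_int -RintegralB//; try exact: slice_integrable.
set G := fun t : R => _ - _.
have iG : lebesgue_measure.-integrable `[0, 1] (EFin \o G).
  apply: continuous_compact_integrable; first exact: segment_compact.
  have cN (t : R) : 0 <= t <= 1 -> {for t, continuous G}.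
    by move=> t01; apply: continuousB; exact: slice_cont_time.
  by apply: continuous_in_subspaceT => t /set_mem /=; rewrite in_itv/= => /cN.
apply: (le_trans (le_normr_Rintegral _ iG)) => //.
have -> : e = \int[lebesgue_measure]_(t in `[0 : R, 1]) cst e t.
  rewrite /Rintegral (integral_cst _ _ e%:E)//= lebesgue_measure_itv/= lte_fin ltr01.
  by rewrite -EFinD oppr0 addr0 mule1.
apply: le_Rintegral => //.
- exact: integrable_norm.
- apply: continuous_compact_integrable; first exact: segment_compact.
  by apply: continuous_subspaceT; exact: cst_continuous.
move=> t; rewrite /= in_itv/= => /andP[t0 t1].
rewrite /G -mulrBr normrM ger0_norm ?exprn_ge0// -[leRHS]mul1r ler_pM ?exprn_ge0//.
  exact: exprn_ile1.
rewrite distrC ltW//.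
have t01 : 0 <= t <= 1 by rewrite t0.
move: t t01 {t0 t1}; near: x'; exact: slice_unif.
Unshelve. all: by end_near. Qed.

(** Gives the constant that dominates the integrand when differentiating under the integral: the
    maximum over the slice of [x], plus 1 for nearby slices. *)
Lemma slice_bound (F : 'rV[R]_n -> R) x : (forall y, U y -> {for y, continuous F}) -> U x ->
  exists M, 0 <= M /\ \forall x' \near x, forall t, 0 <= t <= 1 ->
    `|F (slice q a t x')| <= M.
Proof.
move=> cF Ux.
have cN : {within `[0 : R, 1], continuous (fun t : R => `|1 * F (slice q a t x)|)}.
  have cN (t : R) : 0 <= t <= 1 -> {for t, continuous (fun t : R => `|1 * F (slice q a t x)|)}.
    move=> t01; apply: (@continuous_comp _ _ _ (fun t : R => t ^+ 0 * F (slice q a t x)) (fun t : R => `|t|)).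
      exact: slice_cont_time.
    exact: norm_continuous.
  by apply: continuous_in_subspaceT => t /set_mem /=; rewrite in_itv/= => /cN.
have [c _ cM] := EVT_max ler01 cN.
exists (`|1 * F (slice q a c x)| + 1); split; first by rewrite addr_ge0.
near=> x' => t t01.
rewrite -[F _](subrK (F (slice q a t x))) addrC (le_trans (ler_normD _ _))// lerD//.
  by have := cM t; rewrite in_itv/= !mul1r; apply.
rewrite ltW//; move: t t01; near: x'; exact: slice_unif.
Unshelve. all: by end_near. Qed.

(** Shifting [x] along the direction [i] shifts its slice by [t] times as much if [i = a], and by
    the same amount otherwise; hence the exponent [m + (i == a)]. *)
Lemma slice_int_derive (F : 'rV[R]_n -> R) m (i : 'I_n) x :
  (forall y, U y -> {for y, continuous F}) ->
  (forall y, U y -> derivable F y (delta_mx 0 i)) ->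
  (forall y, U y -> {for y, continuous (partial i F)}) -> U x ->
  derivable (slice_int q a m F) x (delta_mx 0 i) /\
  partial i (slice_int q a m F) x = slice_int q a (m + (i == a)) (partial i F) x.
Proof.
move=> cF dF cD Ux.
have [M [M0 nM]] := slice_bound cD Ux.
have [u [u0 uP]] : exists u : R, 0 < u /\ forall s, `]- u, u[%classic s ->
    U (s *: delta_mx 0 i + x) /\ forall t, 0 <= t <= 1 ->
    `|partial i F (slice q a t (s *: delta_mx 0 i + x))| <= M.
  have nU : \forall x' \near x, U x' by apply: open_nbhs_nbhs; split=> //; exact: box_open.
  have [u u0 uP] := nbhs_box (filterI nU nM).
  exists u; split=> // s /=; rewrite in_itv/= => sI; apply: uP => j.
  rewrite !mxE/= addrK; case: eqP => _ /=; last by rewrite mulr0 normr0.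
  by rewrite mulr1 ltr_norml.
pose c (t : R) := if i == a then t else 1.
pose f (s t : R) := t ^+ m * F (slice q a t (s *: delta_mx 0 i + x)).
have df s t : `]- u, u[%classic s -> 0 <= t <= 1 ->
    is_derive s (1 : R) (f ^~ t)
      (t ^+ m * (partial i F (slice q a t (s *: delta_mx 0 i + x)) * c t)).
  move=> /uP[Us _] t01.
  have := is_derive_line (c t) s (dF _ (slice_box a t01 Us)).
  set h := fun s0 : R => F _ => dh.
  have -> : f ^~ t = t ^+ m \*: h.
    apply/funext => s'; rewrite /f /h /= [RHS]/GRing.scale/=; congr (_ * F _).
    rewrite !slice_shift -/(c t) addrA -scalerDl; congr (_ *: _ + _); ring.
  exact: is_deriveZ.
have d1f s t : `]- u, u[%classic s -> 0 <= t <= 1 -> partial1of2 f s t =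
    t ^+ m * (partial i F (slice q a t (s *: delta_mx 0 i + x)) * c t).
  by move=> su t01; rewrite partial1of2E; have [_] := df s t su t01.
have I0 : `]- u, u[%classic (0 : R) by rewrite /= in_itv/= oppr_lt0 u0.
have intf s : `]- u, u[%classic s -> lebesgue_measure.-integrable `[0, 1] (EFin \o f s).
  by move=> /uP[Us _]; exact: slice_integrable.
have derf1 s (t : R) : `]- u, u[%classic s -> `[0, 1]%classic t -> derivable (f ^~ t) s 1.
  by move=> su; rewrite /= in_itv/= => t01; have [] := df s t su t01.
have intM : lebesgue_measure.-integrable `[0 : R, 1] (EFin \o (fun=> M)).
  apply: continuous_compact_integrable; first exact: segment_compact.
  by apply: continuous_subspaceT; exact: cst_continuous.
have ubM s (t : R) : `]- u, u[%classic s -> `[0, 1]%classic t -> `|partial1of2 f s t| <= M.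
  move=> su; rewrite /= in_itv/= => t01; rewrite d1f//.
  have /andP[t0 t1] := t01; have [_ /(_ t t01) le] := uP s su.
  rewrite normrM ger0_norm ?exprn_ge0// -[leRHS]mul1r ler_pM ?exprn_ge0 ?exprn_ile1//.
  rewrite normrM -[leRHS]mulr1 ler_pM// /c; case: ifP => _; rewrite ?normr1//.
  by rewrite ger0_norm.
have mI := measurable_itv `[0 : R, 1].
have D1 := @derivable_under_integral R _ _ lebesgue_measure f _ mI 0 (- u) u I0 intf derf1 (fun=> M) (fun=> M0) intM ubM.
have D2 := @differentiation_under_integral R _ _ lebesgue_measure f _ mI 0 (- u) u I0 intf derf1 (fun=> M) (fun=> M0) intM ubM.
split; first by apply/derivable1P; exact: D1.
rewrite /partial derive_line -derive1E; apply: (etrans D2).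
rewrite /slice_int; apply: eq_Rintegral => t /set_mem; rewrite /= in_itv/= => t01.
rewrite d1f// scale0r add0r /c exprD; case: (i == a); rewrite ?expr1 ?expr0 /partial; ring.
Qed.

Lemma Ck_slice_int (F : 'rV[R]_n -> R) k m : Ck k U F -> Ck k U (slice_int q a m F).
Proof.
elim: k F m => [|k IH] F m CF.
  by split=> // x Ux; apply: slice_int_cont Ux => y Uy; exact: (Ck_cont CF).
have cF y (Uy : U y) := Ck_cont CF Uy.
split=> [x Ux|i]; first exact: slice_int_cont.
have [_ /(_ i)[D1 D2]] := CF.
have cD y (Uy : U y) := Ck_cont D2 Uy.
split=> [x Ux|]; first by have [] := slice_int_derive m cF D1 cD Ux.
apply: (@Ck_ext _ _ _ _ (slice_int q a (m + (i == a)) (partial i F))); first exact: box_open.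
  by move=> x Ux; have [_ ->] := slice_int_derive m cF D1 cD Ux.
exact: IH.
Qed.

Lemma slice_FTC (F : 'rV[R]_n -> R) x : Ck 1 U F -> U x ->
  F x = F (slice q a 0 x) + (x 0 a - q 0 a) * slice_int q a 0 (partial a F) x.
Proof.
move=> CF Ux; have [cF /(_ a)[D1 [cD _]]] := CF.
pose w := x 0 a - q 0 a.
have dphi (t : R) : 0 <= t <= 1 ->
    is_derive t (1 : R) (fun s => F (slice q a s x)) (w * partial a F (slice q a t x)).
  move=> t01; have := is_derive_line w t (D1 _ (slice_box a t01 Ux)).
  rewrite [X in is_derive _ _ X](_ : _ = fun s => F (slice q a s x)); last first.
    by apply/funext => s; rewrite (slice_time q a s t).
  by rewrite mulrC.
have cphi (t : R) : 0 <= t <= 1 -> {for t, continuous (fun s : R => F (slice q a s x))}.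
  by move=> t01; apply: differentiable_continuous; apply/derivable1_diffP; have [] := dphi t t01.
have := @continuous_FTC2 R (fun t => w * (t ^+ 0 * partial a F (slice q a t x))) (fun t => F (slice q a t x)) 0 1 ltr01.
have I1 : {within `[0 : R, 1], continuous (fun t => w * (t ^+ 0 * partial a F (slice q a t x)))}.
  have cN (t : R) : 0 <= t <= 1 -> {for t, continuous (fun t : R => w * (t ^+ 0 * partial a F (slice q a t x)))}.
    by move=> t01; apply: continuousM; [exact: cst_continuous|exact: slice_cont_time].
  by apply: continuous_in_subspaceT => t /set_mem /=; rewrite in_itv/= => /cN.
move=> /(_ I1) FTC.
have /FTC {}FTC : derivable_oo_LRcontinuous (fun t : R => F (slice q a t x)) 0 1.
  split.
  - move=> t; rewrite in_itv/= => /andP[t0 t1].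
    by have [|//] := dphi t; rewrite !ltW.
  - by apply: cvg_at_right_filter; apply: cphi; rewrite lexx ler01.
  - by apply: cvg_at_left_filter; apply: cphi; rewrite lexx ler01.
have /FTC : {in `](0 : R), 1[, derive1 (fun t : R => F (slice q a t x)) =1
    (fun t => w * (t ^+ 0 * partial a F (slice q a t x)))}.
  move=> t; rewrite in_itv/= => /andP[t0 t1].
  have [|_ dt] := dphi t; first by rewrite !ltW.
  by rewrite derive1E expr0 mul1r -dt.
move/(congr1 fine); rewrite slice1 => E.
have : \int[lebesgue_measure]_(t in `[0 : R, 1]) (w * (t ^+ 0 * partial a F (slice q a t x))) = F x - F (slice q a 0 x) by exact: E.
rewrite RintegralZl//; last exact: slice_integrable.
by rewrite -/(slice_int q a 0 _ x) => ->; rewrite addrC subrK.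
Qed.

End SliceInt.
End Box.

Lemma smooth_on_partial (R : realType) (n : nat) (U : set 'rV[R]_n) f (i : 'I_n) :
  smooth_on U f -> smooth_on U (partial i f).
Proof. by move=> sf k; have [_ /(_ i)[]] := sf k.+1. Qed.

Lemma smooth_on_cont (R : realType) (n : nat) (U : set 'rV[R]_n) f x :
  smooth_on U f -> U x -> {for x, continuous f}.
Proof. by move=> /(_ 0) [cf _] /cf. Qed.

Lemma smooth_on_derivable (R : realType) (n : nat) (U : set 'rV[R]_n) f (i : 'I_n) x :
  smooth_on U f -> U x -> derivable f x (delta_mx 0 i).
Proof. by move=> /(_ 1) [_ /(_ i)[D _]] /D. Qed.

(** * Hadamard's lemma: first-order expansion with smooth remainder factors *)

Section Hadamard.
Context {R : realType} {n : nat}.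
Implicit Types (q x : 'rV[R]_n).

(** The list [s] holds the coordinates already frozen at those of [q]; each induction step freezes
    one more by [slice_FTC]. *)
Lemma hadamard_seq q r (s : seq 'I_n) (F : 'rV[R]_n -> R) :
  smooth_on (box q r) F ->
  exists g : 'I_n -> 'rV[R]_n -> R, (forall a, smooth_on (box q r) (g a)) /\
    forall x, box q r x -> F x = F (\row_j (if j \in s then q 0 j else x 0 j))
       + \sum_a (x 0 a - q 0 a) * g a x.
Proof.
have oU := @box_open R n q r.
elim: s F => [|a s IH] F sF.
  exists (fun _ _ => 0); split=> [a k|x _]; first exact: Ck_cst.
  rewrite big1 ?addr0 => [|a _]; last by rewrite mulr0.
  by congr F; apply/rowP => j; rewrite !mxE in_nil.
pose h := slice_int q a 0 (partial a F).
have sh : smooth_on (box q r) h by move=> k; apply: Ck_slice_int; exact: smooth_on_partial.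
have Fh x : box q r x -> F x = F (slice q a 0 x) + (x 0 a - q 0 a) * h x.
  by move=> Ux; exact: (@slice_FTC R n q r a F x (sF 1) Ux).
(* Smoothness is read off the identity [Fh]: smoothness of compositions is not yet available, as its
   proof rests on Hadamard's lemma. *)
have sF' : smooth_on (box q r) (fun x => F (slice q a 0 x)).
  move=> k; apply: (@Ck_ext _ _ _ _ (fun x => F x - (x 0 a - q 0 a) * h x)) => //.
    by move=> x Ux; rewrite (Fh x Ux) addrK.
  apply: CkB => //; apply: CkM => //.
  by apply: CkB => //; [exact: Ck_coord|exact: Ck_cst].
have [g [sg gP]] := IH _ sF'.
exists (fun b x => g b x + (b == a)%:R * h x); split=> [b k|x Ux].
  by apply: CkD => //; [exact: sg|exact: CkZ].
rewrite (Fh x Ux) (gP x Ux).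
have -> : slice q a 0 (\row_j (if j \in s then q 0 j else x 0 j)) =
    \row_j (if j \in a :: s then q 0 j else x 0 j).
  apply/rowP => j; rewrite !mxE in_cons; case: eqP => [->|//].
  by rewrite mul0r addr0.
rewrite -addrA; congr (_ + _).
under [in RHS]eq_bigr do rewrite mulrDr.
rewrite big_split/=; congr (_ + _).
rewrite (bigD1 a)//= eqxx mul1r big1 ?addr0// => b /negPf ->.
by rewrite mul0r mulr0.
Qed.

(** As [u] vanishes at [x], the difference quotient of the product is that of [u] times a value of
    [G], so continuity of [G] suffices. This allows remainder factors whose differentiability is not
    known. *)
Lemma derive_vanish_mul (u G : 'rV[R]_n -> R) x v : derivable u x v -> u x = 0 ->
  {for x, continuous G} -> is_derive x v (fun y => u y * G y) ('D_v u x * G x).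
Proof.
move=> du u0 cG.
have C : (fun h : R => h^-1 *: ((fun y => u y * G y) (h *: v + x) - u x * G x)) @ 0^'
    --> ('D_v u x * G x : R^o).
  have -> : (fun h : R => h^-1 *: ((fun y => u y * G y) (h *: v + x) - u x * G x)) =
     (fun h : R => (h^-1 *: (u (h *: v + x) - u x)) * G (h *: v + x)).
    by apply/funext => h; rewrite u0 mul0r !subr0 scalerAl.
  apply: cvgM; first exact: du.
  have : (fun h : R => h *: v + x) @ 0^' --> x.
    have C0 : (fun h : R => h *: v + x) @ (0 : R) --> x.
      rewrite -[X in _ --> X]add0r -(scale0r v).
      by apply: cvgD; [apply: cvgZr_tmp; exact: cvg_id|exact: cvg_cst].
    by move=> A /C0; exact: nbhs_dnbhs.
  by move=> /cvg_comp/(_ cG).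
have D : derivable (fun y => u y * G y : R^o) x v by apply/cvg_ex; exists ('D_v u x * G x).
by apply: (DeriveDef D); exact: (cvg_lim _ C).
Qed.

(** The values of the factors at [q] come from differentiating the expansion there, where each
    [x 0 a - q 0 a] vanishes. *)
Lemma hadamard q r (F : 'rV[R]_n -> R) : 0 < r -> smooth_on (box q r) F ->
  exists g : 'I_n -> 'rV[R]_n -> R, [/\ forall a, smooth_on (box q r) (g a),
    forall a, g a q = partial a F q &
    forall x, box q r x -> F x = F q + \sum_a (x 0 a - q 0 a) * g a x].
Proof.
move=> r0 sF; have [g [sg gP]] := hadamard_seq (enum 'I_n) sF.
have gq x : box q r x -> F x = F q + \sum_a (x 0 a - q 0 a) * g a x.
  move=> Ux; rewrite {1}(gP x Ux); congr (F _ + _).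
  by apply/rowP => j; rewrite mxE mem_enum.
exists g; split=> // a; have Uq := box_center q r0.
have nU : \forall x \near q, box q r x.
  by apply: open_nbhs_nbhs; split=> //; exact: box_open.
have -> : partial a F q = 'D_(delta_mx 0 a) (cst (F q) + \sum_b (fun x : 'rV[R]_n => (x 0 b - q 0 b) * g b x)) q.
  rewrite /partial; apply: near_eq_derive; apply: filterS nU => x Ux.
  by rewrite (gq x Ux) !fctE fct_sumE.
have D b : is_derive q (delta_mx 0 a) (fun x : 'rV[R]_n => (x 0 b - q 0 b) * g b x) ((a == b)%:R * g b q).
  have dc : derivable (fun x : 'rV[R]_n => x 0 b - q 0 b) q (delta_mx 0 a).
    by apply: derivableB; [exact: derivable_coord|exact: derivable_cst].
  have -> : (a == b)%:R = 'D_(delta_mx 0 a) (fun x : 'rV[R]_n => x 0 b - q 0 b) q.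
    rewrite deriveB; [|exact: derivable_coord|exact: derivable_cst].
    by rewrite derive_cst subr0 -[LHS](partial_coord a b q).
  apply: derive_vanish_mul => //; first by rewrite subrr.
  exact: (smooth_on_cont (sg b)).
rewrite deriveD; [|exact: derivable_cst|by apply: derivable_sum => b; case: (D b)].
rewrite derive_cst add0r derive_sum; last by move=> b; case: (D b).
under eq_bigr => b _ do have [_ ->] := D b.
rewrite (bigD1 a)//= eqxx mul1r big1 ?addr0// => b; rewrite eq_sym => /negPf ->.
by rewrite mul0r.
Qed.

End Hadamard.

(** * The chain rule and smoothness of compositions *)

Section ChainRule.
Context {R : realType} {n m : nat}.
Variables (U : set 'rV[R]_n) (V : set 'rV[R]_m) (phi : 'rV[R]_n -> 'rV[R]_m).
Hypotheses (oU : open U) (oV : open V).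
Hypothesis UV : forall x, U x -> V (phi x).
Hypothesis sphi : forall a, smooth_on U (fun x => phi x 0 a).

Let cphi x : U x -> {for x, continuous phi}.
Proof.
move=> Ux; apply: mx_continuous_at => i a; rewrite (ord1 i).
exact: (smooth_on_cont (sphi a)).
Qed.

(** The Hadamard expansion of [f] at [phi x], composed with [phi], is a constant plus products whose
    first factor vanishes at [x], so it can be differentiated term by term using partial derivatives
    only. *)
Lemma chain_rule (f : 'rV[R]_m -> R) x (i : 'I_n) : smooth_on V f -> U x ->
  is_derive x (delta_mx 0 i) (f \o phi)
    (\sum_a partial i (fun y => phi y 0 a) x * partial a f (phi x)).
Proof.
move=> sf Ux; set q := phi x.
have [r r0 rV] : exists2 r, 0 < r & box q r `<=` V.
  by apply: nbhs_box; apply: open_nbhs_nbhs; split=> //; exact: UV.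
have [g [sg gq gP]] := hadamard r0 (fun k => Ck_sub rV (sf k)).
have nb : \forall y \near x, box q r (phi y).
  by apply: (cphi Ux); apply: open_nbhs_nbhs; split; [exact: box_open|exact: box_center].
have D a : is_derive x (delta_mx 0 i) (fun y => (phi y 0 a - q 0 a) * g a (phi y))
    (partial i (fun y => phi y 0 a) x * partial a f q).
  have da : derivable (fun y => phi y 0 a) x (delta_mx 0 i).
    exact: (@smooth_on_derivable R n U _ i x (sphi a) Ux).
  have dc : derivable (cst (q 0 a) : 'rV[R]_n -> R) x (delta_mx 0 i) := derivable_cst _ _ _.
  have dB := derivableB da dc.
  have -> : partial i (fun y => phi y 0 a) x = 'D_(delta_mx 0 i) ((fun y => phi y 0 a) - cst (q 0 a)) x.
    by rewrite (deriveB da dc) derive_cst subr0.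
  rewrite -gq.
  apply: (derive_vanish_mul (u := (fun y => phi y 0 a) - cst (q 0 a)) (G := fun y => g a (phi y)) dB).
    by rewrite !fctE subrr.
  apply: (continuous_comp (cphi Ux)); apply: (smooth_on_cont (sg a)).
  exact: box_center.
have E : {near x, f \o phi =1 cst (f q) + \sum_a (fun y => (phi y 0 a - q 0 a) * g a (phi y))}.
  by apply: filterS nb => y by_; rewrite /= (gP _ by_) !fctE fct_sumE.
have Dsum : is_derive x (delta_mx 0 i) (cst (f q) + \sum_a (fun y => (phi y 0 a - q 0 a) * g a (phi y)))
    (\sum_a partial i (fun y => phi y 0 a) x * partial a f q).
  have dS : derivable (\sum_a (fun y => (phi y 0 a - q 0 a) * g a (phi y))) x (delta_mx 0 i).
    by apply: derivable_sum => a; case: (D a).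
  have dc : derivable (cst (f q) : 'rV[R]_n -> R) x (delta_mx 0 i) := derivable_cst _ _ _.
  apply: (DeriveDef (derivableD dc dS)).
  rewrite (deriveD dc dS) derive_cst add0r derive_sum; last by move=> a; case: (D a).
  by apply: eq_bigr => a _; case: (D a).
case: Dsum => S1 S2; rewrite -S2.
have E' : \forall y \near x, (cst (f q) + \sum_a (fun y => (phi y 0 a - q 0 a) * g a (phi y))) y = (f \o phi) y.
  by apply: filterS E => y ->.
apply: DeriveDef; first exact: near_eq_derivable E' S1.
by apply: near_eq_derive; exact: E.
Qed.

Lemma smooth_on_comp (f : 'rV[R]_m -> R) : smooth_on V f -> smooth_on U (f \o phi).
Proof.
move=> + k; elim: k f => [|k IH] f sf.
  by split=> // x Ux; apply: (continuous_comp (cphi Ux)); apply: (smooth_on_cont sf); exact: UV.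
split=> [x Ux|i].
  by apply: (continuous_comp (cphi Ux)); apply: (smooth_on_cont sf); exact: UV.
split=> [x Ux|]; first by case: (chain_rule i sf Ux).
apply: (@Ck_ext _ _ _ _ (fun x => \sum_a partial i (fun y => phi y 0 a) x * partial a f (phi x))) => //.
  by move=> x Ux; rewrite /partial; have [_ ->] := chain_rule i sf Ux.
apply: Ck_sum => // a _; apply: CkM => //; first exact: smooth_on_partial.
by apply: IH; exact: smooth_on_partial.
Qed.

End ChainRule.

(** * Bump functions *)

Section Bump.
Context {R : realType}.

(** The class of functions [p (1/t) * exp (-1/t)], extended by 0, is closed under differentiation,
    so all derivatives of the flat function [exp (-1/t)] are treated at once. *)
Definition exp_poly (p : {poly R}) (t : R) : R :=
  if 0 < t then p.[t^-1] * expR (- t^-1) else 0.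

(** The polynomial of the derivative: differentiating [1/t] gives the factor ['X^2] up to sign,
    which multiplies [p] from the exponential and the derivative of [p] from the polynomial. *)
Definition exp_poly_step (p : {poly R}) : {poly R} := 'X^2 * (p - p^`()).

(** With [s = t^-1 >= 1] the polynomial is at most a multiple of [s ^+ N]; the term of degree [N.+1]
    in the exponential series then leaves one factor [t]. *)
Lemma exp_poly_bound p : exists2 C, 0 <= C & forall t, 0 < t <= 1 -> `|exp_poly p t| <= C * t.
Proof.
pose N := size p; exists ((\sum_(i < N) `|p`_i|) * N.+1`!%:R).
  by rewrite mulr_ge0// sumr_ge0.
move=> t /andP[t0 t1]; rewrite /exp_poly t0; set s := t^-1.
have s1 : 1 <= s by rewrite /s invf_ge1.
have s0 : 0 < s by rewrite invr_gt0.
have b1 : `|p.[s]| <= (\sum_(i < N) `|p`_i|) * s ^+ N.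
  rewrite horner_coef (le_trans (ler_norm_sum _ _ _))// mulr_suml ler_sum// => i _.
  rewrite normrM ler_wpM2l// ger0_norm ?exprn_ge0 ?(ltW s0)//.
  by rewrite ler_weXn2l// ltnW.
have b2 : s ^+ N * expR (- s) <= N.+1`!%:R * t.
  have f0 : 0 < N.+1`!%:R :> R by rewrite ltr0n fact_gt0.
  have := expR_ge1Dxn N (ltW s0); rewrite expRN => le.
  have le' : s ^+ N.+1 / N.+1`!%:R <= expR s by apply: le_trans le; rewrite lerDr.
  rewrite ler_pdivrMr ?expR_gt0//.
  rewrite ler_pdivrMr// in le'.
  have -> : s ^+ N = s ^+ N.+1 * t by rewrite exprSr -mulrA mulVf ?mulr1// gt_eqF.
  by rewrite mulrAC ler_pM2r// mulrC.
rewrite normrM [`|expR _|]ger0_norm ?expR_ge0//.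
apply: le_trans (ler_wpM2r (expR_ge0 _) b1) _.
by rewrite -!mulrA ler_wpM2l// sumr_ge0.
Qed.

Lemma exp_polyV p t : exp_poly p t / t = exp_poly ('X * p) t.
Proof.
rewrite /exp_poly; case: ifP => _; last by rewrite mul0r.
by rewrite hornerM hornerX mulrC mulrA.
Qed.

Lemma is_derive_exp_poly p t : is_derive t (1 : R) (exp_poly p) (exp_poly (exp_poly_step p) t).
Proof.
have [t0|t0|t0] := ltgtP t 0.
- have E : {near t, cst 0 =1 exp_poly p}.
    near=> s; rewrite /exp_poly ifF//; apply: lt_gtF; near: s.
    by apply: open_nbhs_nbhs; split => //; exact: open_lt.
  rewrite [X in is_derive _ _ _ X](_ : _ = 0); last by rewrite /exp_poly ltNge (ltW t0).
  exact: (near_eq_is_derive E (is_derive_cst (0 : R^o) t 1)).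
- have E : {near t, (fun s : R => p.[s^-1] * expR (- s^-1)) =1 exp_poly p}.
    near=> s; rewrite /exp_poly ifT//; near: s.
    by apply: open_nbhs_nbhs; split => //; exact: open_gt.
  apply: (near_eq_is_derive E).
  have tn0 : t != 0 by rewrite gt_eqF.
  have dV : is_derive t (1 : R) (fun s : R => s^-1) (- t ^- 2).
    have di : derivable (id : R -> R) t 1 by exact: derivable_id.
    apply: (DeriveDef (derivableV tn0 di)).
    by rewrite (deriveV tn0 di) derive_id /GRing.scale/= mulr1.
  have dp : is_derive (t^-1) (1 : R) (horner p) (p^`().[t^-1]).
    have dp0 : derivable (horner p : R -> R) (t^-1) 1 by exact: derivable_horner.
    by apply: (DeriveDef dp0); rewrite -derive1E -derivE.
  have d1 := @is_derive1_comp R (horner p) (fun s => s^-1) t _ _ dp dV.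
  have dN : is_derive t (1 : R) (fun s : R => - s^-1) (t ^- 2).
    by have := is_deriveN dV; rewrite opprK.
  have d2 := @is_derive1_comp R expR (fun s => - s^-1) t _ _ (is_derive_expR _) dN.
  have := is_deriveM d1 d2.
  rewrite /exp_poly t0 /exp_poly_step hornerM hornerXn hornerD hornerN /GRing.scale/=.
  rewrite [X in is_derive _ _ _ X -> _](_ : _ =
    t^-1 ^+ 2 * (p.[t^-1] - p^`().[t^-1]) * expR (- t^-1)) //.
  by rewrite -exprVn; ring.
rewrite t0 {t t0}.
have e00 q : exp_poly q 0 = 0 by rewrite /exp_poly ltxx.
(* At 0 the difference quotient is [exp_poly ('X * p)], which tends to 0 by the linear bound. *)
have C : (fun h : R => h^-1 *: (exp_poly p (h *: (1 : R) + 0) - exp_poly p 0)) @ 0^' --> (0 : R^o).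
  have [C C0 Cb] := exp_poly_bound ('X * p).
  apply/cvgr0Pnorm_le => e e0.
  have d0 : 0 < Num.min 1 (e / (C + 1)) by rewrite lt_min ltr01 divr_gt0// ltr_wpDl.
  near=> h.
  rewrite e00 subr0 addr0 [h *: _]mulr1 /GRing.scale/= mulrC exp_polyV.
  have [h0|h0] := ltP 0 h; last by rewrite /exp_poly ltNge h0 normr0 ltW.
  have : `|h| < Num.min 1 (e / (C + 1)).
    near: h; apply: nbhs_dnbhs; apply/nbhs_ballP.
    by exists (Num.min 1 (e / (C + 1))) => //= y; rewrite /ball/= sub0r normrN.
  rewrite gtr0_norm// lt_min => /andP[h1 he].
  apply: (le_trans (Cb h _)); first by rewrite h0 ltW.
  apply: (@le_trans _ _ ((C + 1) * h)); first by rewrite ler_wpM2r ?(ltW h0)// lerDl.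
  rewrite mulrC -ler_pdivlMr ?ltW//; lra.
rewrite e00.
have D : derivable (exp_poly p : R -> R^o) 0 1 by apply/cvg_ex; exists 0.
by apply: (DeriveDef D); exact: (cvg_lim _ C).
Unshelve. all: by end_near. Qed.

Definition flat : R -> R := exp_poly 1.

Lemma flat_ge0 t : 0 <= flat t.
Proof. by rewrite /flat /exp_poly; case: ifP => // _; rewrite hornerC mul1r expR_ge0. Qed.

Lemma flat_gt0 t : 0 < t -> 0 < flat t.
Proof. by move=> t0; rewrite /flat /exp_poly t0 hornerC mul1r expR_gt0. Qed.

Lemma flat_eq0 t : t <= 0 -> flat t = 0.
Proof. by move=> t0; rewrite /flat /exp_poly ltNge t0. Qed.

Lemma Ck_flat n k (U : set 'rV[R]_n) f : open U -> Ck k U f -> Ck k U (fun x => flat (f x)).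
Proof.
move=> oU Cf.
exact: (@Ck_comp1 R n (fun m => exp_poly (iter m exp_poly_step 1)) k U f oU
  (fun m t => is_derive_exp_poly _ t) Cf 0).
Qed.

Definition cutoff (c t : R) : R := flat (2 * c - t) / (flat (2 * c - t) + flat (t - c)).

Lemma cutoff_den c t : 0 < c -> flat (2 * c - t) + flat (t - c) != 0.
Proof.
move=> c0; rewrite gt_eqF//; have [tc|tc] := leP t c.
  by rewrite ltr_wpDr ?flat_ge0// flat_gt0//; lra.
by rewrite ltr_wpDl ?flat_ge0// flat_gt0//; lra.
Qed.

Lemma cutoff1 c t : 0 < c -> t <= c -> cutoff c t = 1.
Proof.
move=> c0 tc; have := cutoff_den t c0.
by rewrite /cutoff [flat (t - c)]flat_eq0 ?subr_le0// addr0 => /divff.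
Qed.

Lemma cutoff0 c t : 2 * c <= t -> cutoff c t = 0.
Proof. by move=> tc; rewrite /cutoff flat_eq0 ?subr_le0// mul0r. Qed.

Lemma Ck_cutoff n k (U : set 'rV[R]_n) f c : 0 < c -> open U -> Ck k U f ->
  Ck k U (fun x => cutoff c (f x)).
Proof.
move=> c0 oU Cf.
have C1 : Ck k U (fun x => flat (2 * c - f x)).
  by apply: Ck_flat => //; apply: CkB => //; exact: Ck_cst.
have C2 : Ck k U (fun x => flat (f x - c)).
  by apply: Ck_flat => //; apply: CkB => //; exact: Ck_cst.
apply: (@CkM _ _ _ _ _ (fun x => (flat (2 * c - f x) + flat (f x - c))^-1)) => //.
by apply: CkV => //; [move=> x _; exact: cutoff_den|exact: CkD].
Qed.

End Bump.

(** * Smooth functions, tangent vectors and coordinate frames on a manifold *)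

Section LocalSmoothness.
Context {R : realType} {M : manifold R}.
Implicit Types (U V W : set M) (f h : M -> R) (p : M).
Local Notation chartM := (chart R M (mdim M)).

Definition chart_preim (c : chartM) U : set 'rV[R]_(mdim M) := cimg c `&` cbwd c @^-1` U.

Lemma chart_preim_open c U : open U -> open (chart_preim c U).
Proof.
move=> oU; rewrite openE => y [cy Uy].
have n1 : \forall z \near y, cimg c z.
  by apply: open_nbhs_nbhs; split=> //; exact: cimg_open.
have n2 : \forall z \near y, U (cbwd c z).
  by apply: (cbwd_cont cy); exact: open_nbhs_nbhs.
exact: filterI n1 n2.
Qed.

Lemma chart_fwd_preim_open (c : chartM) O : open O -> open (cdom c `&` cfwd c @^-1` O).
Proof.
move=> oO; rewrite openE => p [cp Op].
have n1 : \forall z \near p, cdom c z.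
  by apply: open_nbhs_nbhs; split=> //; exact: cdom_open.
have n2 : \forall z \near p, O (cfwd c z).
  by apply: (cfwd_cont cp); exact: open_nbhs_nbhs.
exact: filterI n1 n2.
Qed.

Definition smooth_over U h : Prop :=
  forall c, matlas c -> smooth_on (chart_preim c U) (h \o cbwd c).

Lemma smooth_over_sub U V h : V `<=` U -> smooth_over U h -> smooth_over V h.
Proof. by move=> VU sh c ac k; apply: Ck_sub (sh c ac k) => y [cy /VU]. Qed.

Lemma smooth_overS U h : smooth h -> smooth_over U h.
Proof. by move=> sh c ac k; apply: Ck_sub (sh c ac k) => y []. Qed.

Lemma smooth_over_ext U f h : open U -> (forall p, U p -> f p = h p) ->
  smooth_over U f -> smooth_over U h.
Proof.
move=> oU fh sf c ac k; apply: Ck_ext (sf c ac k); first exact: chart_preim_open.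
by move=> y [_ /fh].
Qed.

Lemma smooth_local h :
  (forall p, exists V, [/\ open V, V p & smooth_over V h]) -> smooth h.
Proof.
move=> loc c ac k; apply: Ck_local => y cy; have [V [oV Vy sV]] := loc (cbwd c y).
exists (chart_preim c V); split; first exact: chart_preim_open.
  by split.
exact: sV.
Qed.

Lemma smooth_near_eq h :
  (forall p, exists2 h', smooth h' & \forall q \near p, h q = h' q) -> smooth h.
Proof.
move=> loc; apply: smooth_local => p; have [h' sh' nh'] := loc p.
exists (interior [set q | h q = h' q]); split; [exact: open_interior|exact: nh'|].
apply: (@smooth_over_ext _ h'); [exact: open_interior| |exact: smooth_overS].
by move=> q /interior_subset.
Qed.

Lemma smooth_overM U f h : open U -> smooth_over U f -> smooth_over U h ->
  smooth_over U (fun p => f p * h p).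
Proof.
by move=> oU sf sh c ac k; apply: CkM; [exact: chart_preim_open|exact: sf|exact: sh].
Qed.

(** Read in another chart, the function is [phi] composed with a transition map, which is smooth by
    compatibility of the atlas. *)
Lemma smooth_over_chart (c : chartM) (O : set 'rV[R]_(mdim M)) (phi : 'rV[R]_(mdim M) -> R) :
  matlas c -> open O -> smooth_on O phi ->
  smooth_over (cdom c `&` cfwd c @^-1` O) (phi \o cfwd c).
Proof.
move=> ac oO sphi d ad.
apply: (@smooth_on_comp R _ _ _ O (fun y => cfwd c (cbwd d y))) => //.
- exact/chart_preim_open/chart_fwd_preim_open.
- by move=> y [_ [_]].
- move=> a k; apply: Ck_sub (m_compat ad ac a k).
  by move=> y [dy [cy _]].
Qed.

Lemma smooth_overV U h : open U -> (forall p, U p -> h p != 0) -> smooth_over U h ->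
  smooth_over U (fun p => (h p)^-1).
Proof.
move=> oU h0 sh c ac k; apply: (@CkV _ _ _ _ (h \o cbwd c)); first exact: chart_preim_open.
  by move=> y [_ /h0].
exact: sh.
Qed.

Lemma smooth_continuous h : smooth h -> continuous h.
Proof.
move=> sh p; have [c ac cp] := m_cover p.
have C : {for cfwd c p, continuous (h \o cbwd c)}.
  exact: (smooth_on_cont (sh c ac) (cfwd_img cp)).
have C2 := continuous_comp (cfwd_cont cp) C.
rewrite /continuous_at -{2}(cfwdK cp); apply: cvg_trans C2.
apply: near_eq_cvg; apply: filterS (open_nbhs_nbhs (conj (cdom_open c) cp)) => q cq.
by rewrite /= cfwdK.
Qed.

Lemma smooth_sum (I : Type) (r : seq I) (P : pred I) (F : I -> M -> R) :
  (forall i, P i -> smooth (F i)) -> smooth (fun p => \sum_(i <- r | P i) F i p).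
Proof.
by move=> sF c ac k; apply: (@Ck_sum _ _ _ _ _ _ _ (fun i => F i \o cbwd c));
  [exact: cimg_open|move=> i /sF; exact].
Qed.

Lemma smooth_prod (I : Type) (r : seq I) (F : I -> M -> R) :
  (forall i, smooth (F i)) -> smooth (fun p => \prod_(i <- r) F i p).
Proof.
move=> sF; elim: r => [|i r IH].
  have -> : (fun p => \prod_(i <- [::]) F i p) = fun=> 1 by apply/funext => p; rewrite big_nil.
  exact: smooth_cst.
have -> : (fun p => \prod_(i <- i :: r) F i p) = F i \* (fun p => \prod_(i <- r) F i p).
  by apply/funext => p; rewrite big_cons.
exact: smoothM.
Qed.

Lemma smoothN f : smooth f -> smooth (fun p => - f p).
Proof.
move=> sf; have -> : (fun p => - f p) = (-1) \*o f by apply/funext => p; rewrite /= mulN1r.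
exact: smoothZ.
Qed.

Lemma smoothB f h : smooth f -> smooth h -> smooth (fun p => f p - h p).
Proof. by move=> sf sh; exact: (smoothD sf (smoothN sh)). Qed.

(** A cutoff of the squared distance to the centre in a chart, extended by 0 outside the chart. *)
Lemma bump_function p W : open W -> W p -> exists chi K, [/\ smooth chi,
  \forall q \near p, chi q = 1, closed K, K `<=` W & forall q, ~ K q -> chi q = 0].
Proof.
move=> oW Wp; have [c ac cp] := m_cover p; set q := cfwd c p.
have Oq : chart_preim c W q by split; [exact: cfwd_img|rewrite /= cfwdK].
have [r r0 rW] := nbhs_box (open_nbhs_nbhs (conj (chart_preim_open (c := c) oW) Oq)).
pose rho (y : 'rV[R]_(mdim M)) := \sum_j (y 0 j - q 0 j) * (y 0 j - q 0 j).
pose K' : set 'rV[R]_(mdim M) := [set y | forall j, `[q 0 j - r / 2, q 0 j + r / 2]%classic (y 0 j)].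
have K'box : K' `<=` box q r.
  move=> y Ky j; have := Ky j; rewrite /= in_itv/= => /andP[y1 y2].
  by rewrite ltr_norml; apply/andP; split; lra.
have cK' : compact K'.
  exact: (@rV_compact R _ (fun j => `[q 0 j - r / 2, q 0 j + r / 2]%classic) (fun j => @segment_compact R _ _)).
have cK : compact (cbwd c @` K').
  apply: continuous_compact => //; apply: continuous_in_subspaceT => y /set_mem /K'box /rW[cy _].
  exact: cbwd_cont.
have KW : cbwd c @` K' `<=` W by move=> _ [y /K'box /rW [_ Wy] <-].
have Kc : cbwd c @` K' `<=` cdom c by move=> _ [y /K'box /rW [cy _] <-]; exact: cbwd_dom.
(* A compact set is closed because [M] is Hausdorff; closedness in all of [M] is what makes the
   extension by 0 smooth. *)
have closedK : closed (cbwd c @` K') := compact_closed (@m_hausdorff R M) cK.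
(* The cutoff vanishes from [2 * c0] on, and [2 * c0] is the square of [r / 2]; hence its support
   stays in the closed box [K'] of half-side [r / 2]. *)
pose c0 := r * r / 8; have c00 : 0 < c0 by rewrite divr_gt0// mulr_gt0.
have rhoK y : rho y < 2 * c0 -> K' y.
  move=> ry j; rewrite /= in_itv/=.
  have le : (y 0 j - q 0 j) * (y 0 j - q 0 j) <= rho y.
    by rewrite /rho (bigD1 j)//= lerDl sumr_ge0// => i _; rewrite -expr2 sqr_ge0.
  have : (y 0 j - q 0 j) * (y 0 j - q 0 j) < (r / 2) ^+ 2.
    apply: (le_lt_trans le); apply: (lt_le_trans ry); rewrite /c0 expr2; lra.
  rewrite -expr2 -[(_ - _) ^+ 2]real_normK ?num_real// ltr_pXn2r ?nnegrE ?divr_ge0 ?(ltW r0)//.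
  by rewrite ltr_norml => /andP[]; lra.
have srho (k : nat) (U : set 'rV[R]_(mdim M)) : open U -> Ck k U rho.
  move=> oU; apply: Ck_sum => // j _.
  by apply: CkM => //; apply: CkB => //; [exact: Ck_coord|exact: Ck_cst|exact: Ck_coord|exact: Ck_cst].
pose chi x := if `[< cdom c x >] then cutoff c0 (rho (cfwd c x)) else 0.
have chi0 x : ~ (cbwd c @` K') x -> chi x = 0.
  move=> Kx; rewrite /chi; case: ifPn => // /asboolP cx.
  apply: cutoff0; rewrite leNgt; apply/negP => /rhoK Ky; apply: Kx.
  by exists (cfwd c x) => //; rewrite cfwdK.
exists chi, (cbwd c @` K'); split=> //.
- apply: smooth_local => x; have [cx|ncx] := pselect (cdom c x).
    exists (cdom c); split=> //; first exact: cdom_open.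
    apply: (@smooth_over_ext _ ((fun y => cutoff c0 (rho y)) \o cfwd c)); first exact: cdom_open.
      by move=> y cy; rewrite /chi /= asboolT.
    apply: (@smooth_over_sub (cdom c `&` cfwd c @^-1` setT)) => //.
    apply: smooth_over_chart => //; first exact: openT.
    by move=> k; apply: Ck_cutoff => //; [exact: openT|exact: srho openT].
  exists (~` (cbwd c @` K')); split; first exact: closed_openC.
    by move=> /Kc.
  apply: (@smooth_over_ext _ (fun=> 0)); first exact: closed_openC.
    by move=> y /chi0.
  exact/smooth_overS/smooth_cst.
- have rc : {for q, continuous rho} by have [H _] := srho 0 setT openT; exact: H.
  have : \forall y \near q, rho y < c0.
    apply: (rc [set t : R | t < c0]); apply: open_nbhs_nbhs; split; first exact: open_lt.
    by rewrite /= /rho big1// => j _; rewrite subrr mul0r.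
  move=> /(cfwd_cont cp) n1'; have n1 : \forall x \near p, rho (cfwd c x) < c0 := n1'.
  have n2 := open_nbhs_nbhs (conj (cdom_open c) cp).
  apply: filterS (filterI n1 n2) => x [rx cx].
  by rewrite /chi asboolT// cutoff1// ltW.
Qed.

Lemma smooth_bumpM W K chi h : open W -> closed K -> K `<=` W -> smooth chi ->
  (forall q, ~ K q -> chi q = 0) -> smooth_over W h -> smooth (fun p => chi p * h p).
Proof.
move=> oW cK KW schi chi0 sh; apply: smooth_local => p.
have [Kp|nKp] := pselect (K p).
  exists W; split=> //; first exact: KW.
  by apply: smooth_overM => //; exact: smooth_overS.
exists (~` K); split=> //; first exact: closed_openC.
apply: (@smooth_over_ext _ (fun=> 0)); first exact: closed_openC.
  by move=> q /chi0 ->; rewrite mul0r.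
exact/smooth_overS/smooth_cst.
Qed.

(** Fields and tangent vectors act only on global smooth functions, so a local function is replaced
    by a global one with the same germ. *)
Lemma smooth_extend p W h : open W -> W p -> smooth_over W h ->
  exists2 h', smooth h' & \forall q \near p, h' q = h q.
Proof.
move=> oW Wp sh; have [chi [K [schi n1 cK KW chi0]]] := bump_function oW Wp.
exists (fun p => chi p * h p); first exact: (smooth_bumpM oW cK KW).
by apply: filterS n1 => q ->; rewrite mul1r.
Qed.

End LocalSmoothness.

(** * Locality of derivations *)

Section TangentLocal.
Context {R : realType} {M : manifold R}.
Implicit Types (f h : M -> R) (p : M).

Lemma tact0 p (u : tangent p) : u (fun=> 0) = 0.
Proof.
transitivity (u (0 \*o (fun=> 0 : R))); last by rewrite (tactZ u 0 (smooth_cst 0)) mul0r.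
by congr (tact u _); apply/funext => q; rewrite /= mul0r.
Qed.

Lemma tact_cst p (u : tangent p) a : u (fun=> a) = 0.
Proof.
have u1 : u (fun=> 1) = 0.
  have := tactM u (smooth_cst 1) (smooth_cst 1); rewrite !mul1r.
  have -> : (fun _ : M => 1) \* (fun=> 1) = (fun=> 1 : R) by apply/funext => q; rewrite /= mul1r.
  by move/eqP; rewrite -subr_eq subrr eq_sym => /eqP.
transitivity (u (a \*o (fun=> 1 : R))); last by rewrite (tactZ u a (smooth_cst 1)) u1 mulr0.
congr (tact u _).
by apply/funext => q; rewrite /= mulr1.
Qed.

Lemma tactN p (u : tangent p) f : smooth f -> u (fun q => - f q) = - u f.
Proof.
move=> sf; rewrite -mulN1r -tactZ//; congr (tact u _).
by apply/funext => q; rewrite /= mulN1r.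
Qed.

Lemma tactB p (u : tangent p) f h : smooth f -> smooth h ->
  u (fun q => f q - h q) = u f - u h.
Proof.
move=> sf sh; rewrite -(tactN u sh); exact: (tactD u sf (smoothN sh)).
Qed.

(** With a bump function [chi] supported where [f = h], the product [chi * (f - h)] is 0 and the
    Leibniz rule at [p] leaves only [u (f - h)]. *)
Lemma tact_near p (u : tangent p) f h : smooth f -> smooth h ->
  (\forall q \near p, f q = h q) -> u f = u h.
Proof.
move=> sf sh fh.
have [chi [K [schi n1 cK KW chi0]]] := bump_function (open_interior [set q | f q = h q]) fh.
have sd : smooth (fun q => f q - h q) by exact: smoothB.
have := tactM u schi sd.
rewrite (_ : chi \* _ = fun=> 0); last first.
  apply/funext => q; rewrite /=; have [/KW/interior_subset ->|/chi0 ->] := pselect (K q).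
    by rewrite subrr mulr0.
  by rewrite mul0r.
rewrite tact0 (nbhs_singleton n1) mul1r (nbhs_singleton fh) subrr mul0r addr0.
by rewrite tactB// => /eqP; rewrite eq_sym subr_eq0 => /eqP.
Qed.

Lemma tact_sum p (u : tangent p) (I : Type) (r : seq I) (P : pred I) (F : I -> M -> R) :
  (forall i, P i -> smooth (F i)) ->
  u (fun q => \sum_(i <- r | P i) F i q) = \sum_(i <- r | P i) u (F i).
Proof.
move=> sF; elim: r => [|i r IH].
  rewrite big_nil -[RHS](tact0 u); congr (tact u _).
  by apply/funext => q; rewrite big_nil.
rewrite big_cons -IH; case: ifPn => Pi.
  rewrite -tactD; [|exact: sF|exact: smooth_sum].
  by congr (tact u _); apply/funext => q; rewrite big_cons Pi.
by congr (tact u _); apply/funext => q; rewrite big_cons (negPf Pi).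
Qed.

Lemma tadd_act p (u v : tangent p) f : (u + v) f = u f + v f.
Proof. by []. Qed.

Lemma tscale_act p a (u : tangent p) f : (a *: u) f = a * u f.
Proof. by []. Qed.

Lemma topp_act p (u : tangent p) f : (- u) f = - u f.
Proof. by []. Qed.

Lemma tzero_act p f : (0 : tangent p) f = 0.
Proof. by []. Qed.

Lemma tsum_act p (I : Type) (r : seq I) (P : pred I) (F : I -> tangent p) f :
  (\sum_(i <- r | P i) F i) f = \sum_(i <- r | P i) F i f.
Proof. exact: (big_morph (fun u : tangent p => u f) (fun u v => tadd_act u v f) (tzero_act p f)). Qed.

End TangentLocal.

(** * Coordinate frames *)

Section Frame.
Context {R : realType} {M : manifold R}.
Local Notation n := (mdim M).

(* [E] and [x] behave on [U] like the coordinate fields and the coordinate functions of a chart. *)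
Definition frame_on (U : set M) (E : 'I_n -> vfield M) (x : 'I_n -> M -> R) : Prop :=
  [/\ open U, forall a, smooth (x a),
      forall a b q, U q -> E a q (x b) = (a == b)%:R
    & forall q (v : tangent q), U q -> v = \sum_a v (x a) *: E a q].

Section CoordinateField.
Variables (c : chart R M n) (ac : matlas c) (chi : M -> R) (K : set M).
Hypotheses (schi : smooth chi) (cK : closed K) (KW : K `<=` cdom c)
  (chi0 : forall q, ~ K q -> chi q = 0).
Variable a : 'I_n.

(** The coordinate field of the chart multiplied by [chi], so that it extends by 0 to the whole
    manifold. *)
Definition coord_act (q : M) (h : M -> R) : R :=
  if `[< smooth h >] then chi q * partial a (h \o cbwd c) (cfwd c q) else 0.

Lemma coord_actE q h : smooth h ->
  coord_act q h = chi q * partial a (h \o cbwd c) (cfwd c q).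
Proof. by move=> sh; rewrite /coord_act asboolT. Qed.

Lemma chart_derivable q h : smooth h -> cdom c q ->
  derivable (h \o cbwd c) (cfwd c q) (delta_mx 0 a).
Proof. by move=> sh cq; exact: (@smooth_on_derivable R n (cimg c) _ a _ (sh c ac) (cfwd_img cq)). Qed.

Lemma chiP q : cdom c q \/ chi q = 0.
Proof. by have [/KW|/chi0] := pselect (K q); [left|right]. Qed.

Lemma coord_actD q f h : smooth f -> smooth h ->
  coord_act q (f \+ h) = coord_act q f + coord_act q h.
Proof.
move=> sf sh; rewrite !coord_actE//; last exact: smoothD.
have [cq|->] := chiP q; last by rewrite !mul0r addr0.
rewrite -mulrDr; congr (_ * _).
by rewrite -(deriveD (chart_derivable sf cq) (chart_derivable sh cq)).
Qed.

Lemma coord_actM q f h : smooth f -> smooth h ->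
  coord_act q (f \* h) = f q * coord_act q h + h q * coord_act q f.
Proof.
move=> sf sh; rewrite !coord_actE//; last exact: smoothM.
have [cq|->] := chiP q; last by rewrite !mul0r !mulr0 addr0.
have := deriveM (chart_derivable sf cq) (chart_derivable sh cq).
rewrite /= cfwdK// /GRing.scale/= => E.
rewrite (_ : partial a _ _ = f q * partial a (h \o cbwd c) (cfwd c q) + h q * partial a (f \o cbwd c) (cfwd c q)) //.
ring.
Qed.

Lemma coord_actZ q k f : smooth f -> coord_act q (k \*o f) = k * coord_act q f.
Proof.
move=> sf; have := coord_actM q (smooth_cst k) sf.
rewrite (coord_actE q (smooth_cst k)) (_ : partial a _ _ = 0); last exact: derive_cst.
by rewrite !mulr0 addr0.
Qed.

Lemma coord_act_out q f : ~ smooth f -> coord_act q f = 0.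
Proof. by move=> nf; rewrite /coord_act asboolF. Qed.

Definition coord_tangent q : tangent q :=
  Tangent (@coord_actD q) (@coord_actZ q) (@coord_actM q) (@coord_act_out q).

Lemma coord_smooth f : smooth f -> smooth (fun q => coord_tangent q f).
Proof.
move=> sf; have -> : (fun q => coord_tangent q f) =
    fun q => chi q * (partial a (f \o cbwd c) \o cfwd c) q.
  by apply/funext => q; rewrite /= coord_actE.
apply: (smooth_bumpM (cdom_open c) cK KW) => //.
apply: (@smooth_over_sub _ _ (cdom c `&` cfwd c @^-1` cimg c)).
  by move=> q cq; split=> //; exact: cfwd_img.
apply: smooth_over_chart => //; first exact: cimg_open.
exact: smooth_on_partial (sf c ac).
Qed.

Definition coord_field : vfield M := VField coord_smooth.

End CoordinateField.

Lemma chart_frame (c : chart R M n) p : matlas c -> cdom c p ->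
  exists U E x, [/\ U p, U `<=` cdom c, frame_on U E x &
    forall a q, U q -> x a q = cfwd c q 0 a].
Proof.
move=> ac cp; have [chi [K [schi n1 cK KW chi0]]] := bump_function (cdom_open c) cp.
pose U := interior [set q | chi q = 1] `&` cdom c.
have oU : open U by apply: openI; [exact: open_interior|exact: cdom_open].
have chi1 q : U q -> chi q = 1 by move=> [/interior_subset].
pose E a := coord_field ac schi cK KW chi0 a.
pose x (a : 'I_n) q := chi q * cfwd c q 0 a.
have sx a : smooth (x a).
  apply: (smooth_bumpM (cdom_open c) cK KW) => //.
  apply: (@smooth_over_sub _ _ (cdom c `&` cfwd c @^-1` setT)) => //.
  by apply: (@smooth_over_chart _ _ c setT (fun y => y 0 a)) => //; [exact: openT|move=> k; exact: Ck_coord].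
have xE a q : U q -> x a q = cfwd c q 0 a by move=> /chi1; rewrite /x => ->; rewrite mul1r.
exists U, E, x; split=> //; first by move=> q [].
split=> // [a b q Uq|q v Uq].
  rewrite /= coord_actE// chi1// mul1r -[RHS](partial_coord a b (cfwd c q)).
  rewrite /partial; apply: near_eq_derive.
  have Oq : chart_preim c U (cfwd c q).
    by case: (Uq) => _ cq; split; [exact: cfwd_img|rewrite /= cfwdK].
  apply: filterS (open_nbhs_nbhs (conj (chart_preim_open (c := c) oU) Oq)) => y [cy Uy].
  by rewrite /= xE// cbwdK.
(* A derivation kills constants, so on the Hadamard expansion of [h] at [q] only the values of [v]
   on the coordinates remain. The remainder factors are first extended to global functions [G a],
   since [v] acts on nothing else. *)
apply: tangent_ext => h sh; rewrite tsum_act.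
under eq_bigr do rewrite tscale_act /= coord_actE// chi1// mul1r.
have cq : cdom c q by case: Uq.
set y0 := cfwd c q.
have Oq : chart_preim c U y0.
  by split; [exact: cfwd_img|rewrite /= /y0 cfwdK].
have [r r0 rO] := nbhs_box (open_nbhs_nbhs (conj (chart_preim_open (c := c) oU) Oq)).
have rimg : box y0 r `<=` cimg c by move=> y /rO[].
have [g [sg gq gP]] := hadamard r0 (fun k => Ck_sub rimg (sh c ac k)).
pose W := cdom c `&` cfwd c @^-1` box y0 r.
have oW : open W by exact/chart_fwd_preim_open/box_open.
have Wq : W q by split=> //; exact: box_center.
have G_ex a : exists G, smooth G /\ \forall q' \near q, G q' = g a (cfwd c q').
  have [G sG nG] := smooth_extend oW Wq (smooth_over_chart ac (@box_open _ _ _ _) (sg a)).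
  by exists G.
have /choice[G GP] := G_ex.
have sG a := (GP a).1; have nG a := (GP a).2.
pose k q' := h q + \sum_a (x a q' - y0 0 a) * G a q'.
have sxa a : smooth (fun q' => x a q' - y0 0 a) by apply: smoothB => //; exact: smooth_cst.
have st a : smooth (fun q' => (x a q' - y0 0 a) * G a q') by exact: (smoothM (sxa a) (sG a)).
have sS : smooth (fun q' => \sum_a (x a q' - y0 0 a) * G a q') by apply: smooth_sum => a _; exact: st.
have -> : v h = v k.
  apply: tact_near => //; first exact: (smoothD (smooth_cst _) sS).
  have nG' : \forall q' \near q, forall a, G a q' = g a (cfwd c q').
    by apply: filter_forall => a; exact: nG.
  have nU := open_nbhs_nbhs (conj oU Uq); have nW := open_nbhs_nbhs (conj oW Wq).
  apply: filterS (filterI nG' (filterI nU nW)) => q' [Gq' [Uq' [cq' bq']]].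
  have := gP _ bq'; rewrite /= cfwdK// cfwdK// => ->; rewrite /k; congr (_ + _).
  by apply: eq_bigr => a _; rewrite xE// Gq'.
rewrite (tactD v (smooth_cst _) sS) tact_cst add0r tact_sum//.
apply: eq_bigr => a _.
rewrite (tactM v (sxa a) (sG a)) xE// subrr mul0r add0r.
rewrite (tactB v (sx a) (smooth_cst _)) tact_cst subr0 mulrC; congr (_ * _).
by rewrite (nbhs_singleton (nG a)) gq.
Qed.

Lemma frame_exists p : exists U E x, U p /\ frame_on U E x.
Proof.
have [c ac cp] := m_cover p; have [U [E [x [Up _ fr _]]]] := chart_frame ac cp.
by exists U, E, x.
Qed.

End Frame.

(** * Vector fields, 1-forms and the Koszul form *)

Section Fields.
Context {R : realType} {M : manifold R}.
Implicit Types (X Y Z : vfield M) (f h : M -> R) (p : M).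

Lemma field_comb_smooth (I : Type) (s : seq I) (h : I -> M -> R) (E : I -> vfield M) :
  (forall i, smooth (h i)) -> forall f, smooth f ->
  smooth (fun p => (\sum_(i <- s) h i p *: E i p : tangent p) f).
Proof.
move=> sh f sf.
have -> : (fun p => (\sum_(i <- s) h i p *: E i p : tangent p) f) =
    fun p => \sum_(i <- s) (h i \* lie (E i) f) p.
  by apply/funext => p; rewrite tsum_act.
by apply: smooth_sum => i _; apply: smoothM => //; exact: smooth_lie.
Qed.

Definition field_comb (I : Type) (s : seq I) (h : I -> M -> R) (E : I -> vfield M)
  (sh : forall i, smooth (h i)) : vfield M := VField (field_comb_smooth s E sh).

Lemma field_through p (v : tangent p) : exists X, X p = v.
Proof.
have [U [E [x [Up [_ _ _ fr]]]]] := frame_exists p.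
exists (field_comb (enum 'I_(mdim M)) E (fun a => smooth_cst (v (x a)))) => /=.
by rewrite [RHS](fr p v Up) -big_enum.
Qed.

(** Forms take fields as arguments, so evaluating one on a vector requires an extension; by
    [one_form_pointwise] its choice does not matter. *)
Definition field_at p (v : tangent p) : vfield M := projT1 (cid (field_through v)).

Lemma field_atE p (v : tangent p) : field_at v p = v.
Proof. exact: projT2 (cid (field_through v)). Qed.
Section OneForm.
Variables (w : @preform R M) (ow : one_form w).

Lemma one_form_zero X p : (forall q, X q = 0) -> w X p = 0.
Proof.
move=> X0; have := ow.2 _ X X X (smooth_cst 1).
move=> /(_ _ p); rewrite mul1r => H; apply/eqP.
rewrite -(inj_eq (addrI (w X p))) addr0 -H// => q.
by rewrite !X0 scaler0 addr0.
Qed.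

Lemma one_form_comb (I : Type) (s : seq I) (h : I -> M -> R) (E : I -> vfield M) (sh : forall i, smooth (h i)) p :
  w (field_comb s E sh) p = \sum_(i <- s) h i p * w (E i) p.
Proof.
elim: s => [|i s IH].
  by rewrite big_nil; apply: one_form_zero => q; rewrite /= big_nil.
rewrite big_cons -IH; apply: ow.2 => // q.
by rewrite /= big_cons.
Qed.

Lemma one_form_frame U E x p X : frame_on U E x -> U p ->
  w X p = \sum_a X p (x a) * w (E a) p.
Proof.
move=> [oU sx _ fr] Up; have [chi [K [schi n1 cK KU chi0]]] := bump_function oU Up.
have sh a : smooth (chi \* lie X (x a)) by apply: smoothM => //; exact: smooth_lie.
(* The frame expansion of [X] holds on [U] only. After multiplication by [chi] it is an identity
   between global fields, to which linearity applies; the empty combination is the zero field. *)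
have chiX : w (field_comb (enum 'I_(mdim M)) E sh) p = chi p * w X p + w (field_comb [::] E sh) p.
  apply: ow.2 => // q; rewrite /= big_nil addr0 big_enum/=.
  have [/KU Uq|/chi0 ->] := pselect (K q).
    rewrite [X q in RHS](fr q _ Uq) scaler_sumr.
    by apply: eq_bigr => a _; rewrite scalerA.
  by rewrite scale0r big1// => a _; rewrite mul0r scale0r.
have chi1 := nbhs_singleton n1.
move: chiX; rewrite !one_form_comb big_nil addr0 chi1 mul1r big_enum => <-.
by apply: eq_bigr => a _; rewrite /= chi1 mul1r.
Qed.

Lemma one_form_pointwise X Y p : X p = Y p -> w X p = w Y p.
Proof.
move=> XY; have [U [E [x [Up fr]]]] := frame_exists p.
by rewrite (one_form_frame X fr Up) (one_form_frame Y fr Up) XY.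
Qed.

Lemma one_form_at X Y Z a p : Z p = a *: X p + Y p -> w Z p = a * w X p + w Y p.
Proof.
move=> ZXY; have [U [E [x [Up fr]]]] := frame_exists p.
rewrite (one_form_frame X fr Up) (one_form_frame Y fr Up) (one_form_frame Z fr Up) ZXY.
rewrite mulr_sumr -big_split/=; apply: eq_bigr => b _.
by rewrite mulrDl mulrA.
Qed.

End OneForm.

Lemma one_form_add (w t : @preform R M) : one_form w -> one_form t ->
  one_form (fun X p => w X p + t X p : R).
Proof.
move=> [sw lw] [st lt]; split=> [X|f X Y Z sf ZXY p]; first exact: smoothD.
by rewrite (lw f X Y Z)// (lt f X Y Z)// mulrDr addrACA.
Qed.

Lemma one_form_scale f (w : @preform R M) : smooth f -> one_form w ->
  one_form (fun X p => f p * w X p : R).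
Proof.
move=> sf [sw lw]; split=> [X|h X Y Z sh ZXY p]; first exact: smoothM.
by rewrite (lw h X Y Z)// mulrDr mulrCA.
Qed.

Lemma one_form_null : one_form (fun (_ : vfield M) (_ : M) => 0 : R).
Proof. by split=> [X|*]; [exact: smooth_cst|rewrite mulr0 addr0]. Qed.

Lemma one_form_sum (I : Type) (s : seq I) (w : I -> @preform R M) : (forall i, one_form (w i)) ->
  one_form (fun X p => \sum_(i <- s) w i X p : R).
Proof.
move=> ow; elim: s => [|i s IH].
  have -> : (fun X p => \sum_(i <- [::]) w i X p) = fun (_ : vfield M) (_ : M) => 0 : R.
    by apply/funext => X; apply/funext => p; rewrite big_nil.
  exact: one_form_null.
have -> : (fun X p => \sum_(j <- i :: s) w j X p) = fun X p => w i X p + \sum_(j <- s) w j X p.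
  by apply/funext => X; apply/funext => p; rewrite big_cons.
exact: one_form_add.
Qed.

Lemma one_form_d f : smooth f -> one_form (fun X => lie X f).
Proof.
move=> sf; split=> [X|h X Y Z sh ZXY p]; first exact: smooth_lie.
by rewrite /lie ZXY.
Qed.

Lemma lie_near X p f h : smooth f -> smooth h -> (\forall q \near p, f q = h q) ->
  lie X f p = lie X h p.
Proof. by move=> sf sh fh; exact: tact_near. Qed.

Lemma bracket_anti X Y p : bracket X Y p = - bracket Y X p.
Proof.
apply: tangent_ext => f sf; rewrite topp_act /= !bracket_actE//.
by rewrite opprB.
Qed.

Lemma bracket_comb X (A B Z : vfield M) f p : smooth f -> (forall q, Z q = f q *: A q + B q) ->
  bracket X Z p = f p *: bracket X A p + (X p f *: A p + bracket X B p).
Proof.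
move=> sf ZAB; apply: tangent_ext => h sh.
rewrite !(tadd_act, tscale_act) /= !bracket_actE//.
have -> : lie Z h = (f \* lie A h) \+ lie B h.
  by apply/funext => q; rewrite /lie/= ZAB.
have sA := smooth_lie A sh; have sB := smooth_lie B sh.
rewrite (tactD (X p) (smoothM sf sA) sB) (tactM (X p) sf sA) ZAB !(tadd_act, tscale_act).
rewrite /lie; ring.
Qed.

End Fields.

(** * Pullback of 1-forms and fields related by a smooth map *)

Section Pullback.
Context {R : realType} {M N : manifold R} (phi : M -> N) (sphi : smooth_map phi).
Local Notation dphi := (differential sphi).

Lemma differential_comp p (u : tangent p) h : smooth h -> dphi u h = u (h \o phi).
Proof. exact: differential_actE. Qed.

Lemma differential_lin p a (u v : tangent p) : dphi (a *: u + v) = a *: dphi u + dphi v.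
Proof.
apply: tangent_ext => h sh; rewrite !(tadd_act, tscale_act) !differential_comp//.
Qed.

Lemma differential_sum p (I : Type) (s : seq I) (P : pred I) (F : I -> tangent p) :
  dphi (\sum_(i <- s | P i) F i) = \sum_(i <- s | P i) dphi (F i).
Proof.
apply: tangent_ext => h sh; rewrite differential_comp// !tsum_act.
by apply: eq_bigr => i _; rewrite differential_comp.
Qed.

Lemma differentialZ p a (u : tangent p) : dphi (a *: u) = a *: dphi u.
Proof.
by apply: tangent_ext => h sh; rewrite !tscale_act !differential_comp.
Qed.

(** A smooth map is given by its effect on functions, so its continuity is recovered by pulling back
    a bump function. *)
Lemma smooth_map_near V p : open V -> V (phi p) -> \forall q \near p, V (phi q).
Proof.
move=> oV Vp; have [chi [K [schi n1 cK KV chi0]]] := bump_function oV Vp.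
have c : {for p, continuous (chi \o phi)} by exact/smooth_continuous/sphi.
have : \forall q \near p, chi (phi q) > 0.
  apply: (c [set t : R | 0 < t]); apply: open_nbhs_nbhs; split; first exact: open_gt.
  by rewrite /= (nbhs_singleton n1).
apply: filterS => q chiq; apply: KV; apply: contrapT => /chi0 E.
by rewrite E ltxx in chiq.
Qed.

(** [X] need not project to a field of [N], so the form is evaluated at each point on an extension
    of the projected vector. *)
Definition pullback (w : @preform R N) : @preform R M := fun X p => w (field_at (dphi (X p))) (phi p).

Lemma pullbackE w (X : vfield M) (X' : vfield N) p : one_form w -> dphi (X p) = X' (phi p) ->
  pullback w X p = w X' (phi p).
Proof. by move=> ow XX'; apply: (one_form_pointwise ow); rewrite field_atE XX'. Qed.

Lemma pullback_frame w U E x X p : one_form w -> frame_on U E x -> U (phi p) ->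
  pullback w X p = \sum_a X p (x a \o phi) * w (E a) (phi p).
Proof.
move=> ow fr Up; rewrite /pullback (one_form_frame ow _ fr Up).
apply: eq_bigr => a _; rewrite field_atE differential_comp//.
by case: fr.
Qed.

Lemma pullback_one_form w : one_form w -> one_form (pullback w).
Proof.
move=> ow; split=> [X|f X Y Z sf ZXY p]; last first.
  by apply: (one_form_at ow); rewrite !field_atE ZXY differential_lin.
apply: smooth_near_eq => p; have [U [E [x [Up fr]]]] := frame_exists (phi p).
exists (fun q => \sum_a (lie X (x a \o phi) \* (w (E a) \o phi)) q).
  apply: smooth_sum => a _; apply: smoothM.
    by apply: smooth_lie; apply: sphi; case: fr.
  by apply: sphi; exact: ow.1.
have [oU _ _ _] := fr.
by apply: filterS (smooth_map_near oU Up) => q Uq; rewrite (pullback_frame X ow fr Uq).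
Qed.

Definition related_on (U : set M) (X : vfield M) (X' : vfield N) :=
  forall p, U p -> dphi (X p) = X' (phi p).

Lemma related_lie U X X' h p : related_on U X X' -> smooth h -> U p ->
  lie X (h \o phi) p = lie X' h (phi p).
Proof. by move=> rX sh /rX E; rewrite /lie -E differential_comp. Qed.

Lemma related_bracket U X X' Y Y' : open U -> related_on U X X' -> related_on U Y Y' ->
  related_on U (bracket X Y) (bracket X' Y').
Proof.
move=> oU rX rY p Up; apply: tangent_ext => h sh.
have nU := open_nbhs_nbhs (conj oU Up).
have shp := sphi sh.
rewrite differential_comp//= !bracket_actE//.
have E A A' B B' : related_on U A A' -> related_on U B B' ->
    A p (lie B (h \o phi)) = A' (phi p) (lie B' h).
  move=> rA rB; have sB := smooth_lie B' sh.
  apply: (etrans _ (related_lie rA sB Up)); apply: lie_near; first exact: smooth_lie.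
    exact: sphi.
  by apply: filterS nU => q Uq; exact: related_lie rB sh Uq.
by rewrite (E _ _ _ _ rX rY) (E _ _ _ _ rY rX).
Qed.

End Pullback.

(** * Algebra of the metric and of the Koszul form *)

Section Metric.
Context {R : realType} {M : manifold R} (g : tensor02 M) (sg : semi_riemannian g).
Arguments g : clear implicits.
Implicit Types (X Y Z : vfield M) (f h : M -> R) (p : M).

Definition inner X Y : M -> R := fun p => g p (X p) (Y p).

Lemma metricC p u v : g p u v = g p v u. Proof. by case: sg. Qed.
Lemma metric_linl p a u v w : g p (a *: u + v) w = a * g p u w + g p v w.
Proof. by case: sg => _ lin _; exact: lin. Qed.
Lemma metric_linr p a u v w : g p w (a *: u + v) = a * g p w u + g p w v.
Proof. by rewrite !(metricC w) metric_linl. Qed.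
Lemma metric0l p w : g p 0 w = 0.
Proof. by have := metric_linl (-1) 0 0 w; rewrite scaler0 addr0 mulN1r addNr. Qed.
Lemma metric0r p w : g p w 0 = 0.
Proof. by rewrite metricC metric0l. Qed.
Lemma metricDl p u v w : g p (u + v) w = g p u w + g p v w.
Proof. by have := metric_linl 1 u v w; rewrite scale1r mul1r. Qed.
Lemma metricDr p u v w : g p w (u + v) = g p w u + g p w v.
Proof. by rewrite !(metricC w) metricDl. Qed.
Lemma metricZl p a u w : g p (a *: u) w = a * g p u w.
Proof. by rewrite -[a *: u]addr0 metric_linl metric0l addr0. Qed.
Lemma metricZr p a u w : g p w (a *: u) = a * g p w u.
Proof. by rewrite !(metricC w) metricZl. Qed.
Lemma metricNl p u w : g p (- u) w = - g p u w.
Proof. by rewrite -scaleN1r metricZl mulN1r. Qed.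
Lemma metricNr p u w : g p w (- u) = - g p w u.
Proof. by rewrite !(metricC w) metricNl. Qed.
Lemma metric_suml p (I : Type) (s : seq I) (P : pred I) (F : I -> tangent p) w :
  g p (\sum_(i <- s | P i) F i) w = \sum_(i <- s | P i) g p (F i) w.
Proof. exact: (big_morph (fun u => g p u w) (fun u v => metricDl u v w) (metric0l w)). Qed.
Lemma metric_sumr p (I : Type) (s : seq I) (P : pred I) (F : I -> tangent p) w :
  g p w (\sum_(i <- s | P i) F i) = \sum_(i <- s | P i) g p w (F i).
Proof. by rewrite metricC metric_suml; apply: eq_bigr => i _; exact: metricC. Qed.

Lemma inner_smooth X Y : smooth (inner X Y). Proof. by case: sg => _ _; exact. Qed.
Lemma inner_sym X Y : inner X Y = inner Y X.
Proof. by apply/funext => p; exact: metricC. Qed.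

Lemma flat_one_form Y : one_form (fun X => inner Y X).
Proof.
split=> [X|f A B Z sf ZAB p]; first exact: inner_smooth.
by rewrite /inner ZAB metric_linr.
Qed.

Lemma koszulE X Y Z p : koszul g X Y Z p =
  2^-1 * (lie X (inner Y Z) p + lie Y (inner Z X) p - lie Z (inner X Y) p
          - g p (X p) (bracket Y Z p) + g p (Y p) (bracket Z X p)
          + g p (Z p) (bracket X Y p)).
Proof. by []. Qed.

Lemma inner_comb (Y A B Z : vfield M) f : (forall q, Z q = f q *: A q + B q) ->
  inner Y Z = (f \* inner Y A) \+ inner Y B.
Proof. by move=> ZAB; apply/funext => q; rewrite /inner/= ZAB metric_linr. Qed.

Lemma koszul_smooth X Y Z : smooth (koszul g X Y Z).
Proof.
have sl A B C := smooth_lie A (inner_smooth B C).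
have -> : koszul g X Y Z = 2^-1 \*o (fun p => (((((lie X (inner Y Z) p + lie Y (inner Z X) p)
    - lie Z (inner X Y) p) - inner X (bracket Y Z) p) + inner Y (bracket Z X) p)
    + inner Z (bracket X Y) p)) by [].
apply: smoothZ; do 2 (apply: smoothD; last exact: inner_smooth).
apply: smoothB; last exact: inner_smooth.
by apply: smoothB => //; apply: smoothD.
Qed.

(** Metric compatibility. It carries what tensoriality gives in the last slot over to the middle
    slot, which is how [koszul_near] and [koszul_comb] follow, and later it removes derivatives of
    inner products. *)
Lemma koszul_compat X Y Z p : koszul g X Y Z p + koszul g X Z Y p = lie X (inner Y Z) p.
Proof.
rewrite !koszulE (inner_sym Z Y) (inner_sym X Z) (inner_sym Y X).
rewrite (bracket_anti Z Y) (bracket_anti Z X) (bracket_anti Y X) !metricNr.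
by field.
Qed.

Lemma koszul_one_form X Y : one_form (koszul g X Y).
Proof.
split=> [Z|f A B Z sf ZAB p]; first exact: koszul_smooth.
rewrite !koszulE (bracket_comb Y p sf ZAB) (bracket_anti Z X) (bracket_comb X p sf ZAB).
rewrite (inner_sym Z X) !(inner_comb _ ZAB).
have sA C := inner_smooth C A; have sB C := inner_smooth C B.
have sfA C := smoothM sf (sA C).
rewrite /lie !tactD// !tactM// -?/(lie _ _) ZAB !(metric_linl, metric_linr, metricDr, metricZr, metricNr).
rewrite (bracket_anti A X) (bracket_anti B X) !metricNr (inner_sym A X) (inner_sym B X).
rewrite !(tadd_act, tscale_act) /inner; ring.
Qed.

Lemma koszul_one_form_l Y Z : one_form (fun X => koszul g X Y Z).
Proof.
split=> [X|f A B X sf XAB p]; first exact: koszul_smooth.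
rewrite !koszulE (bracket_anti X Y) (bracket_comb Z p sf XAB) (bracket_comb Y p sf XAB).
rewrite (inner_sym X Y) !(inner_comb _ XAB).
have sA C := inner_smooth C A; have sB C := inner_smooth C B.
have sfA C := smoothM sf (sA C).
rewrite /lie !tactD// !tactM// XAB !(metric_linl, metric_linr, metricDr, metricZr, metricNr).
rewrite (bracket_anti A Y) (bracket_anti B Y) !metricNr (inner_sym A Y) (inner_sym B Y).
rewrite !(tadd_act, tscale_act) /inner; ring.
Qed.

Lemma koszul_near X Y Y' Z p : (\forall q \near p, Y q = Y' q) ->
  koszul g X Y Z p = koszul g X Y' Z p.
Proof.
move=> YY'; apply: (addIr (koszul g X Z Y p)); rewrite koszul_compat.
rewrite (one_form_pointwise (koszul_one_form X Z) (nbhs_singleton YY')) koszul_compat.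
apply: lie_near; try exact: inner_smooth.
by apply: filterS YY' => q E; rewrite /inner E.
Qed.

Lemma koszul_comb X Z (I : Type) (s : seq I) (h : I -> M -> R) (E : I -> vfield M) (sh : forall i, smooth (h i)) p :
  koszul g X (field_comb s E sh) Z p =
    \sum_(i <- s) (h i p * koszul g X (E i) Z p + lie X (h i) p * inner (E i) Z p).
Proof.
apply: (addIr (koszul g X Z (field_comb s E sh) p)); rewrite koszul_compat.
rewrite (one_form_comb (koszul_one_form X Z)) -big_split/=.
have sI i : smooth (inner (E i) Z) by exact: inner_smooth.
have -> : inner (field_comb s E sh) Z = fun q => \sum_(i <- s) (h i \* inner (E i) Z) q.
  by apply/funext => q; rewrite /inner/= metric_suml; apply: eq_bigr => i _; rewrite metricZl.
rewrite /lie tact_sum; last by move=> i _; exact: smoothM.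
apply: eq_bigr => i _; rewrite tactM//.
have := koszul_compat X (E i) Z p; rewrite /lie => <-; ring.
Qed.

Lemma cocontractionE w t p u v : represents g u w -> represents g v t ->
  cocontraction g w t p = g p u v.
Proof.
move=> ru rv; rewrite /cocontraction.
case: xgetP => [a _ [u' [v' [ru' rv' ->]]]|/(_ (g p u v))]; last by case; exists u, v.
have -> : g p u' v' = g p u v'.
  by rewrite -(field_atE v') -ru' -ru.
rewrite !(metricC u); rewrite -(field_atE u) -rv'.
by rewrite -rv.
Qed.

Lemma represents_frame p u U E x (w : @preform R M) : one_form w -> frame_on U E x -> U p ->
  (forall a, w (E a) p = g p u (E a p)) -> represents g u w.
Proof.
move=> ow fr Up wE Y; rewrite (one_form_frame ow Y fr Up).
have [_ _ _ dec] := fr; rewrite [X in g p u X](dec p _ Up) metric_sumr.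
by apply: eq_bigr => a _; rewrite wE metricZr.
Qed.

End Metric.

(** * The index and points of constant signature *)

Section Congruence.
Variable R : realType.

(** Polarization: if [G i j] is nonzero while [G i i] and [G j j] vanish, the sum of the two basis
    vectors takes the value [2 * G i j]. *)
Lemma symmetric_anisotropic n (G : 'M[R]_n) : G^T = G -> G != 0 ->
  exists v : 'rV[R]_n, (v *m G *m v^T) 0 0 != 0.
Proof.
move=> sG G0.
have dE (i j : 'I_n) : ((delta_mx 0 i : 'rV[R]_n) *m G *m (delta_mx 0 j : 'rV[R]_n)^T) 0 0 = G i j.
  by rewrite -rowE trmx_delta -colE !mxE.
have [i [j Gij]] : exists i j, G i j != 0.
  apply: contrapT => H; move/eqP: G0; apply; apply/matrixP => i j; rewrite mxE.
  by apply/eqP; apply: contrapT => Gij; apply: H; exists i, j; apply/negP.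
have [Gii|/eqP Gii] := eqVneq (G i i) 0; last by exists (delta_mx 0 i); rewrite dE; apply/eqP.
have [Gjj|/eqP Gjj] := eqVneq (G j j) 0; last by exists (delta_mx 0 j); rewrite dE; apply/eqP.
have Gji : G j i = G i j by rewrite -[in LHS]sG mxE.
exists (delta_mx 0 i + delta_mx 0 j).
rewrite linearD/= !mulmxDl !mulmxDr.
have D (A B : 'M[R]_1) : (A + B) 0 0 = A 0 0 + B 0 0 by rewrite mxE.
rewrite !D !dE Gii Gjj Gji add0r addr0.
by rewrite -mulr2n mulrn_eq0 negb_or.
Qed.

(** Splits off an anisotropic vector [v] and continues on its orthogonal complement: the rows of [W]
    are a basis of the kernel of [h], which misses [v]. *)
Lemma symmetric_diagonalization n (G : 'M[R]_n) : G^T = G ->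
  exists2 P, P \in unitmx & forall i j, i != j -> (P *m G *m P^T) i j = 0.
Proof.
elim: n G => [|n IH] G sG; first by exists 1%:M; [exact: unitmx1|case].
have [->|G0] := eqVneq G 0.
  by exists 1%:M; [exact: unitmx1|move=> i j _; rewrite mulmx0 mul0mx mxE].
have [v vG] := symmetric_anisotropic sG G0.
pose h : 'cV[R]_n.+1 := G *m v^T.
have vh : v *m h = ((v *m G *m v^T) 0 0)%:M by rewrite /h mulmxA -mx11_scalar.
have h0 : h != 0.
  apply: contra_neq vG => h0; have := congr1 (fun A : 'M[R]_1 => A 0 0) vh.
  by rewrite h0 mulmx0 !mxE eqxx mulr1n => <-.
have rh : \rank h = 1%N.
  by apply/eqP; rewrite eqn_leq rank_leq_col/= lt0n mxrank_eq0.
have rk : \rank (kermx h) = n by rewrite mxrank_ker rh subn1.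
have [W Wfree Wh] : exists2 W : 'M[R]_(n, n.+1), row_free W & W *m h = 0.
  have fr := row_base_free (kermx h).
  have kr : row_base (kermx h) *m h = 0.
    by apply/sub_kermxP; rewrite eq_row_base.
  move: (row_base (kermx h)) fr kr; rewrite rk => W fr kr; by exists W.
pose P0 : 'M[R]_(1 + n) := col_mx v W.
have P0u : P0 \in unitmx.
  rewrite -row_free_unit -kermx_eq0; apply/rowV0P => x /sub_kermxP.
  rewrite -[x]hsubmxK /P0 (@mul_row_col R 1 1 n) => E.
  have : (lsubmx x *m v + rsubmx x *m W) *m h = 0 by rewrite E mul0mx.
  rewrite mulmxDl -!mulmxA Wh mulmx0 addr0 vh mul_mx_scalar => /eqP.
  rewrite scaler_eq0 (negPf vG)/= => /eqP l0.
  move: E; rewrite l0 mul0mx add0r => /eqP.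
  rewrite mulmx_free_eq0// => /eqP ->.
  by rewrite -[RHS](@row_mx0 R 1 1 n).
have sW : (W *m G *m W^T)^T = W *m G *m W^T by rewrite !trmx_mul trmxK sG mulmxA.
have [P1 P1u P1d] := IH _ sW.
pose S : 'M[R]_(1 + n) := block_mx 1%:M 0 0 P1.
have Su : S \in unitmx by rewrite unitmxE (@det_ublock R 1 n) det1 mul1r -unitmxE.
exists (S *m P0); first by rewrite unitmx_mul Su.
have vGW : v *m G *m W^T = 0.
  have : (v *m G *m W^T)^T = 0 by rewrite !trmx_mul trmxK sG -/h Wh.
  by move/(congr1 trmx); rewrite trmxK trmx0.
have WGv : W *m G *m v^T = 0 by rewrite -mulmxA.
have PGP : P0 *m G *m P0^T = block_mx (v *m G *m v^T) 0 0 (W *m G *m W^T) :> 'M[R]_(1 + n).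
  by rewrite /P0 (@mul_col_mx R 1 n) (@tr_col_mx R 1 n) (@mul_col_row R 1 n) vGW WGv.
have SPG : S *m P0 *m G *m (S *m P0)^T =
    block_mx (v *m G *m v^T) 0 0 (P1 *m (W *m G *m W^T) *m P1^T) :> 'M[R]_(1 + n).
  rewrite trmx_mul !mulmxA -[S *m P0 *m G]mulmxA -[S *m _ *m P0^T]mulmxA PGP.
  rewrite /S (@tr_block_mx R 1 n) !trmx0 trmx1 !(@mulmx_block R 1 n).
  by rewrite !(mul0mx, mulmx0, add0r, addr0, mul1mx, mulmx1) !mulmxA.
move=> i j ij; rewrite SPG.
rewrite -[i](@splitK 1 n) -[j](@splitK 1 n) in ij *.
move: ij; case: (@fintype.split 1 n i) => i'; case: (@fintype.split 1 n j) => j' /=.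
- by rewrite (ord1 i') (ord1 j') eqxx.
- by rewrite (@block_mxEur R 1 n 1 n) mxE.
- by rewrite (@block_mxEdl R 1 n 1 n) mxE.
- by rewrite (@block_mxEdr R 1 n 1 n) => ij; apply: P1d; apply: contra_neq ij => ->.
Qed.

End Congruence.

(** * The index, its semicontinuity, and density of constant signature *)

Section Signature.
Context {R : realType} {M : manifold R} (g : tensor02 M) (sg : semi_riemannian g).
Arguments g : clear implicits.
Local Notation n := (mdim M).

Definition orthogonal_basis p (e : 'I_n -> tangent p) : Prop :=
  tbasis e /\ forall i j, i != j -> g p (e i) (e j) = 0.

(* For [sigma = 1] and [sigma = -1] this is the negative and the positive index. *)
Definition index_of (sigma : R) p (e : 'I_n -> tangent p) : nat :=
  #|[pred i | sigma * g p (e i) (e i) < 0]|.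

Lemma frame_tbasis (U : set M) (E : 'I_n -> vfield M) x p : frame_on U E x -> U p -> @tbasis R M p n (fun a => E a p).
Proof.
move=> [_ _ xE fr] Up v; exists [ffun a => v (x a)]; split.
  by rewrite [LHS](fr p v Up); apply: eq_bigr => a _; rewrite ffunE.
move=> b vb; apply/ffunP => a; rewrite ffunE vb tsum_act.
under eq_bigr do rewrite tscale_act xE//.
by rewrite (bigD1 a)//= eqxx mulr1 big1 ?addr0// => c /negPf ->; rewrite mulr0.
Qed.

Lemma tbasis_unit_comb p (e : 'I_n -> tangent p) (P : 'M[R]_n) : tbasis e -> P \in unitmx ->
  @tbasis R M p n (fun i => \sum_j P i j *: e j).
Proof.
move=> be Pu v.
have comb (b : {ffun 'I_n -> R}) : \sum_i b i *: (\sum_j P i j *: e j) =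
    \sum_j ([ffun j => ((\row_i b i) *m P) 0 j] j) *: e j.
  under eq_bigr do rewrite scaler_sumr.
  rewrite exchange_big/=; apply: eq_bigr => j _; rewrite ffunE mxE scaler_suml.
  by apply: eq_bigr => i _; rewrite mxE scalerA.
have [a [va ua]] := be v.
exists [ffun i => ((\row_j a j) *m invmx P) 0 i]; split.
  rewrite comb va; apply: eq_bigr => j _; rewrite !ffunE; congr (_ *: _).
  rewrite (_ : \row_i _ = (\row_j a j) *m invmx P); last first.
    by apply/rowP => i; rewrite mxE ffunE.
  by rewrite mulmxKV// mxE.
move=> b vb; have := ua _ (etrans vb (comb b)).
move=> ab; apply/ffunP => i; rewrite ffunE ab.
rewrite (_ : \row_j _ = (\row_i b i) *m P); last by apply/rowP => j; rewrite mxE ffunE.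
by rewrite mulmxK// mxE.
Qed.

Lemma orthogonal_basis_exists p : exists e : 'I_n -> tangent p, orthogonal_basis e.
Proof.
have [U [E [x [Up fr]]]] := frame_exists p.
pose G : 'M[R]_n := \matrix_(i, j) g p (E i p) (E j p).
have sG : G^T = G by apply/matrixP => i j; rewrite !mxE metricC.
have [P Pu Pd] := symmetric_diagonalization sG.
exists (fun i => \sum_j P i j *: E j p); split.
  exact: (tbasis_unit_comb (frame_tbasis fr Up) Pu).
move=> i j /Pd; rewrite !mxE => H; rewrite -[RHS]H metric_sumr//.
apply: eq_bigr => k _; rewrite metricZr// metric_suml// !mxE mulr_suml mulr_sumr.
by apply: eq_bigr => l _; rewrite metricZl// mxE; ring.
Qed.

Lemma metric_diag p (e : 'I_n -> tangent p) (c : 'I_n -> R) : orthogonal_basis e ->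
  g p (\sum_k c k *: e k) (\sum_k c k *: e k) = \sum_k c k ^+ 2 * g p (e k) (e k).
Proof.
move=> [_ oe]; rewrite metric_suml//; apply: eq_bigr => k _.
rewrite metricZl// metric_sumr// (bigD1 k)//= metricZr// big1 => [|j jk].
  by rewrite addr0 expr2 mulrA.
by rewrite metricZr// oe ?mulr0// eq_sym.
Qed.

(** If there were more vectors than negative basis elements, a nonzero combination would have no
    component along those elements, and on it [sigma * g] would be nonnegative. *)
Lemma inertia (sigma : R) p (e : 'I_n -> tangent p) (s : nat) (v : 'I_s -> tangent p) :
  orthogonal_basis e ->
  (forall x : 'rV[R]_s, x != 0 ->
    sigma * g p (\sum_i x 0 i *: v i) (\sum_i x 0 i *: v i) < 0) ->
  (s <= index_of sigma e)%N.
Proof.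
move=> oe neg; rewrite leqNgt; apply/negP => lt.
have [a aP] : exists a : 'I_s -> 'I_n -> R, forall i, v i = \sum_k a i k *: e k.
  have /choice[a aP] : forall i, exists a : {ffun 'I_n -> R}, v i = \sum_k a k *: e k.
    by move=> i; have [a [-> _]] := oe.1 (v i); exists a.
  by exists (fun i k => a i k).
pose A : 'M[R]_(s, index_of sigma e) := \matrix_(i, k) a i (enum_val k).
have : kermx A != 0.
  rewrite -mxrank_eq0 mxrank_ker -lt0n subn_gt0.
  exact: leq_ltn_trans (rank_leq_col A) lt.
case/rowV0Pn => x /sub_kermxP xA x0.
have := neg x x0.
pose c k := \sum_i x 0 i * a i k.
have -> : \sum_i x 0 i *: v i = \sum_k c k *: e k.
  under eq_bigr do rewrite aP scaler_sumr.
  rewrite exchange_big/=; apply: eq_bigr => k _; rewrite scaler_suml.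
  by apply: eq_bigr => i _; rewrite scalerA.
rewrite metric_diag// mulr_sumr ltNge sumr_ge0// => k _.
have [kn|kn] := boolP (k \in [pred i | sigma * g p (e i) (e i) < 0]).
  suff -> : c k = 0 by rewrite expr0n/= mul0r mulr0.
  have := congr1 (fun B : 'rV_(index_of sigma e) => B 0 (enum_rank_in kn k)) xA.
  rewrite !mxE => H; rewrite -[RHS]H; apply: eq_bigr => i _.
  by rewrite mxE enum_rankK_in.
rewrite mulrCA mulr_ge0// ?sqr_ge0//.
by rewrite inE -leNgt in kn.
Qed.

(** Since [|x_i x_j| <= (x_i^2 + x_j^2) / 2], entrywise errors up to [eps] add at most [s * eps]
    times the sum of squares. *)
Lemma neg_def_perturb (s : nat) (A : 'I_s -> 'I_s -> R) (d : 'I_s -> R) (eps : R) :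
  0 < eps -> (forall i, d i + s%:R * eps < 0) ->
  (forall i j, `|A i j - (i == j)%:R * d i| <= eps) ->
  forall x : 'rV[R]_s, x != 0 -> \sum_i \sum_j x 0 i * x 0 j * A i j < 0.
Proof.
move=> e0 dn Ad x x0.
have b i j : x 0 i * x 0 j * A i j <=
    (i == j)%:R * (x 0 i * x 0 j * d i) + eps * (x 0 i ^+ 2 / 2 + x 0 j ^+ 2 / 2).
  have -> : x 0 i * x 0 j * A i j = (i == j)%:R * (x 0 i * x 0 j * d i) +
      x 0 i * x 0 j * (A i j - (i == j)%:R * d i) by ring.
  rewrite lerD2l (le_trans (ler_norm _))// normrM mulrC.
  apply: ler_pM => //.
  rewrite normrM -(real_normK (num_real (x 0 i))) -(real_normK (num_real (x 0 j))).
  have := sqr_ge0 (`|x 0 i| - `|x 0 j|); rewrite sqrrB; lra.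
apply: (@le_lt_trans _ _ (\sum_i x 0 i ^+ 2 * (d i + s%:R * eps))).
  apply: (le_trans (ler_sum _ (fun i _ => ler_sum _ (fun j _ => b i j)))).
  under eq_bigr => i _.
    rewrite big_split/= (bigD1 i)//= eqxx mul1r big1 ?addr0; last first.
      by move=> j; rewrite eq_sym => /negPf ->; rewrite mul0r.
    rewrite -mulr_sumr big_split/= sumr_const card_ord.
    over.
  rewrite big_split/= -mulr_sumr big_split/=.
  rewrite [X in _ * (_ + X)]exchange_big/=.
  under [X in _ * (_ + X)]eq_bigr => i _ do rewrite sumr_const card_ord.
  rewrite -big_split/= mulr_sumr -big_split/=; apply: ler_sum => i _.
  by rewrite -(mulr_natr (x 0 i ^+ 2 / 2) s) le_eqVlt; apply/orP; left; apply/eqP; field.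
have [i xi] : exists i, x 0 i != 0.
  apply: contrapT => H; move/eqP: x0; apply; apply/rowP => i; rewrite mxE.
  by apply/eqP; apply: contrapT => xi; apply: H; exists i; apply/negP.
rewrite (bigD1 i)//= -[ltRHS]addr0 ltr_leD//.
  by rewrite pmulr_rlt0 ?dn// lt_def sqr_ge0 sqrf_eq0 xi.
by rewrite sumr_le0// => j _; rewrite mulr_ge0_le0 ?sqr_ge0// ltW.
Qed.

(** The negative vectors at [p] extend to fields whose Gram matrix stays negative definite nearby.
    Quantifying over all bases at [q], including [q = p], makes the index well defined as well. *)
Lemma index_semicontinuous (sigma : R) p (e : 'I_n -> tangent p) : orthogonal_basis e ->
  \forall q \near p, forall e' : 'I_n -> tangent q, orthogonal_basis e' ->
    (index_of sigma e <= index_of sigma e')%N.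
Proof.
move=> oe.
set s := index_of sigma e.
pose f (i : 'I_s) : 'I_n := enum_val i.
pose d (i : 'I_s) := sigma * g p (e (f i)) (e (f i)).
have d0 i : d i < 0.
  by have := enum_valP i; rewrite inE.
pose X (i : 'I_s) := field_at (e (f i)).
have [eps e0 de] : exists2 eps : R, 0 < eps & forall i, d i + s%:R * eps < 0.
  (* The default 1 only serves the empty family and positivity; dividing by [s + 1] yields
     [s * eps < m] and is legitimate for [s = 0]. *)
  pose m := \big[Order.min/1]_i (- d i).
  have m0 : 0 < m by apply: lt_bigmin => // i _; rewrite oppr_gt0.
  exists (m / (s%:R + 1)); first by rewrite divr_gt0// ltr_wpDl.
  move=> i; have mi : m <= - d i by exact: bigmin_le_cond.
  have : s%:R * (m / (s%:R + 1)) < m.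
    by rewrite mulrA ltr_pdivrMr ?ltr_wpDl// mulrC ltr_pM2l// ltrDl.
  lra.
have nA : \forall q \near p, forall ij : 'I_s * 'I_s,
    `|sigma * inner g (X ij.1) (X ij.2) q - (ij.1 == ij.2)%:R * d ij.1| < eps.
  apply: filter_forall => -[i j] /=.
  have c : {for p, continuous (sigma \*o inner g (X i) (X j))}.
    by apply/smooth_continuous/smoothZ/inner_smooth.
  have E : (sigma \*o inner g (X i) (X j)) p = (i == j)%:R * d i.
    rewrite /= /inner !field_atE; case: eqP => [->|/eqP ij]; first by rewrite mul1r.
    by rewrite oe.2 ?mulr0 ?mul0r// (inj_eq enum_val_inj).
  have := c; move/cvgrPdist_lt => /(_ _ e0); rewrite E.
  by apply: filterS => q; rewrite distrC.
apply: filterS nA => q nA e' oe'.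
apply: (@inertia sigma q e' s (fun i => X i q) oe') => x x0.
rewrite metric_suml// mulr_sumr.
under eq_bigr do rewrite metricZl// metric_sumr// !mulr_sumr.
have := @neg_def_perturb s (fun i j => sigma * inner g (X i) (X j) q) d eps e0 de _ x x0.
have H i j : `|sigma * inner g (X i) (X j) q - (i == j)%:R * d i| <= eps.
  by rewrite ltW//; exact: (nA (i, j)).
move=> /(_ H); congr (_ < _); apply: eq_bigr => i _; apply: eq_bigr => j _.
by rewrite metricZr// /inner; ring.
Qed.

(** Sylvester's law of inertia, as semicontinuity in both directions at the point itself. *)
Lemma index_unique (sigma : R) p (e e' : 'I_n -> tangent p) : orthogonal_basis e ->
  orthogonal_basis e' -> index_of sigma e = index_of sigma e'.
Proof.
move=> oe oe'; apply/eqP; rewrite eqn_leq.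
by rewrite (nbhs_singleton (index_semicontinuous sigma oe))// (nbhs_singleton (index_semicontinuous sigma oe')).
Qed.

Definition index_at (sigma : R) p : nat :=
  index_of sigma (projT1 (cid (orthogonal_basis_exists p))).

Lemma index_atE sigma p (e : 'I_n -> tangent p) : orthogonal_basis e ->
  index_at sigma p = index_of sigma e.
Proof. by move=> oe; apply: index_unique => //; exact: projT2 (cid (orthogonal_basis_exists p)). Qed.

Lemma index_at_near sigma p : \forall q \near p, (index_at sigma p <= index_at sigma q)%N.
Proof.
have [e oe] := orthogonal_basis_exists p; rewrite (index_atE _ oe).
apply: filterS (index_semicontinuous sigma oe) => q H.
have [e' oe'] := orthogonal_basis_exists q; rewrite (index_atE _ oe'); exact: H.
Qed.

Lemma index_of1 p (e : 'I_n -> tangent p) : index_of 1 e = #|[pred i | g p (e i) (e i) < 0]|.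
Proof. by apply: eq_card => i; rewrite !inE mul1r. Qed.

Lemma index_ofN1 p (e : 'I_n -> tangent p) : index_of (-1) e = #|[pred i | g p (e i) (e i) > 0]|.
Proof. by apply: eq_card => i; rewrite !inE mulN1r oppr_lt0. Qed.

Lemma index_card p (e : 'I_n -> tangent p) :
  (#|[pred i | g p (e i) (e i) == 0%R]| + (index_of 1%R e + index_of (-1)%R e) = n)%N.
Proof.
rewrite index_of1 index_ofN1 -[RHS]card_ord -!sum1_card [RHS]big_mkcond/=.
rewrite [X in (X + _)%N]big_mkcond [X in (_ + (X + _))%N]big_mkcond.
rewrite [X in (_ + (_ + X))%N]big_mkcond /= -!big_split/=; apply: eq_bigr => i _; rewrite !inE.
by case: ltgtP.
Qed.

(** The null count is the remainder left by the other two, so a signature amounts to the two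
    indices. *)
Lemma has_signatureP p r s t : has_signature g p r s t <->
  [/\ (r = n - (s + t))%N, (s + t <= n)%N, s = index_at 1 p & t = index_at (-1) p].
Proof.
split=> [[e [be oe <- <- <-]]|[-> le -> ->]].
  have ob : orthogonal_basis e by split.
  rewrite !(index_atE _ ob) -index_of1 -index_ofN1 -[in X in (X - _)%N](index_card e) addnK.
  by split=> //; rewrite -[leqRHS](index_card e) leq_addl.
have [e oe] := orthogonal_basis_exists p.
rewrite !(index_atE _ oe); exists e; split; [exact: oe.1|exact: oe.2| |exact/esym/index_of1|exact/esym/index_ofN1].
by rewrite -[in RHS](index_card e) addnK.
Qed.

Lemma index_le p : (index_at 1 p + index_at (-1) p <= n)%N.
Proof.
have [e oe] := orthogonal_basis_exists p; rewrite !(index_atE _ oe).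
by rewrite -[leqRHS](index_card e) leq_addl.
Qed.

Lemma constant_signature_nearP p : constant_signature_near g p <->
  \forall q \near p, index_at 1 q = index_at 1 p /\ index_at (-1) q = index_at (-1) p.
Proof.
split=> [[r [s [t nq]]]|nq].
  have /has_signatureP[_ _ sp tp] := nbhs_singleton nq.
  by apply: filterS nq => q /has_signatureP[_ _ sq tq]; rewrite -sp -tp -sq -tq.
exists (n - (index_at 1 p + index_at (-1) p))%N, (index_at 1 p), (index_at (-1) p).
apply: filterS nq => q [e1 e2]; apply/has_signatureP; split=> //.
exact: index_le.
Qed.

(** Maximizing the sum of the two indices over [U] gives a point near which neither can grow, so
    that both are constant near the same point. *)
Lemma constant_signature_dense (U : set M) : open U -> U !=set0 ->
  exists2 q, U q & constant_signature_near g q.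
Proof.
move=> oU [p Up].
pose P k := `[< exists2 q, U q & (index_at 1 q + index_at (-1) q = k)%N >].
have exP : exists k, P k by exists (index_at 1 p + index_at (-1) p)%N; apply/asboolP; exists p.
have ubP k : P k -> (k <= n)%N by move=> /asboolP[q _ <-]; exact: index_le.
have [k /asboolP[q Uq qk] kmax] := ex_maxnP exP ubP.
exists q => //; apply/constant_signature_nearP.
have n1 := index_at_near 1 q; have n2 := index_at_near (-1) q.
have nU := open_nbhs_nbhs (conj oU Uq).
apply: filterS (filterI nU (filterI n1 n2)) => q' [Uq' [l1 l2]].
have : (index_at 1 q' + index_at (-1) q' <= index_at 1 q + index_at (-1) q)%N.
  by rewrite qk; apply: kmax; apply/asboolP; exists q'.
have : forall a b a' b' : nat, (a <= a')%N -> (b <= b')%N -> (a' + b' <= a + b)%N -> a' = a /\ b' = b.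
  move=> a b a' b' aa bb le; split; apply/eqP; rewrite eqn_leq.
    by rewrite aa andbT -(leq_add2r b) (leq_trans _ le)// leq_add2l.
  by rewrite bb andbT -(leq_add2l a) (leq_trans _ le)// leq_add2r.
by apply.
Qed.

End Signature.

(** * Representing vectors and local criteria for semi-regularity *)

Section Sharp.
Context {R : realType} {M : manifold R} (g : tensor02 M) (sg : semi_riemannian g).
Arguments g : clear implicits.
Local Notation n := (mdim M).

Lemma smooth_det m (A : M -> 'M[R]_m) : (forall i j, smooth (fun p => A p i j)) ->
  smooth (fun p => \det (A p)).
Proof.
move=> sA; apply: smooth_sum => s _; apply: smoothM; first exact: smooth_cst.
by apply: smooth_prod => i; exact: sA.
Qed.

Definition gram (E : 'I_n -> vfield M) p : 'M[R]_n := \matrix_(a, b) inner g (E a) (E b) p.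

Lemma smooth_gram E a b : smooth (fun p => gram E p a b).
Proof.
have -> : (fun p => gram E p a b) = inner g (E a) (E b) by apply/funext => p; rewrite mxE.
exact: inner_smooth.
Qed.

Lemma smooth_gram_cofactor E a b : smooth (fun p => cofactor (gram E p) a b).
Proof.
apply: smoothM; first exact: smooth_cst.
apply: smooth_det => i j.
have -> : (fun p => row' a (col' b (gram E p)) i j) = fun p => gram E p (lift a i) (lift b j).
  by apply/funext => p; rewrite !mxE.
exact: smooth_gram.
Qed.

Hypothesis ng : nondegenerate_metric g.

Lemma gram_unit U E x p : frame_on U E x -> U p -> gram E p \in unitmx.
Proof.
move=> fr Up; rewrite -row_free_unit -kermx_eq0; apply/rowV0P => y /sub_kermxP yG.
have [_ _ xE dec] := fr.
pose v := \sum_a y 0 a *: E a p.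
have vE b : g p v (E b p) = 0.
  have := congr1 (fun A : 'rV[R]_n => A 0 b) yG; rewrite !mxE => H; rewrite -[RHS]H.
  by rewrite metric_suml//; apply: eq_bigr => a _; rewrite metricZl// mxE.
have v0 : v = 0.
  apply: ng => w; rewrite (dec p w Up) metric_sumr// big1// => b _.
  by rewrite metricZr// vE mulr0.
apply/rowP => a; rewrite mxE -[RHS](tzero_act p (x a)) -v0 tsum_act.
under eq_bigr do rewrite tscale_act xE//.
by rewrite (bigD1 a)//= eqxx mulr1 big1 ?addr0// => c /negPf ->; rewrite mulr0.
Qed.

Lemma sharp_frame (w : @preform R M) U E x p : one_form w -> frame_on U E x -> U p ->
  represents g (\sum_a (\sum_b w (E b) p * invmx (gram E p) b a) *: E a p) w.
Proof.
move=> ow fr Up; apply: (represents_frame sg ow fr Up) => c.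
rewrite metric_suml//.
have Gu := gram_unit fr Up.
have -> : w (E c) p = ((\row_b w (E b) p) *m invmx (gram E p) *m gram E p) 0 c.
  by rewrite mulmxKV// mxE.
rewrite mxE; apply: eq_bigr => a _; rewrite metricZl// !mxE; congr (_ * _).
by apply: eq_bigr => b _; rewrite mxE.
Qed.

Lemma represents_unique p (u v : tangent p) (w : @preform R M) :
  represents g u w -> represents g v w -> u = v.
Proof.
move=> ru rv; apply/eqP; rewrite -subr_eq0; apply/eqP; apply: ng => z.
by rewrite metricDl// metricNl// -(field_atE z) -ru -rv subrr.
Qed.

(** The pointwise representing vector is unique, and smooth by Cramer's rule: the inverse Gram
    matrix consists of cofactors times a smooth reciprocal determinant. On the base this yields
    gradients and covariant derivatives as fields. *)
Lemma sharp (w : @preform R M) : one_form w ->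
  exists W : vfield M, forall p, represents g (W p) w.
Proof.
move=> ow.
have ex p : exists u : tangent p, represents g u w.
  have [U [E [x [Up fr]]]] := frame_exists p.
  by eexists; exact: (sharp_frame ow fr Up).
pose W p : tangent p := projT1 (cid (ex p)).
have rW p : represents g (W p) w := projT2 (cid (ex p)).
suff sW f : smooth f -> smooth (fun p => W p f) by exists (VField sW).
move=> sf; apply: smooth_near_eq => p0.
have [U [E [x [Up fr]]]] := frame_exists p0; have [oU _ _ _] := fr.
have sd : smooth (fun p => \det (gram E p)).
  by apply: smooth_det => i j; exact: smooth_gram.
have dU p : U p -> \det (gram E p) != 0.
  by move=> Up'; rewrite -unitfE -unitmxE; exact: (gram_unit fr Up').
have [h sh nh] := smooth_extend oU Up (smooth_overV oU dU (smooth_overS U sd)).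
exists (fun p => \sum_a ((fun p => \sum_b (w (E b) \* (h \* (fun p => cofactor (gram E p) a b))) p)
   \* lie (E a) f) p).
  apply: smooth_sum => a _; apply: smoothM; last exact: smooth_lie.
  apply: smooth_sum => b _; apply: smoothM; first exact: ow.1.
  by apply: smoothM => //; exact: smooth_gram_cofactor.
apply: filterS (filterI (open_nbhs_nbhs (conj oU Up)) nh) => p [Up' hp].
rewrite (represents_unique (rW p) (sharp_frame ow fr Up')) tsum_act.
apply: eq_bigr => a _; rewrite tscale_act /=; congr (_ * _).
apply: eq_bigr => b _; congr (_ * _).
by rewrite /invmx (gram_unit fr Up') !mxE hp.
Qed.

End Sharp.

(** * Gluing of local extensions and reduction to frame fields *)

Section SemiRegularity.
Context {R : realType} {M : manifold R} (g : tensor02 M) (sg : semi_riemannian g).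
Arguments g : clear implicits.
Local Notation n := (mdim M).
Implicit Types (X Y Z T : vfield M) (p : M).

Definition represented_on (U : set M) (w : @preform R M) : Prop :=
  forall p, U p -> exists u : tangent p, represents g u w.

Definition cov_deriv_on (U : set M) Z (w eta : @preform R M) : Prop :=
  forall T p, U p -> constant_signature_near g p -> eta T p = cov_deriv g Z w T p.

Lemma cov_deriv_glue Z (w : @preform R M) :
  (forall p, exists U eta, [/\ open U, U p, one_form eta, represented_on U eta
     & cov_deriv_on U Z w eta]) ->
  cov_deriv_in_Abullet g Z w.
Proof.
move=> loc.
have /choice[F FP] : forall p, exists F : set M * @preform R M, [/\ open F.1, F.1 p, one_form F.2,
    represented_on F.1 F.2 & cov_deriv_on F.1 Z w F.2].
  by move=> p; have [U [eta H]] := loc p; exists (U, eta).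
have agree T p q : (F p).1 q -> (F q).2 T q = (F p).2 T q.
  move=> pq; apply: contrapT => neq.
  have [op _ ofp _ cp] := FP p; have [oq qq ofq _ cq] := FP q.
  pose d p' := (F q).2 T p' - (F p).2 T p'.
  have sd : smooth d by apply: smoothB; [exact: ofq.1|exact: ofp.1].
  have nd : \forall p' \near q, d p' != 0.
    have : nbhs (d q) [set t : R | t != 0].
      apply: open_nbhs_nbhs; split; first exact: open_neq.
      by rewrite /= /d subr_eq0; apply/eqP.
    by move/(smooth_continuous sd).
  have := constant_signature_dense sg (U := interior ([set p' | d p' != 0] `&` ((F p).1 `&` (F q).1))).
  case; first exact: open_interior.
    exists q; apply: filterI nd _.
    by apply: filterI; [exact: open_nbhs_nbhs|exact: open_nbhs_nbhs].
  move=> p' /interior_subset [/= + [Fp Fq]] cs; rewrite /d.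
  by rewrite (cp T p' Fp cs) (cq T p' Fq cs) subrr eqxx.
(* At each point the value of the form chosen at that same point is taken; by [agree] this coincides
   near [p] with the single smooth form [(F p).2]. *)
exists (fun T p => (F p).2 T p); last first.
  by move=> T p cs; have [_ pp _ _ cp] := FP p; exact: cp.
split; last first.
  by move=> p; have [_ pp _ rp _] := FP p; exact: rp.
split=> [T|f A B C sf CAB p]; last first.
  by have [_ _ [_ lin] _ _] := FP p; exact: lin.
apply: smooth_near_eq => p; have [op pp [sm _] _ _] := FP p.
exists ((F p).2 T) => //.
apply: filterS (open_nbhs_nbhs (conj op pp)) => q pq; exact: agree.
Qed.

Lemma cov_derivE Z (w : @preform R M) T p u v : represents g u (lower_deriv g Z T) ->
  represents g v w -> cov_deriv g Z w T p = lie Z (w T) p - g p u v.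
Proof. by move=> ru rv; rewrite /cov_deriv (cocontractionE sg ru rv). Qed.

Section Frame.
Variables (U : set M) (E : 'I_n -> vfield M) (x : 'I_n -> M -> R).
Hypothesis fr : frame_on U E x.

Let oU : open U. Proof. by case: fr. Qed.
Let sx a : smooth (x a). Proof. by case: fr. Qed.

Lemma field_frame Y : exists Y', (forall q, U q -> Y q = Y' q) /\
  Y' = field_comb (enum 'I_n) E (fun b => smooth_lie Y (sx b)).
Proof.
eexists; split; last by reflexivity.
by move=> q Uq /=; rewrite big_enum/=; case: fr => _ _ _ dec; exact: dec.
Qed.

(** The Koszul form is tensorial in [X] but obeys a Leibniz rule in [Y]; the derivatives of the
    components of [Y] give the terms with [inner]. *)
Lemma koszul_frame X Y T p : U p -> koszul g X Y T p =
  \sum_a \sum_b (lie X (x a) p * lie Y (x b) p * koszul g (E a) (E b) T p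
    + lie X (x a) p * lie (E a) (lie Y (x b)) p * inner g (E b) T p).
Proof.
move=> Up; rewrite (one_form_frame (koszul_one_form_l sg Y T) X fr Up).
apply: eq_bigr => a _; have [Y' [YY' Y'E]] := field_frame Y.
have nY : \forall q \near p, Y q = Y' q.
  by apply: filterS (open_nbhs_nbhs (conj oU Up)) => q; exact: YY'.
rewrite (koszul_near sg _ _ nY) Y'E (koszul_comb sg) big_enum/= mulr_sumr.
by apply: eq_bigr => b _; rewrite /lie; ring.
Qed.

Hypothesis repE : forall a b, represented_on U (koszul g (E a) (E b)).

Lemma represents_koszul X Y p (u : 'I_n -> 'I_n -> tangent p) : U p ->
  (forall a b, represents g (u a b) (koszul g (E a) (E b))) ->
  represents g (\sum_a \sum_b (lie X (x a) p * lie Y (x b) p *: u a b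
     + lie X (x a) p * lie (E a) (lie Y (x b)) p *: E b p)) (koszul g X Y).
Proof.
move=> Up ru T; rewrite koszul_frame// metric_suml//; apply: eq_bigr => a _.
rewrite metric_suml//; apply: eq_bigr => b _.
by rewrite metricDl// !metricZl// -ru.
Qed.

Lemma koszul_represented X Y : represented_on U (koszul g X Y).
Proof.
move=> p Up.
have /choice[u uP] : forall ab : 'I_n * 'I_n, exists u : tangent p,
    represents g u (koszul g (E ab.1) (E ab.2)).
  by move=> [a b]; exact: repE.
eexists; apply: (represents_koszul X Y (u := fun a b => u (a, b)) Up) => a b; exact: (uP (a, b)).
Qed.

Hypothesis covE : forall a b c, exists eta, [/\ one_form eta, represented_on U eta &
  cov_deriv_on U (E c) (koszul g (E a) (E b)) eta].

Lemma represented_add w t : represented_on U w -> represented_on U t ->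
  represented_on U (fun X p => w X p + t X p : R).
Proof.
move=> rw rt p Up; have [u ru] := rw p Up; have [v rv] := rt p Up.
by exists (u + v) => T; rewrite metricDl// -ru -rv.
Qed.

Lemma represented_scale h w : represented_on U w ->
  represented_on U (fun X p => h p * w X p : R).
Proof.
move=> rw p Up; have [u ru] := rw p Up.
by exists (h p *: u) => T; rewrite metricZl// -ru.
Qed.

Lemma represented_sum (I : Type) (s : seq I) (w : I -> @preform R M) :
  (forall i, represented_on U (w i)) ->
  represented_on U (fun X p => \sum_(i <- s) w i X p : R).
Proof.
move=> rw p Up.
have /choice[u uP] : forall i, exists u : tangent p, represents g u (w i).
  by move=> i; exact: rw.
exists (\sum_(i <- s) u i) => T; rewrite metric_suml//.
by apply: eq_bigr => i _; exact: uP.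
Qed.

Lemma represented_flat Y : represented_on U (fun T => inner g Y T).
Proof. by move=> p _; exists (Y p) => T. Qed.

Lemma cov_deriv_frame X Y Z : exists eta, [/\ one_form eta, represented_on U eta &
  cov_deriv_on U Z (koszul g X Y) eta].
Proof.
have /choice[e eP] : forall abc : 'I_n * 'I_n * 'I_n, exists eta, [/\ one_form eta, represented_on U eta &
    cov_deriv_on U (E abc.2) (koszul g (E abc.1.1) (E abc.1.2)) eta].
  by move=> [[a b] c]; exact: covE.
pose h a b := lie X (x a) \* lie Y (x b).
pose k a b := lie X (x a) \* lie (E a) (lie Y (x b)).
have sh a b : smooth (h a b) by apply: smoothM; apply: smooth_lie.
have sk a b : smooth (k a b).
  by apply: smoothM; [exact: smooth_lie|exact/smooth_lie/smooth_lie].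
(* Leibniz expansion along [E c] of the two kinds of terms in [koszul_frame]. By metric
   compatibility the covariant derivative of the lowered field [E b] is [koszul g (E c) (E b)],
   hence the last summand. *)
pose term c a b : @preform R M := fun T p =>
  (lie (E c) (h a b) p * koszul g (E a) (E b) T p + h a b p * e (a, b, c) T p) +
  (lie (E c) (k a b) p * inner g (E b) T p + k a b p * koszul g (E c) (E b) T p).
exists (fun T p => \sum_(c <- enum 'I_n) lie Z (x c) p * \sum_(a <- enum 'I_n) \sum_(b <- enum 'I_n) term c a b T p).
split.
- apply: (@one_form_sum R M _ (enum 'I_n) (fun c (T : vfield M) p => lie Z (x c) p * \sum_(a <- enum 'I_n) \sum_(b <- enum 'I_n) term c a b T p)) => c.
  apply: (@one_form_scale R M (lie Z (x c)) (fun (T : vfield M) p => \sum_(a <- enum 'I_n) \sum_(b <- enum 'I_n) term c a b T p)).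
    exact: smooth_lie.
  apply: (@one_form_sum R M _ (enum 'I_n) (fun a (T : vfield M) p => \sum_(b <- enum 'I_n) term c a b T p)) => a.
  apply: one_form_sum => b.
  have [oe _ _] := eP (a, b, c).
  apply: one_form_add; apply: one_form_add; apply: one_form_scale => //.
  + exact: smooth_lie.
  + exact: koszul_one_form.
  + exact: smooth_lie.
  + exact: flat_one_form.
  + exact: koszul_one_form.
- apply: (@represented_sum _ (enum 'I_n) (fun c (T : vfield M) p => lie Z (x c) p * \sum_(a <- enum 'I_n) \sum_(b <- enum 'I_n) term c a b T p)) => c.
  apply: (@represented_scale (lie Z (x c)) (fun (T : vfield M) p => \sum_(a <- enum 'I_n) \sum_(b <- enum 'I_n) term c a b T p)).
  apply: (@represented_sum _ (enum 'I_n) (fun a (T : vfield M) p => \sum_(b <- enum 'I_n) term c a b T p)) => a.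
  apply: represented_sum => b.
  have [_ re _] := eP (a, b, c).
  apply: represented_add; apply: represented_add; apply: represented_scale => //.
  exact: represented_flat.
move=> T p Up cs.
have /choice[u uP] : forall ab : 'I_n * 'I_n, exists u : tangent p,
    represents g u (koszul g (E ab.1) (E ab.2)).
  by move=> [a b]; exact: repE.
have /choice[v vP] : forall c, exists v : tangent p, represents g v (koszul g (E c) T).
  by move=> c; exact: koszul_represented.
have rw := represents_koszul X Y (u := fun a b => u (a, b)) Up (fun a b => uP (a, b)).
have rz : represents g (\sum_c lie Z (x c) p *: v c) (koszul g Z T).
  move=> V; rewrite metric_suml// (one_form_frame (koszul_one_form_l sg T V) Z fr Up).
  by apply: eq_bigr => c _; rewrite metricZl// -vP.
rewrite (cov_derivE rz rw).
have sK a b : smooth (koszul g (E a) (E b) T) by exact: koszul_smooth.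
have sI b : smooth (inner g (E b) T) by exact: inner_smooth.
have sab a b : smooth (fun q => (h a b \* koszul g (E a) (E b) T) q + (k a b \* inner g (E b) T) q).
  by apply: (@smoothD R M (h a b \* koszul g (E a) (E b) T) (k a b \* inner g (E b) T)); apply: smoothM.
have Ew c : lie (E c) (koszul g X Y T) p = \sum_a \sum_b
   (lie (E c) (h a b) p * koszul g (E a) (E b) T p + h a b p * lie (E c) (koszul g (E a) (E b) T) p +
   (lie (E c) (k a b) p * inner g (E b) T p + k a b p * lie (E c) (inner g (E b) T) p)).
  transitivity (lie (E c) (fun q => \sum_a \sum_b ((h a b \* koszul g (E a) (E b) T) q + (k a b \* inner g (E b) T) q)) p).
    apply: lie_near; first exact: koszul_smooth.
      by apply: smooth_sum => a _; apply: smooth_sum => b _; exact: sab.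
    by apply: filterS (open_nbhs_nbhs (conj oU Up)) => q Uq; rewrite koszul_frame.
  rewrite /lie tact_sum; last by move=> a _; apply: smooth_sum => b _; exact: sab.
  apply: eq_bigr => a _; rewrite tact_sum; last by move=> b _; exact: sab.
  apply: eq_bigr => b _.
  rewrite (tactD _ (smoothM (sh a b) (sK a b)) (smoothM (sk a b) (sI b))).
  rewrite (tactM _ (sh a b) (sK a b)) (tactM _ (sk a b) (sI b)); ring.
rewrite (one_form_frame (one_form_d (koszul_smooth sg X Y T)) Z fr Up).
rewrite metric_suml// big_enum/= -sumrB; apply: eq_bigr => c _.
rewrite metricZl// -mulrBr; congr (_ * _).
rewrite Ew metric_sumr// big_enum/= -sumrB; apply: eq_bigr => a _.
rewrite metric_sumr// big_enum/= -sumrB; apply: eq_bigr => b _.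
rewrite metricDr// !metricZr// /term.
have [_ _ /(_ T p Up cs) ->] := eP (a, b, c).
rewrite (cov_derivE (vP c) (uP (a, b))) /=.
rewrite -(vP c (E b)) -(koszul_compat sg (E c) (E b) T p) /h /k /=; ring.
Qed.

End Frame.

(** Allows the conditions to be checked on one convenient frame around each point, here a frame that
    splits along the product. *)
Lemma semi_regular_local :
  (forall p, exists U E x, [/\ frame_on U E x, U p,
     forall a b, represented_on U (koszul g (E a) (E b)) &
     forall a b c, exists eta, [/\ one_form eta, represented_on U eta &
       cov_deriv_on U (E c) (koszul g (E a) (E b)) eta]]) ->
  semi_regular g.
Proof.
move=> loc; split=> [X Y|X Y Z].
  split; first exact: koszul_one_form.
  move=> p; have [U [E [x [fr Up rep _]]]] := loc p.
  exact: (koszul_represented fr rep X Y Up).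
apply: cov_deriv_glue => p; have [U [E [x [fr Up rep cov]]]] := loc p.
have [eta [oeta reta ceta]] := cov_deriv_frame fr rep cov X Y Z.
by exists U, eta; split=> //; case: fr.
Qed.

End SemiRegularity.

Lemma inner_pullback_smooth (R : realType) (M N : manifold R) (phi : M -> N)
    (sphi : smooth_map phi) (g : tensor02 N) (X Y : vfield M) : semi_riemannian g ->
  smooth (fun p => g (phi p) (differential sphi (X p)) (differential sphi (Y p))).
Proof.
move=> sg; apply: smooth_near_eq => p; have [U [E [x [Up fr]]]] := frame_exists (phi p).
have [oU sx _ dec] := fr.
exists (fun q => \sum_a (fun q => \sum_b (lie X (x a \o phi) \*
    (lie Y (x b \o phi) \* (inner g (E a) (E b) \o phi))) q) q).
  apply: smooth_sum => a _; apply: smooth_sum => b _.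
  apply: smoothM; first by apply/smooth_lie/sphi.
  by apply: smoothM; [apply/smooth_lie/sphi|apply/sphi/inner_smooth].
apply: filterS (smooth_map_near sphi oU Up) => q Uq.
rewrite [X in g _ X _](dec _ _ Uq) [X in g _ _ X](dec _ _ Uq) metric_suml//.
apply: eq_bigr => a _; rewrite metric_sumr//; apply: eq_bigr => b _.
by rewrite metricZl// metricZr// !differential_comp//.
Qed.

(** * Products and warped metrics *)

Section Product.
Context {R : realType} {B : manifold R} {l : nat} {F : 'I_l -> manifold R}.
Local Notation M := (product_manifold B F).
Local Notation pB := (@projB R B l F).
Local Notation pF := (@projF R B l F).
Local Notation spB := (@projB_smooth R B l F).
Local Notation spF j := (@projF_smooth R B l F j).
Local Notation dB := (differential spB).
Local Notation dF j := (differential (spF j)).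
Local Notation iB a := (@idxB R B l F a : 'I_(mdim M)).
Local Notation iF j a := (@idxF R B l F j a : 'I_(mdim M)).

Lemma idxB_idxF a j b : (iB a == iF j b) = false.
Proof. by apply/eqP => /eqP; rewrite eq_lrshift. Qed.

Lemma idxF_eq i (a : 'I_(mdim (F i))) j (b : 'I_(mdim (F j))) : iF i a = iF j b ->
  Tagged (fun j => 'I_(mdim (F j))) a = Tagged (fun j => 'I_(mdim (F j))) b.
Proof. by move=> /rshift_inj /tagnat.rank_inj. Qed.

Lemma idxF_neq i a j b : i != j -> (iF i a == iF j b) = false.
Proof. by move=> ij; apply/eqP => /idxF_eq /(congr1 tag)/= /eqP; rewrite (negPf ij). Qed.

Lemma big_idx (T : Type) (idx : T) (op : Monoid.com_law idx) (G : 'I_(mdim M) -> T) :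
  \big[op/idx]_A G A =
    op (\big[op/idx]_a G (iB a)) (\big[op/idx]_j \big[op/idx]_a G (iF j a)).
Proof.
rewrite [LHS]big_split_ord/=; congr (op _ _).
rewrite (reindex _ tagnat.rank_bij_on)/= sig_big_dep/=.
by apply: eq_bigr => -[j a] _.
Qed.

(** The frame of a product chart: each field projects to a coordinate field of one factor and to 0
    in the others. The last clause identifies the tangent space of the product with the product of
    the tangent spaces. *)
Lemma product_frame (p : M) : exists U E x (XB : 'I_(mdim M) -> vfield B)
    (XF : forall j, 'I_(mdim M) -> vfield (F j)),
  [/\ frame_on U E x, U p, forall A, related_on spB U (E A) (XB A),
      forall j A, related_on (spF j) U (E A) (XF j A) &
      forall q, U q ->
        (forall v : tangent q, dB v = 0 -> (forall j, dF j v = 0) -> v = 0) /\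
        (forall (uB : tangent (pB q)) (uF : forall j, tangent (pF j q)),
           exists u : tangent q, dB u = uB /\ forall j, dF j u = uF j)].
Proof.
have [c ac cp] := m_cover (pB p).
have d_ex j := cid2 (m_cover (pF j p)).
pose d j := s2val (d_ex j).
have ad j : matlas (d j) := s2valP (d_ex j).
have dp j : cdom (d j) (pF j p) := s2valP' (d_ex j).
have aC : matlas (prod_chart c d : chart R M (mdim M)) by exists c, d.
have [UB [EB [xB [UBp _ frB xBE]]]] := chart_frame ac cp.
have F_ex j : exists UEx : set (F j) * ('I_(mdim (F j)) -> vfield (F j)) * ('I_(mdim (F j)) -> F j -> R),
    [/\ UEx.1.1 (pF j p), frame_on UEx.1.1 UEx.1.2 UEx.2 &
     forall a q, UEx.1.1 q -> UEx.2 a q = cfwd (d j) q 0 a].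
  by have [U [E [x [Up _ fr xE]]]] := chart_frame (ad j) (dp j); exists (U, E, x).
pose UF j := (projT1 (cid (F_ex j))).1.1.
pose EF j := (projT1 (cid (F_ex j))).1.2.
pose xF j := (projT1 (cid (F_ex j))).2.
have UFp j : UF j (pF j p) by case: (projT2 (cid (F_ex j))).
have frF j : frame_on (UF j) (EF j) (xF j) by case: (projT2 (cid (F_ex j))).
have xFE j a q : UF j q -> xF j a q = cfwd (d j) q 0 a.
  by case: (projT2 (cid (F_ex j))) => _ _; exact.
have [U0 [E [x [U0p _ fr xE]]]] := @chart_frame R M (prod_chart c d) p aC (conj cp dp).
have [oU0 sx xE0 dec] := fr; have [oUB sxB _ decB] := frB.
pose U : set M := [set q | U0 q /\ UB (pB q) /\ forall j, UF j (pF j q)].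
have oU : open U.
  rewrite openE => q [q0 [qB qF]].
  have nF : \forall q' \near q, forall j, UF j (pF j q').
    apply: (@filter_forall _ _ (fun j q' => UF j (pF j q')) (nbhs q) (nbhs_filter q)) => j.
    apply: (smooth_map_near (spF j)) => //.
    by case: (frF j).
  exact: filterI (open_nbhs_nbhs (conj oU0 q0)) (filterI (smooth_map_near spB oUB qB) nF).
have frU : frame_on U E x.
  by split=> // [a b q [Uq _]|q v [Uq _]]; [exact: xE0|exact: dec].
have xBx a q : U q -> x (iB a) q = xB a (pB q).
  move=> [U0q [UBq UFq]]; rewrite xE// xBE//.
  have /rowP/(_ a) := unblockB (cfwd c (pB q)) (fun j => cfwd (d j) (pF j q)).
  by rewrite mxE.
have xFx j a q : U q -> x (iF j a) q = xF j a (pF j q).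
  move=> [U0q [UBq UFq]]; rewrite xE// xFE//.
  have /rowP/(_ a) := unblockF (cfwd c (pB q)) (fun j => cfwd (d j) (pF j q)) j.
  by rewrite mxE.
have vB q (v : tangent q) a : U q -> (dB v) (xB a) = v (x (iB a)).
  move=> Uq; rewrite differential_comp//; apply: tact_near => //.
    exact/projB_smooth/sxB.
  by apply: filterS (open_nbhs_nbhs (conj oU Uq)) => q' /xBx ->.
have vF q (v : tangent q) j a : U q -> (dF j v) (xF j a) = v (x (iF j a)).
  move=> Uq; have [_ sxF _ _] := frF j; rewrite differential_comp//; apply: tact_near => //.
    exact/projF_smooth/sxF.
  by apply: filterS (open_nbhs_nbhs (conj oU Uq)) => q' /xFx ->.
(* Constant coefficients 0 and 1 select the coordinate field of the base when [A] is a base index,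
   and the zero field otherwise. *)
pose XB A := field_comb (enum 'I_(mdim B)) EB (fun a => smooth_cst ((A == iB a)%:R : R)).
pose XF j A := field_comb (enum 'I_(mdim (F j))) (EF j) (fun a => smooth_cst ((A == iF j a)%:R : R)).
have relB A : related_on spB U (E A) (XB A).
  move=> q Uq; have [U0q [UBq UFq]] := Uq; rewrite (decB _ (dB (E A q)) UBq) [RHS]/= big_enum.
  by apply: eq_bigr => a _; rewrite vB// xE0.
have relF j A : related_on (spF j) U (E A) (XF j A).
  move=> q Uq; have [U0q [UBq UFq]] := Uq; have [_ _ _ decF] := frF j.
  rewrite (decF _ (dF j (E A q)) (UFq j)) [RHS]/= big_enum.
  by apply: eq_bigr => a _; rewrite vF// xE0.
exists U, E, x, XB, XF; split=> // q Uq; have [U0q [UBq UFq]] := Uq; split=> [v vB0 vF0|uB uF].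
  rewrite (dec q v U0q) big1// => A _.
  have [[a ->]|[j [a ->]]] := idxP A.
    by rewrite -vB// vB0 tzero_act scale0r.
  by rewrite -vF// vF0 tzero_act scale0r.
pose u : tangent q := \sum_a uB (xB a) *: E (iB a) q + \sum_j \sum_a uF j (xF j a) *: E (iF j a) q.
have uxB b : u (x (iB b)) = uB (xB b).
  rewrite /u tadd_act !tsum_act.
  under eq_bigr do rewrite tscale_act xE0// (inj_eq (@idxB_inj R B l F)).
  rewrite (bigD1 b)//= eqxx mulr1 big1 ?addr0 => [|a /negPf ->]; last by rewrite mulr0.
  rewrite big1 ?addr0// => j _; rewrite tsum_act big1// => a _.
  by rewrite tscale_act xE0// eq_sym idxB_idxF mulr0.
have uxF j b : u (x (iF j b)) = uF j (xF j b).
  rewrite /u tadd_act !tsum_act big1 => [|a _]; last first.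
    by rewrite tscale_act xE0// idxB_idxF mulr0.
  rewrite add0r (bigD1 j)//= [X in _ + X]big1 => [|i ij]; last first.
    by rewrite tsum_act big1// => a _; rewrite tscale_act xE0// idxF_neq// mulr0.
  rewrite addr0 tsum_act.
  under eq_bigr do rewrite tscale_act xE0// (inj_eq (@idxF_inj R B l F j)).
  by rewrite (bigD1 b)//= eqxx mulr1 big1 ?addr0 => // a /negPf ->; rewrite mulr0.
exists u; split=> [|j].
  rewrite (decB _ (dB u) UBq) [RHS](decB _ uB UBq).
  by apply: eq_bigr => a _; rewrite vB// uxB.
have [_ _ _ decF] := frF j.
rewrite (decF _ (dF j u) (UFq j)) [RHS](decF _ (uF j) (UFq j)).
by apply: eq_bigr => a _; rewrite vF// uxF.
Qed.

Lemma tangent_separated (q : M) (v : tangent q) : dB v = 0 -> (forall j, dF j v = 0) -> v = 0.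
Proof.
by have [U [E [x [XB [XF [_ Uq _ _ /(_ q Uq)[sep _]]]]]]] := product_frame q; exact: sep.
Qed.

Lemma tangent_lift (q : M) (uB : tangent (pB q)) (uF : forall j, tangent (pF j q)) :
  exists u : tangent q, dB u = uB /\ forall j, dF j u = uF j.
Proof.
by have [U [E [x [XB [XF [_ Uq _ _ /(_ q Uq)[_ lift]]]]]]] := product_frame q; exact: lift.
Qed.

Section Warped.
Variables (gB : tensor02 B) (gF : forall j, tensor02 (F j)) (f : 'I_l -> B -> R).
Arguments gB : clear implicits.
Arguments gF : clear implicits.
Hypotheses (sgB : semi_riemannian gB) (sgF : forall j, semi_riemannian (gF j)).
Hypothesis sf : forall j, smooth (f j).
Local Notation g := (warped_metric gB f gF).

Lemma warpedE (p : M) (u v : tangent p) : g p u v = gB (pB p) (dB u) (dB v) +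
  \sum_j f j (pB p) ^+ 2 * gF j (pF j p) (dF j u) (dF j v).
Proof. by []. Qed.

Lemma warped_semi_riemannian : semi_riemannian g.
Proof.
split=> [p u v|p v a u w|X Y].
- rewrite !warpedE metricC//; congr (_ + _).
  by apply: eq_bigr => j _; rewrite metricC.
- rewrite !warpedE differential_lin metric_linl//.
  rewrite [X in _ + X = _](_ : _ = a * (\sum_j f j (pB p) ^+ 2 * gF j (pF j p) (dF j u) (dF j v)) +
      \sum_j f j (pB p) ^+ 2 * gF j (pF j p) (dF j w) (dF j v)).
    by rewrite /GRing.scale/=; ring.
  rewrite mulr_sumr -big_split/=; apply: eq_bigr => j _.
  by rewrite differential_lin metric_linl//; ring.
- apply: smoothD; first exact: inner_pullback_smooth.
  apply: (@smooth_sum R M _ _ _ (fun j p => f j (pB p) ^+ 2 * gF j (pF j p) (dF j (X p)) (dF j (Y p)))) => j _.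
  apply: (@smoothM R M (fun p => f j (pB p) ^+ 2)); last exact: inner_pullback_smooth.
  have -> : (fun p : M => f j (pB p) ^+ 2) = (f j \o pB) \* (f j \o pB).
    by apply/funext => p; rewrite expr2.
  by apply: smoothM; exact/projB_smooth/sf.
Qed.

Definition splits_on (U : set M) (X : vfield M) (XB : vfield B) (XF : forall j, vfield (F j)) : Prop :=
  related_on spB U X XB /\ forall j, related_on (spF j) U X (XF j).

Lemma splits_bracket U X XB XF Y YB YF : open U -> splits_on U X XB XF -> splits_on U Y YB YF ->
  splits_on U (bracket X Y) (bracket XB YB) (fun j => bracket (XF j) (YF j)).
Proof.
by move=> oU [XB1 XF1] [YB1 YF1]; split=> [|j]; exact: related_bracket.
Qed.

Section Split.
Variables (U : set M) (oU : open U).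

Lemma warped_inner X XB XF Y YB YF p : splits_on U X XB XF -> splits_on U Y YB YF -> U p ->
  inner g X Y p = inner gB XB YB (pB p) +
    \sum_j f j (pB p) ^+ 2 * inner (gF j) (XF j) (YF j) (pF j p).
Proof.
move=> [rXB rXF] [rYB rYF] Up; rewrite /inner warpedE rXB// rYB//; congr (_ + _).
by apply: eq_bigr => j _; rewrite rXF// rYF.
Qed.

Lemma lie_warped_inner Z ZB ZF X XB XF Y YB YF p : splits_on U Z ZB ZF ->
  splits_on U X XB XF -> splits_on U Y YB YF -> U p ->
  lie Z (inner g X Y) p = lie ZB (inner gB XB YB) (pB p) +
    \sum_j (2 * f j (pB p) * lie ZB (f j) (pB p) * inner (gF j) (XF j) (YF j) (pF j p) +
       f j (pB p) ^+ 2 * lie (ZF j) (inner (gF j) (XF j) (YF j)) (pF j p)).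
Proof.
move=> sZ sX sY Up.
have sfp j : smooth (f j \o pB) by exact/projB_smooth/sf.
have siF j : smooth (inner (gF j) (XF j) (YF j) \o pF j) by exact/projF_smooth/inner_smooth.
have siB : smooth (inner gB XB YB \o pB) by exact/projB_smooth/inner_smooth.
pose h j := ((f j \o pB) \* (f j \o pB)) \* (inner (gF j) (XF j) (YF j) \o pF j).
have sh j : smooth (h j) by apply: smoothM => //; exact: smoothM.
have sS : smooth (fun q => \sum_j h j q) by apply: smooth_sum.
transitivity (lie Z ((inner gB XB YB \o pB) \+ (fun q => \sum_j h j q)) p).
  apply: lie_near; [exact/inner_smooth/warped_semi_riemannian|exact: smoothD|].
  apply: filterS (open_nbhs_nbhs (conj oU Up)) => q Uq.
  by rewrite (warped_inner sX sY Uq).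
rewrite lieD//=; congr (_ + _).
  by rewrite (related_lie sZ.1 _ Up)//; exact: inner_smooth.
rewrite /lie tact_sum//; apply: eq_bigr => j _.
rewrite (tactM _ (smoothM (sfp j) (sfp j)) (siF j)) (tactM _ (sfp j) (sfp j)) /=.
have := related_lie sZ.1 (sf j) Up; rewrite /lie => ->.
have := related_lie (sZ.2 j) (inner_smooth (sgF j) (XF j) (YF j)) Up; rewrite /lie => ->.
by rewrite expr2; ring.
Qed.

(** Differentiating [f j ^+ 2] gives [2 * f j] times the derivative of [f j], and the 2 cancels the
    one half of the Koszul formula; the brackets of split fields split again and bring no derivative
    of [f j]. *)
Lemma koszul_warped X XB XF Y YB YF Z ZB ZF p : splits_on U X XB XF ->
  splits_on U Y YB YF -> splits_on U Z ZB ZF -> U p ->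
  koszul g X Y Z p = koszul gB XB YB ZB (pB p) +
    \sum_j (f j (pB p) ^+ 2 * koszul (gF j) (XF j) (YF j) (ZF j) (pF j p) +
      f j (pB p) * (lie XB (f j) (pB p) * inner (gF j) (YF j) (ZF j) (pF j p)
        + lie YB (f j) (pB p) * inner (gF j) (XF j) (ZF j) (pF j p)
        - lie ZB (f j) (pB p) * inner (gF j) (XF j) (YF j) (pF j p))).
Proof.
move=> sX sY sZ Up; rewrite !koszulE.
rewrite (lie_warped_inner sX sY sZ Up) (lie_warped_inner sY sZ sX Up) (lie_warped_inner sZ sX sY Up).
have := warped_inner sX (splits_bracket oU sY sZ) Up; rewrite {1}/inner => ->.
have := warped_inner sY (splits_bracket oU sZ sX) Up; rewrite {1}/inner => ->.
have := warped_inner sZ (splits_bracket oU sX sY) Up; rewrite {1}/inner => ->.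
set SX := \sum_j _; set SY := \sum_j _; set SZ := \sum_j _.
set TX := \sum_j _; set TY := \sum_j _; set TZ := \sum_j _.
transitivity (koszul gB XB YB ZB (pB p) + 2^-1 * (SX + SY - SZ - TX + TY + TZ)).
  by rewrite koszulE /inner; ring.
congr (_ + _); rewrite /SX /SY /SZ /TX /TY /TZ -big_split /= -!sumrB -!big_split /= mulr_sumr.
apply: eq_bigr => j _; rewrite koszulE.
by rewrite (inner_sym (sgF j) (ZF j) (XF j)) /inner; field.
Qed.

End Split.
End Warped.
End Product.

(** * The index of the warped metric *)

Section WarpedSignature.
Context {R : realType} {B : manifold R} {l : nat} {F : 'I_l -> manifold R}.
Local Notation M := (product_manifold B F).
Local Notation pB := (@projB R B l F).
Local Notation pF := (@projF R B l F).
Local Notation spB := (@projB_smooth R B l F).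
Local Notation spF j := (@projF_smooth R B l F j).
Local Notation dB := (differential spB).
Local Notation dF j := (differential (spF j)).
Local Notation iB a := (@idxB R B l F a : 'I_(mdim M)).
Local Notation iF j a := (@idxF R B l F j a : 'I_(mdim M)).
Variables (gB : tensor02 B) (gF : forall j, tensor02 (F j)) (f : 'I_l -> B -> R).
Arguments gB : clear implicits.
Arguments gF : clear implicits.
Hypotheses (sgB : semi_riemannian gB) (sgF : forall j, semi_riemannian (gF j)).
Hypothesis sf : forall j, smooth (f j).
Local Notation g := (warped_metric gB f gF).
Let sgW : semi_riemannian g := warped_semi_riemannian sgB sgF sf.

Lemma lift_family (q : M) (eB : 'I_(mdim B) -> tangent (pB q))
    (eF : forall j, 'I_(mdim (F j)) -> tangent (pF j q)) :
  exists e : 'I_(mdim M) -> tangent q,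
   [/\ forall a, dB (e (iB a)) = eB a, forall a j, dF j (e (iB a)) = 0,
       forall j a, dB (e (iF j a)) = 0, forall j a, dF j (e (iF j a)) = eF j a &
       forall i j a, j != i -> dF i (e (iF j a)) = 0].
Proof.
have /choice[hB hBP] : forall a, exists u : tangent q, dB u = eB a /\ forall j, dF j u = 0.
  by move=> a; exact: (tangent_lift (eB a) (fun j => 0)).
have /choice[hF hFP] : forall s : {j & 'I_(mdim (F j))}, exists u : tangent q, dB u = 0 /\
    forall j, dF j u = eqtype.dfwith (fun j => 0 : tangent (pF j q)) (eF (tag s) (tagged s)) j.
  by move=> s; exact: tangent_lift.
pose e (A : 'I_(mdim M)) : tangent q :=
  match fintype.split (A : 'I_(prod_dim B F)) with inl a => hB a | inr k => hF (tagnat.sig k) end.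
have eiB a : e (iB a) = hB a.
  rewrite /e; have := unsplitK (inl a : 'I_(mdim B) + 'I_(\sum_j mdim (F j))).
  by rewrite /= => ->.
have eiF j a : e (iF j a) = hF (Tagged (fun j => 'I_(mdim (F j))) a).
  rewrite /e; have := unsplitK (inr (tagnat.Rank j a) : 'I_(mdim B) + 'I_(\sum_j mdim (F j))).
  by rewrite /= => ->; rewrite tagnat.rankK.
exists e; split=> [a|a j|j a|j a|i j a ji]; rewrite ?eiB ?eiF.
- by case: (hBP a).
- by case: (hBP a).
- by case: (hFP (Tagged (fun j => 'I_(mdim (F j))) a)).
- by case: (hFP (Tagged (fun j => 'I_(mdim (F j))) a)) => _ ->; rewrite dfwith_in.
- by case: (hFP (Tagged (fun j => 'I_(mdim (F j))) a)) => _ ->; rewrite dfwith_out.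
Qed.

Section Basis.
Variables (q : M) (eB : 'I_(mdim B) -> tangent (pB q))
  (eF : forall j, 'I_(mdim (F j)) -> tangent (pF j q)) (e : 'I_(mdim M) -> tangent q).
Arguments eF : clear implicits.
Hypotheses (eBB : forall a, dB (e (iB a)) = eB a) (eBF : forall a j, dF j (e (iB a)) = 0)
  (eFB : forall j a, dB (e (iF j a)) = 0) (eFF : forall j a, dF j (e (iF j a)) = eF j a)
  (eFF0 : forall i j a, j != i -> dF i (e (iF j a)) = 0).

Lemma lift_family_dB (c : 'I_(mdim M) -> R) : dB (\sum_A c A *: e A) = \sum_a c (iB a) *: eB a.
Proof.
rewrite big_idx/= (_ : dB (_ + _) = dB (\sum_a c (iB a) *: e (iB a)) + dB (\sum_j \sum_a c (iF j a) *: e (iF j a))); last first.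
  by have := differential_lin spB 1 (\sum_a c (iB a) *: e (iB a)) (\sum_j \sum_a c (iF j a) *: e (iF j a)); rewrite !scale1r.
rewrite !differential_sum [X in _ + X]big1 => [|j _]; last first.
  by rewrite differential_sum big1// => a _; rewrite differentialZ eFB scaler0.
by rewrite addr0; apply: eq_bigr => a _; rewrite differentialZ eBB.
Qed.

Lemma lift_family_dF (c : 'I_(mdim M) -> R) j : dF j (\sum_A c A *: e A) = \sum_a c (iF j a) *: eF j a.
Proof.
rewrite big_idx/= (_ : dF j (_ + _) = dF j (\sum_a c (iB a) *: e (iB a)) + dF j (\sum_i \sum_a c (iF i a) *: e (iF i a))); last first.
  by have := differential_lin (spF j) 1 (\sum_a c (iB a) *: e (iB a)) (\sum_i \sum_a c (iF i a) *: e (iF i a)); rewrite !scale1r.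
rewrite !differential_sum big1 => [|a _]; last by rewrite differentialZ eBF scaler0.
rewrite add0r (bigD1 j)//= [X in _ + X]big1 => [|i ij]; last first.
  by rewrite differential_sum big1// => a _; rewrite differentialZ eFF0// scaler0.
by rewrite addr0 differential_sum; apply: eq_bigr => a _; rewrite differentialZ eFF.
Qed.

Lemma lift_family_tbasis : tbasis eB -> (forall j, tbasis (eF j)) -> tbasis e.
Proof.
move=> bB bF v.
have [cB [vB uB]] := bB (dB v).
have cF_ex j := cid (bF j (dF j v)).
pose c (A : 'I_(mdim M)) : R :=
  match fintype.split (A : 'I_(prod_dim B F)) with inl a => cB a
  | inr k => projT1 (cF_ex (tagnat.sig1 k)) (tagnat.sig2 k) end.
have ciB a : c (iB a) = cB a.
  rewrite /c; have := unsplitK (inl a : 'I_(mdim B) + 'I_(\sum_j mdim (F j))).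
  by rewrite /= => ->.
pose h (s : {j & 'I_(mdim (F j))}) := projT1 (cF_ex (tag s)) (tagged s).
have ciF j a : c (iF j a) = projT1 (cF_ex j) a.
  rewrite /c; have := unsplitK (inr (tagnat.Rank j a) : 'I_(mdim B) + 'I_(\sum_j mdim (F j))).
  rewrite /= => ->; rewrite -[LHS]/(h (tagnat.sig (tagnat.Rank j a))).
  by rewrite tagnat.rankK.
exists [ffun A => c A]; split.
  apply/eqP; rewrite -subr_eq0; apply/eqP; apply: tangent_separated => [|j].
    rewrite -[v - _]addrC -scaleN1r differential_lin lift_family_dB scaleN1r vB.
    rewrite -sumrN -big_split big1//= => a _; rewrite ffunE ciB addNr//.
  rewrite -[v - _]addrC -scaleN1r differential_lin lift_family_dF scaleN1r.
  have [vF _] := projT2 (cF_ex j); rewrite [X in _ + X = _]vF.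
  by rewrite -sumrN -big_split big1//= => a _; rewrite ffunE ciF addNr.
move=> b vb; apply/ffunP => A; rewrite ffunE.
have [[a ->]|[j [a ->]]] := idxP A.
  rewrite ciB (uB [ffun a => b (iB a)]) ?ffunE// vb lift_family_dB.
  by apply: eq_bigr => a' _; rewrite ffunE.
rewrite ciF; have [_ uF] := projT2 (cF_ex j).
rewrite (uF [ffun a => b (iF j a)]) ?ffunE// vb lift_family_dF.
by apply: eq_bigr => a' _; rewrite ffunE.
Qed.

Lemma warped_iB a v : g q (e (iB a)) v = gB (pB q) (eB a) (dB v).
Proof. by rewrite warpedE eBB big1 ?addr0// => j _; rewrite eBF metric0l// mulr0. Qed.

Lemma warped_iF j a v : g q (e (iF j a)) v = f j (pB q) ^+ 2 * gF j (pF j q) (eF j a) (dF j v).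
Proof.
rewrite warpedE eFB metric0l// add0r (bigD1 j)//= eFF big1 ?addr0// => i ij.
by rewrite eFF0 1?eq_sym// metric0l// mulr0.
Qed.

Lemma lift_family_orthogonal : orthogonal_basis gB eB -> (forall j, orthogonal_basis (gF j) (eF j)) ->
  orthogonal_basis g e.
Proof.
move=> oB oF; split; first by apply: lift_family_tbasis; [exact: oB.1|move=> j; exact: (oF j).1].
move=> A A'; have [[a ->]|[j [a ->]]] := idxP A; have [[a' ->]|[j' [a' ->]]] := idxP A'.
- by rewrite warped_iB eBB => aa; apply: oB.2; apply: contra_neq aa => ->.
- by rewrite warped_iB eFB metric0r.
- by rewrite warped_iF eBF metric0r// mulr0.
- rewrite warped_iF; have [jj|jj] := eqVneq j' j; last by rewrite eFF0// metric0r// mulr0.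
  move: a'; rewrite jj => a' aa; rewrite eFF (oF j).2 ?mulr0//.
  by apply: contra_neq aa => ->.
Qed.

Lemma lift_family_index (sigma : R) : index_of g sigma e =
  (index_of gB sigma eB + \sum_j (if f j (pB q) == 0%R then 0 else index_of (gF j) sigma (eF j)))%N.
Proof.
rewrite /index_of -!sum1_card !(big_mkcond (fun i => i \in _))/= big_idx/=; congr (_ + _)%N.
  by apply: eq_bigr => a _; rewrite !inE warped_iB eBB.
apply: eq_bigr => j _; case: eqP => [f0|/eqP f0].
  by rewrite big1// => a _; rewrite !inE warped_iF f0 expr0n mul0r mulr0 ltxx.
rewrite -sum1_card [RHS]big_mkcond/=.
apply: eq_bigr => a _; rewrite !inE warped_iF eFF mulrCA pmulr_rlt0//.
by rewrite lt_def sqr_ge0 sqrf_eq0 f0.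
Qed.

End Basis.

Lemma index_at_warped (sigma : R) (q : M) : index_at sgW sigma q =
  (index_at sgB sigma (pB q) +
   \sum_j (if f j (pB q) == 0%R then 0 else index_at (sgF j) sigma (pF j q)))%N.
Proof.
have [eB oB] := orthogonal_basis_exists sgB (pB q).
have eF_ex j := cid (orthogonal_basis_exists (sgF j) (pF j q)).
pose eF j := projT1 (eF_ex j); have oF j : orthogonal_basis (gF j) (eF j) := projT2 (eF_ex j).
have [e [eBB eBF eFB eFF eFF0]] := lift_family eB eF.
have oe := lift_family_orthogonal eBB eBF eFB eFF eFF0 oB oF.
rewrite (index_atE sgW _ oe) (lift_family_index eBB eBF eFB eFF eFF0) (index_atE sgB _ oB).
congr (_ + _)%N; apply: eq_bigr => j _; case: ifP => // _.
by rewrite (index_atE (sgF j) _ (oF j)).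
Qed.

(** Along the slice [iota] that moves only the [j]-th fibre point, every other summand of
    [index_at_warped] is constant. *)
Lemma constant_signature_fiber (p : M) j : f j (pB p) != 0 -> constant_signature_near g p ->
  constant_signature_near (gF j) (pF j p).
Proof.
move=> f0 /(constant_signature_nearP sgW) np; apply/(constant_signature_nearP (sgF j)).
pose iota (y : F j) : M := (pB p, eqtype.dfwith (fun i => pF i p) y).
have iota_cont : {for pF j p, continuous iota}.
  apply: pair_continuous_at; first exact: cst_continuous.
  apply: prod_topology_continuous_at => i.
  have [ji|ji] := eqVneq j i.
    move: ji => <-; apply: (@eq_continuous_at _ _ id) => [y|]; last exact: cvg_id.
    by rewrite dfwith_in.
  apply: (@eq_continuous_at _ _ (fun=> pF i p)) => [y|]; last exact: cst_continuous.
  by rewrite dfwith_out.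
have iotap : iota (pF j p) = p.
  rewrite /iota [RHS]surjective_pairing; congr pair.
  by apply: functional_extensionality_dep => i; case: eqtype.dfwithP.
have ny : \forall y \near pF j p, index_at sgW 1 (iota y) = index_at sgW 1 p /\
    index_at sgW (-1) (iota y) = index_at sgW (-1) p.
  by apply: (iota_cont [set q | index_at sgW 1 q = index_at sgW 1 p /\
    index_at sgW (-1) q = index_at sgW (-1) p]); rewrite iotap.
have key sigma y : index_at sgW sigma (iota y) = index_at sgW sigma p ->
    index_at (sgF j) sigma y = index_at (sgF j) sigma (pF j p).
  rewrite !index_at_warped => /addnI; rewrite (bigD1 j)//= [in RHS](bigD1 j)//= (negPf f0).
  rewrite [X in (_ + X)%N = _ -> _](_ : _ =
    \sum_(i < l | i != j) (if f i (pB p) == 0%R then 0 else index_at (sgF i) sigma (pF i p))%N); last first.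
    apply: eq_bigr => i ij; rewrite /projF/= dfwith_out// eq_sym//.
  by move/addIn; rewrite /projF/= dfwith_in.
by apply: filterS ny => y [y1 y2]; split; exact: key.
Qed.

(** Only the base point moves. A nearby [b] with [f j b] nonzero adds the index of [gF j], and no
    other summand can drop to compensate: the base index is lower semicontinuous, nonzero [f i] stay
    nonzero, and the fibre points are fixed. Applied to both signs, this forces [gF j] to vanish at
    the point unless [f j] vanishes near it. *)
Lemma warping_zero (p : M) j : f j (pB p) = 0 -> constant_signature_near g p ->
  (forall v : tangent (pB p), v (f j) = 0) \/ (forall u v : tangent (pF j p), gF j (pF j p) u v = 0).
Proof.
move=> f0 /(constant_signature_nearP sgW) np.
pose iota (b : B) : M := (b, fun i => pF i p).
have iota_cont : {for pB p, continuous iota}.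
  by apply: pair_continuous_at; [exact: cvg_id|exact: cst_continuous].
have iotap : iota (pB p) = p by rewrite [RHS]surjective_pairing.
have nb : \forall b \near pB p, index_at sgW 1 (iota b) = index_at sgW 1 p /\
    index_at sgW (-1) (iota b) = index_at sgW (-1) p.
  by apply: (iota_cont [set q | index_at sgW 1 q = index_at sgW 1 p /\
    index_at sgW (-1) q = index_at sgW (-1) p]); rewrite iotap.
have nf : \forall b \near pB p, forall i, f i (pB p) != 0 -> f i b != 0.
  apply: (@filter_forall _ _ (fun i b => f i (pB p) != 0 -> f i b != 0) (nbhs (pB p)) (nbhs_filter (pB p))) => i.
  have [fi|fi] := boolP (f i (pB p) == 0); first by apply: nearW => b.
  have nf0 : nbhs (f i (pB p)) [set t : R | t != 0].
    by apply: open_nbhs_nbhs; split; first exact: open_neq.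
  have nfi : \forall b \near pB p, f i b != 0 := smooth_continuous (sf i) nf0.
  by apply: filterS nfi => b.
have key sigma b : (index_at sgB sigma (pB p) <= index_at sgB sigma b)%N ->
    (forall i, f i (pB p) != 0 -> f i b != 0) ->
    index_at sgW sigma (iota b) = index_at sgW sigma p -> f j b != 0 ->
    index_at (sgF j) sigma (pF j p) = 0%N.
  move=> leB fb; rewrite !index_at_warped => E fjb.
  have leS : (index_at (sgF j) sigma (pF j p) + \sum_i (if f i (pB p) == 0%R then 0 else index_at (sgF i) sigma (pF i p))
     <= \sum_i (if f i b == 0%R then 0 else index_at (sgF i) sigma (pF i p)))%N.
    rewrite (bigD1 j)//= f0 eqxx add0n [leqRHS](bigD1 j)//= (negPf fjb) leq_add2l.
    apply: leq_sum => i _; have [//|fi] := eqVneq (f i (pB p)) 0.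
    by rewrite (negPf (fb i fi)).
  have := leq_add leB leS; rewrite [leqRHS]E addnCA -[leqRHS]add0n leq_add2r leqn0.
  by move/eqP.
have [z|nz] := boolP ((index_at (sgF j) 1 (pF j p) == 0%N) && (index_at (sgF j) (-1) (pF j p) == 0%N)).
  right; case/andP: z => /eqP z1 /eqP z2 u v.
  have [e oe] := orthogonal_basis_exists (sgF j) (pF j p).
  rewrite (index_atE _ _ oe) in z1; rewrite (index_atE _ _ oe) in z2.
  have null a : gF j (pF j p) (e a) (e a) = 0.
    have := card0_eq z1 a; have := card0_eq z2 a; rewrite !inE mul1r mulN1r oppr_lt0.
    by case: ltgtP.
  have [c [-> _]] := oe.1 u; rewrite metric_suml// big1// => a _.
  have [d [-> _]] := oe.1 v; rewrite metricZl// metric_sumr// big1 ?mulr0// => b _.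
  rewrite metricZr//; have [->|ab] := eqVneq a b; first by rewrite null mulr0.
  by rewrite oe.2// mulr0.
left => v.
rewrite -[RHS](tact0 v); apply: tact_near => //; first exact: smooth_cst.
have l1 := index_at_near sgB 1 (pB p); have l2 := index_at_near sgB (-1) (pB p).
apply: filterS (filterI (filterI nb nf) (filterI l1 l2)) => b [[[E1 E2] fb] [lb1 lb2]].
apply/eqP; apply: contraNT nz => fjb.
by rewrite (key 1 b)// (key (-1) b).
Qed.

End WarpedSignature.

(** * The covariant derivative of the warped product *)

Section FormCombinators.
Context {R : realType} {M : manifold R}.
Implicit Types (w t : @preform R M).

Definition form_add w t : @preform R M := fun X p => w X p + t X p.
Definition form_scale (h : M -> R) w : @preform R M := fun X p => h p * w X p.
Definition form_sum l (w : 'I_l -> @preform R M) : @preform R M :=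
  fun X p => \sum_j w j X p.

End FormCombinators.

Section CovDerivTensor.
Context {R : realType} {M : manifold R} (g : tensor02 M) (sg : semi_riemannian g).
Arguments g : clear implicits.

(* If [V] extends a vector representing [w] at [p], then [cov_deriv g Z w T p] is
   [lie Z (w T) p - koszul g Z T V p], which is tensorial in [T] when [w] is. *)
Lemma cov_deriv_expand (w : @preform R M) U E x Z p (v : tangent p) T :
  one_form w -> frame_on U E x -> U p -> represents g v w ->
  (forall S, exists u : tangent p, represents g u (koszul g Z S)) ->
  cov_deriv g Z w T p = \sum_a T p (x a) * cov_deriv g Z w (E a) p.
Proof.
move=> ow fr Up rv rep.
have H S : cov_deriv g Z w S p = lie Z (w S) p - koszul g Z S (field_at v) p.
  by have [u ru] := rep S; rewrite (cov_derivE sg ru rv) ru field_atE.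
have [oU sx _ _] := fr.
have nU := open_nbhs_nbhs (conj oU Up).
have [T' [TT' T'E]] := field_frame fr T.
have nT : \forall q \near p, T q = T' q by apply: filterS nU.
rewrite H (koszul_near sg _ _ nT) T'E (koszul_comb sg) big_enum/=.
have sT a : smooth (lie T (x a)) by exact: smooth_lie.
have swE a : smooth (w (E a)) by exact: ow.1.
have -> : lie Z (w T) p = lie Z (fun q => \sum_a (lie T (x a) \* w (E a)) q) p.
  apply: lie_near; [exact: ow.1|by apply: smooth_sum => a _; exact: smoothM|].
  by apply: filterS nU => q Uq; exact: (one_form_frame ow T fr Uq).
rewrite /lie tact_sum; last by move=> a _; exact: (smoothM (sT a) (swE a)).
rewrite -sumrB; apply: eq_bigr => a _.
rewrite (tactM _ (sT a) (swE a)) H rv /inner field_atE (metricC sg (E a p)) /lie; ring.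
Qed.

End CovDerivTensor.

(** The convention for the inverse of 0 makes this valid at zeros, so that representing vectors can
    be written with the inverse of [f j] everywhere. *)
Lemma sqr_mulV (R : fieldType) (c : R) : c ^+ 2 * c^-1 = c.
Proof. by have [->|c0] := eqVneq c 0; rewrite ?invr0 ?mulr0// expr2 mulfK. Qed.

(* To be used with [c = f^-1]; the three hypotheses hold also where [f = 0]. *)
Lemma fiber_identity (R : comPzRingType) (c f Xf Yf Zf Tf ZXf ZYf KZGT KZTG
    iXY iXT iYT iZT iZX iZY ZiXY kZYT kZTY kZXT kZTX kXYT ZkXYT kXYZ e gam m : R) :
  f ^+ 2 * c = f -> f ^+ 2 * e = f ^+ 2 * (ZkXYT - m) ->
  (f ^+ 2 * c ^+ 2) * (Zf * Xf * iYT + Zf * Yf * iXT + Tf * Xf * iZY + Tf * Yf * iZX) =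
    Zf * Xf * iYT + Zf * Yf * iXT + Tf * Xf * iZY + Tf * Yf * iZX ->
  (2 * f * Zf * kXYT + f ^+ 2 * ZkXYT + Zf * (Xf * iYT + Yf * iXT - Tf * iXY) +
   f * (ZXf * iYT + Xf * (kZYT + kZTY) + (ZYf * iXT + Yf * (kZXT + kZTX))
        - ((KZTG + KZGT) * iXY + Tf * ZiXY)))
  - (- (f * iXY * KZTG) - f * iZT * gam
     + f ^+ 2 * (m + c * (Xf * kZTY + Yf * kZTX + Zf * kXYT + Tf * kXYZ)
        + c ^+ 2 * (Zf * Xf * iYT + Zf * Yf * iXT + Tf * Xf * iZY + Tf * Yf * iZX))) =
  - (f * iXY) * KZGT + (- (Zf * iXY + f * ZiXY + f * kXYZ + Xf * iZY + Yf * iZX) * Tf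
   + (f * (f * e) + (Zf * (f * kXYT) + (ZXf * (f * iYT) + (Xf * (f * kZYT)
   + (ZYf * (f * iXT) + (Yf * (f * kZXT) + gam * (f * iZT)))))))).
Proof.
move=> fc fe; set a := Xf * kZTY + _ + _ + _; set b := Zf * Xf * iYT + _ + _ + _ => fcc.
have -> : f ^+ 2 * (m + c * a + c ^+ 2 * b) = f ^+ 2 * m + f * a + b.
  by rewrite -[in RHS]fcc -[in f * a]fc; ring.
rewrite [f * (f * e)]mulrA -expr2 fe /a /b; ring.
Qed.

Section WarpedConnection.
Context {R : realType} {B : manifold R} {l : nat} {F : 'I_l -> manifold R}.
Local Notation M := (product_manifold B F).
Local Notation pB := (@projB R B l F).
Local Notation pF := (@projF R B l F).
Local Notation spB := (@projB_smooth R B l F).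
Local Notation spF j := (@projF_smooth R B l F j).
Local Notation dB := (differential spB).
Local Notation dF j := (differential (spF j)).
Variables (gB : tensor02 B) (gF : forall j, tensor02 (F j)) (f : 'I_l -> B -> R).
Arguments gB : clear implicits.
Arguments gF : clear implicits.
Hypotheses (sgB : semi_riemannian gB) (sgF : forall j, semi_riemannian (gF j)).
Hypothesis sf : forall j, smooth (f j).
Hypothesis ngB : nondegenerate_metric gB.
Local Notation g := (warped_metric gB f gF).
Let sgW : semi_riemannian g := warped_semi_riemannian sgB sgF sf.

Definition fiber_form j (w : @preform R (F j)) : @preform R M :=
  form_scale (f j \o pB) (pullback (spF j) w).

Lemma fiber_one_form j w : one_form w -> one_form (fiber_form (j := j) w).
Proof.
move=> ow; apply: one_form_scale; first exact/projB_smooth/sf.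
exact: pullback_one_form.
Qed.

Lemma base_represented U w : one_form w -> represented_on g U (pullback spB w).
Proof.
move=> ow p _; have [W rW] := sharp sgB ngB ow.
have [u [uB uF]] := tangent_lift (W (pB p)) (fun j => 0 : tangent (pF j p)).
exists u => T; rewrite warpedE uB big1 => [|j _]; last by rewrite uF metric0l// mulr0.
by rewrite addr0 /pullback rW field_atE.
Qed.

Lemma fiber_represented U j w : (forall q, exists u : tangent q, represents (gF j) u w) ->
  represented_on g U (fiber_form (j := j) w).
Proof.
move=> rw p _; have [v rv] := rw (pF j p).
have [u [uB uF]] := tangent_lift (0 : tangent (pB p))
  (eqtype.dfwith (fun j => 0 : tangent (pF j p)) ((f j (pB p))^-1 *: v)).
exists u => T; rewrite warpedE uB metric0l// add0r (bigD1 j)//= big1 => [|i ij]; last first.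
  by rewrite uF dfwith_out 1?eq_sym// metric0l// mulr0.
rewrite uF dfwith_in metricZl// mulrA sqr_mulV addr0.
by rewrite /fiber_form /form_scale /pullback rv field_atE.
Qed.

Section Frame.
Variables (U : set M) (E : 'I_(mdim M) -> vfield M) (x : 'I_(mdim M) -> M -> R)
  (EB : 'I_(mdim M) -> vfield B) (EF : 'I_(mdim M) -> forall j, vfield (F j)).
Arguments EF : clear implicits.
Hypotheses (fr : frame_on U E x) (sE : forall A, splits_on U (E A) (EB A) (EF A)).
Let oU : open U. Proof. by case: fr. Qed.

Variable G : 'I_l -> vfield B.
Hypothesis GP : forall j b, represents gB (G j b) (fun T => lie T (f j)).

(** The hypotheses on [u] are the classical horizontal and vertical components of the Levi-Civita
    connection of a warped product, [G j] being the gradient of [f j]. *)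
Lemma koszul_warped_represents X XB XF Y YB YF p (nB : tangent (pB p))
    (kF : forall j, tangent (pF j p)) (u : tangent p) :
  splits_on U X XB XF -> splits_on U Y YB YF -> U p ->
  represents gB nB (koszul gB XB YB) ->
  (forall j, represents (gF j) (kF j) (koszul (gF j) (XF j) (YF j))) ->
  dB u = nB - \sum_j (f j (pB p) * inner (gF j) (XF j) (YF j) (pF j p)) *: G j (pB p) ->
  (forall j, dF j u = kF j + (f j (pB p))^-1 *:
     (lie XB (f j) (pB p) *: YF j (pF j p) + lie YB (f j) (pB p) *: XF j (pF j p))) ->
  represents g u (koszul g X Y).
Proof.
move=> sX sY Up rB rF uB uF.
apply: (represents_frame sgW (koszul_one_form sgW X Y) fr Up) => A.
have [rEB rEF] := sE A.
rewrite (koszul_warped sgB sgF sf oU sX sY (sE A) Up) warpedE uB (rEB _ Up) metricDl// metricNl//.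
rewrite metric_suml// -rB -addrA; congr (_ + _).
rewrite -sumrN -big_split/=; apply: eq_bigr => j _.
rewrite (rEF j _ Up) uF metricDl// !metricZl// metricDl// !metricZl// -GP -rF.
rewrite (mulrDr (f j (pB p) ^+ 2)) [f j (pB p) ^+ 2 * ((f j (pB p))^-1 * _)]mulrA sqr_mulV /inner; ring.
Qed.

Lemma koszul_warped_represented X XB XF Y YB YF :
  splits_on U X XB XF -> splits_on U Y YB YF ->
  (forall j q, exists u : tangent q, represents (gF j) u (koszul (gF j) (XF j) (YF j))) ->
  represented_on g U (koszul g X Y).
Proof.
move=> sX sY rF p Up.
have [N NP] := sharp sgB ngB (koszul_one_form sgB XB YB).
have kF_ex j := cid (rF j (pF j p)).
have [u [uB uF]] := tangent_lift
  (N (pB p) - \sum_j (f j (pB p) * inner (gF j) (XF j) (YF j) (pF j p)) *: G j (pB p))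
  (fun j => projT1 (kF_ex j) + (f j (pB p))^-1 *:
     (lie XB (f j) (pB p) *: YF j (pF j p) + lie YB (f j) (pB p) *: XF j (pF j p))).
exists u; apply: (koszul_warped_represents sX sY Up (NP _) _ uB uF) => j.
exact: projT2 (kF_ex j).
Qed.

Section Triple.
Variables (X Y Z : vfield M) (XB YB ZB : vfield B) (XF YF ZF : forall j, vfield (F j)).
Arguments XF : clear implicits.
Arguments YF : clear implicits.
Arguments ZF : clear implicits.
Hypotheses (sX : splits_on U X XB XF) (sY : splits_on U Y YB YF) (sZ : splits_on U Z ZB ZF).
Hypothesis rF : forall j (S T : vfield (F j)) q, exists u : tangent q,
  represents (gF j) u (koszul (gF j) S T).
Variable N : vfield B.
Hypothesis NP : forall b, represents gB (N b) (koszul gB XB YB).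
Variable e : forall j, @preform R (F j).
Arguments e : clear implicits.
Hypothesis eA : forall j, Abullet (gF j) (e j).
Hypothesis eC : forall j T q, constant_signature_near (gF j) q ->
  e j T q = cov_deriv (gF j) (ZF j) (koszul (gF j) (XF j) (YF j)) T q.

Let iF j (S T : vfield (F j)) : M -> R := inner (gF j) S T \o pF j.
Let fB j : M -> R := f j \o pB.
Let lB (S : vfield B) j : M -> R := lie S (f j) \o pB.
Arguments iF : clear implicits.

(** The total factor of minus the derivative of [f j] along the argument. The first two terms are
    the derivative along [Z] of [f j] times the fibre product of [X] and [Y]. *)
Definition horizontal_coef j : M -> R := fun p =>
  lB ZB j p * iF j (XF j) (YF j) p
  + fB j p * lie (ZF j) (inner (gF j) (XF j) (YF j)) (pF j p)
  + fB j p * koszul (gF j) (XF j) (YF j) (ZF j) (pF j p)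
  + lB XB j p * iF j (ZF j) (YF j) p + lB YB j p * iF j (ZF j) (XF j) p.

(** The derivative of [f j] along the base part of the vector representing [koszul g X Y]. *)
Definition vertical_coef j : M -> R := fun p => inner gB (G j) N (pB p)
  - \sum_i fB i p * iF i (XF i) (YF i) p * inner gB (G j) (G i) (pB p).

(* The part of [F j] in the covariant derivative, after all denominators have cancelled;
   [e j] extends the covariant derivative of the fibre. *)
Definition fiber_cov_deriv j : @preform R M :=
  form_add (form_scale (fun p => - (fB j p * iF j (XF j) (YF j) p))
    (pullback spB (koszul gB ZB (G j))))
  (form_add (form_scale (fun p => - horizontal_coef j p) (pullback spB (fun T => lie T (f j))))
  (form_add (form_scale (fB j) (fiber_form (e j)))
  (form_add (form_scale (lB ZB j) (fiber_form (koszul (gF j) (XF j) (YF j))))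
  (form_add (form_scale (lie ZB (lie XB (f j)) \o pB) (fiber_form (inner (gF j) (YF j))))
  (form_add (form_scale (lB XB j) (fiber_form (koszul (gF j) (ZF j) (YF j))))
  (form_add (form_scale (lie ZB (lie YB (f j)) \o pB) (fiber_form (inner (gF j) (XF j))))
  (form_add (form_scale (lB YB j) (fiber_form (koszul (gF j) (ZF j) (XF j))))
    (form_scale (vertical_coef j) (fiber_form (inner (gF j) (ZF j))))))))))).

Definition warped_cov_deriv : @preform R M :=
  form_add (pullback spB (koszul gB ZB N)) (form_sum fiber_cov_deriv).

Let s_iF j (S T : vfield (F j)) : smooth (iF j S T). Proof. exact/projF_smooth/inner_smooth. Qed.
Let s_fB j : smooth (fB j). Proof. exact/projB_smooth/sf. Qed.
Let s_lB S j : smooth (lB S j). Proof. exact/projB_smooth/smooth_lie. Qed.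

Lemma horizontal_coef_smooth j : smooth (horizontal_coef j).
Proof.
have sM := @smoothM R M.
have s1 := sM _ _ (s_lB ZB j) (s_iF (XF j) (YF j)).
have s2 := sM _ _ (s_fB j) (projF_smooth (smooth_lie (ZF j) (inner_smooth (sgF j) (XF j) (YF j)))).
have s3 := sM _ _ (s_fB j) (projF_smooth (koszul_smooth (sgF j) (XF j) (YF j) (ZF j))).
have s4 := sM _ _ (s_lB XB j) (s_iF (ZF j) (YF j)).
have s5 := sM _ _ (s_lB YB j) (s_iF (ZF j) (XF j)).
exact: (smoothD (smoothD (smoothD (smoothD s1 s2) s3) s4) s5).
Qed.

Lemma vertical_coef_smooth j : smooth (vertical_coef j).
Proof.
apply: smoothB; first exact/projB_smooth/inner_smooth.
apply: (@smooth_sum R M _ _ _ (fun i p => fB i p * iF i (XF i) (YF i) p * inner gB (G j) (G i) (pB p))) => i _.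
have s1 := smoothM (s_fB i) (s_iF (XF i) (YF i)).
exact: (smoothM s1 (projB_smooth (inner_smooth sgB (G j) (G i)))).
Qed.

Lemma warped_cov_deriv_one_form : one_form warped_cov_deriv.
Proof.
have sl S T j : smooth (lie S (lie T (f j)) \o pB : M -> R).
  by apply: projB_smooth; do 2 apply: smooth_lie.
have ko S T : one_form (pullback spB (koszul gB S T)) by exact/pullback_one_form/koszul_one_form.
apply: one_form_add => //; apply: one_form_sum => j.
have kF S T : one_form (fiber_form (koszul (gF j) S T)) by exact/fiber_one_form/koszul_one_form.
have fF S : one_form (fiber_form (inner (gF j) S)) by exact/fiber_one_form/flat_one_form.
rewrite /fiber_cov_deriv; do !apply: one_form_add; apply: one_form_scale => //.
- by apply: smoothN; exact: smoothM.
- exact/smoothN/horizontal_coef_smooth.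
- by apply: pullback_one_form; exact: one_form_d.
- by apply: fiber_one_form; case: (eA j).
- exact: vertical_coef_smooth.
Qed.

Lemma warped_cov_deriv_represented : represented_on g U warped_cov_deriv.
Proof.
have ko S T : represented_on g U (pullback spB (koszul gB S T)) by exact/base_represented/koszul_one_form.
apply: represented_add => //; apply: represented_sum => // j.
have kF S T : represented_on g U (fiber_form (koszul (gF j) S T)) by apply: fiber_represented => q; exact: rF.
have fF S : represented_on g U (fiber_form (inner (gF j) S)).
  by apply: fiber_represented => q; exists (S q) => T.
rewrite /fiber_cov_deriv; do !apply: (represented_add sgW); apply: (represented_scale sgW) => //.
- by apply: base_represented; exact: one_form_d.
- by apply: fiber_represented; case: (eA j).
Qed.

Lemma fiber_cov_derivE T TB TF p j : splits_on U T TB TF -> U p ->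
  fiber_cov_deriv j T p =
  - (fB j p * iF j (XF j) (YF j) p) * koszul gB ZB (G j) TB (pB p)
  + (- horizontal_coef j p * lB TB j p
  + (fB j p * (fB j p * e j (TF j) (pF j p))
  + (lB ZB j p * (fB j p * koszul (gF j) (XF j) (YF j) (TF j) (pF j p))
  + (lie ZB (lie XB (f j)) (pB p) * (fB j p * iF j (YF j) (TF j) p)
  + (lB XB j p * (fB j p * koszul (gF j) (ZF j) (YF j) (TF j) (pF j p))
  + (lie ZB (lie YB (f j)) (pB p) * (fB j p * iF j (XF j) (TF j) p)
  + (lB YB j p * (fB j p * koszul (gF j) (ZF j) (XF j) (TF j) (pF j p))
  + vertical_coef j p * (fB j p * iF j (ZF j) (TF j) p)))))))).
Proof.
move=> [rB rFT] Up.
have pb w : one_form w -> pullback spB w T p = w TB (pB p).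
  by move=> ow; apply: pullbackE ow (rB p Up).
have pf w : one_form w -> fiber_form w T p = fB j p * w (TF j) (pF j p).
  by move=> ow; rewrite /fiber_form /form_scale (pullbackE ow (rFT j p Up)).
rewrite /fiber_cov_deriv /form_add /form_scale.
rewrite (pb _ (koszul_one_form sgB _ _)) (pb _ (one_form_d (sf j))) (pf _ (eA j).1).
by rewrite !(pf _ (koszul_one_form (sgF j) _ _)) !(pf _ (flat_one_form (sgF j) _)).
Qed.

Lemma lie_koszul_warped T TB TF p : splits_on U T TB TF -> U p ->
  lie Z (koszul g X Y T) p = lie ZB (koszul gB XB YB TB) (pB p) + \sum_j
   (2 * fB j p * lB ZB j p * koszul (gF j) (XF j) (YF j) (TF j) (pF j p)
    + fB j p ^+ 2 * lie (ZF j) (koszul (gF j) (XF j) (YF j) (TF j)) (pF j p)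
    + lB ZB j p * (lB XB j p * iF j (YF j) (TF j) p + lB YB j p * iF j (XF j) (TF j) p
        - lB TB j p * iF j (XF j) (YF j) p)
    + fB j p * (lie ZB (lie XB (f j)) (pB p) * iF j (YF j) (TF j) p
        + lB XB j p * lie (ZF j) (inner (gF j) (YF j) (TF j)) (pF j p)
        + (lie ZB (lie YB (f j)) (pB p) * iF j (XF j) (TF j) p
        + lB YB j p * lie (ZF j) (inner (gF j) (XF j) (TF j)) (pF j p))
        - (lie ZB (lie TB (f j)) (pB p) * iF j (XF j) (YF j) p
        + lB TB j p * lie (ZF j) (inner (gF j) (XF j) (YF j)) (pF j p)))).
Proof.
move=> sT Up.
have sM := @smoothM R M.
pose kF j : M -> R := koszul (gF j) (XF j) (YF j) (TF j) \o pF j.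
have skF j : smooth (kF j) by exact/projF_smooth/koszul_smooth.
have skB : smooth (koszul gB XB YB TB \o pB : M -> R) by exact/projB_smooth/koszul_smooth.
pose W j : M -> R := (((lB XB j \* iF j (YF j) (TF j)) \+ (lB YB j \* iF j (XF j) (TF j)))
   \+ ((-1) \*o (lB TB j \* iF j (XF j) (YF j)))).
have sW j : smooth (W j).
  by apply: smoothD; [apply: smoothD|apply: smoothZ]; exact: sM.
pose H j : M -> R := ((fB j \* fB j) \* kF j) \+ (fB j \* W j).
have sff j : smooth (fB j \* fB j) by exact: sM.
have sH j : smooth (H j) by apply: smoothD; exact: sM.
have sS : smooth (fun q => \sum_j H j q) by apply: smooth_sum.
transitivity (lie Z ((koszul gB XB YB TB \o pB) \+ (fun q => \sum_j H j q)) p).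
  apply: lie_near; [exact: koszul_smooth|exact: smoothD|].
  apply: filterS (open_nbhs_nbhs (conj oU Up)) => q Uq.
  rewrite (koszul_warped sgB sgF sf oU sX sY sT Uq); congr (_ + _).
  apply: eq_bigr => j _; rewrite /H /W /kF /iF /lB /fB /=; ring.
have lieB h : smooth h -> Z p (h \o pB) = lie ZB h (pB p).
  by move=> sh; have := related_lie sZ.1 sh Up.
have lieF j h : smooth h -> Z p (h \o pF j) = lie (ZF j) h (pF j p).
  by move=> sh; have := related_lie (sZ.2 j) sh Up.
rewrite /lie tactD// lieB; last exact: koszul_smooth.
congr (_ + _); rewrite tact_sum//; apply: eq_bigr => j _.
have ZW : Z p (W j) = (lie ZB (lie XB (f j)) (pB p) * iF j (YF j) (TF j) p
        + lB XB j p * lie (ZF j) (inner (gF j) (YF j) (TF j)) (pF j p)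
        + (lie ZB (lie YB (f j)) (pB p) * iF j (XF j) (TF j) p
        + lB YB j p * lie (ZF j) (inner (gF j) (XF j) (TF j)) (pF j p))
        - (lie ZB (lie TB (f j)) (pB p) * iF j (XF j) (YF j) p
        + lB TB j p * lie (ZF j) (inner (gF j) (XF j) (YF j)) (pF j p))).
  have Zp S A C : Z p (lB S j \* iF j A C) = lie ZB (lie S (f j)) (pB p) * iF j A C p
      + lB S j p * lie (ZF j) (inner (gF j) A C) (pF j p).
    rewrite tactM// lieB; last exact: smooth_lie.
    by rewrite lieF; [ring|exact: inner_smooth].
  rewrite tactD; [|by apply: smoothD; exact: sM|by apply: smoothZ; exact: sM].
  rewrite tactZ; last exact: sM.
  by rewrite tactD ?Zp; [ring|exact: sM|exact: sM].
rewrite (tactD _ (sM _ _ (sff j) (skF j)) (sM _ _ (s_fB j) (sW j))).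
rewrite (tactM _ (sff j) (skF j)) (tactM _ (s_fB j) (s_fB j)) (tactM _ (s_fB j) (sW j)) ZW.
rewrite (lieB _ (sf j)) (lieF _ _ (koszul_smooth (sgF j) (XF j) (YF j) (TF j))).
rewrite /W /kF /lie /lB /fB /iF /lie /= expr2; ring.
Qed.

(** The argument is a frame field because it splits, so that both representing vectors are explicit
    and the comparison reduces to one identity for each [j]. *)
Lemma warped_cov_deriv_frame D p : U p -> constant_signature_near g p ->
  warped_cov_deriv (E D) p = cov_deriv g Z (koszul g X Y) (E D) p.
Proof.
move=> Up cs.
set T := E D; set TB := EB D; set TF := EF D.
have sT : splits_on U T TB TF := sE D.
have kXY_ex j := cid (rF (XF j) (YF j) (pF j p)).
pose kXY j := projT1 (kXY_ex j).
have kXYP j : represents (gF j) (kXY j) (koszul (gF j) (XF j) (YF j)) := projT2 (kXY_ex j).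
have kZT_ex j := cid (rF (ZF j) (TF j) (pF j p)).
pose kZT j := projT1 (kZT_ex j).
have kZTP j : represents (gF j) (kZT j) (koszul (gF j) (ZF j) (TF j)) := projT2 (kZT_ex j).
have [N' N'P] := sharp sgB ngB (koszul_one_form sgB ZB TB).
pose uXYB := N (pB p) - \sum_j (f j (pB p) * inner (gF j) (XF j) (YF j) (pF j p)) *: G j (pB p).
have [uXY [uXYBE uXYF]] := tangent_lift uXYB
  (fun j => kXY j + (f j (pB p))^-1 *:
     (lie XB (f j) (pB p) *: YF j (pF j p) + lie YB (f j) (pB p) *: XF j (pF j p))).
have rXY := koszul_warped_represents sX sY Up (NP (pB p)) kXYP uXYBE uXYF.
have [uZT [uZTBE uZTF]] := tangent_lift
  (N' (pB p) - \sum_j (f j (pB p) * inner (gF j) (ZF j) (TF j) (pF j p)) *: G j (pB p))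
  (fun j => kZT j + (f j (pB p))^-1 *:
     (lie ZB (f j) (pB p) *: TF j (pF j p) + lie TB (f j) (pB p) *: ZF j (pF j p))).
have rZT := koszul_warped_represents sZ sT Up (N'P (pB p)) kZTP uZTBE uZTF.
rewrite (cov_derivE sgW rZT rXY) (lie_koszul_warped sT Up).
have gG j : gB (pB p) (G j (pB p)) uXYB = vertical_coef j p.
  rewrite /uXYB metricDr// metricNr// metric_sumr//; congr (_ - _).
  by apply: eq_bigr => i _; rewrite metricZr.
have gN : gB (pB p) (N' (pB p)) uXYB = koszul gB ZB TB N (pB p)
    - \sum_j fB j p * iF j (XF j) (YF j) p * koszul gB ZB TB (G j) (pB p).
  rewrite /uXYB metricDr// metricNr// metric_sumr// -N'P; congr (_ - _).
  by apply: eq_bigr => j _; rewrite metricZr// -N'P.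
rewrite warpedE uXYBE uZTBE metricDl// metricNl// metric_suml// gN.
have NE : inner gB N TB = koszul gB XB YB TB by apply/funext => b; rewrite /inner -NP.
(* The derivative along [Z] of the base Koszul form is split in two: the part in which [TB] is
   differentiated cancels against the contraction, and the part tensorial in [TB] remains. *)
have := koszul_compat sgB ZB N TB (pB p); rewrite NE => <-.
rewrite /warped_cov_deriv /form_add /form_sum (pullbackE (koszul_one_form sgB _ _) (sT.1 p Up)).
set S1 := \sum_j _; set S2 := \sum_j _; set S3 := \sum_j _; set S4 := \sum_j _; set S5 := \sum_j _.
transitivity (koszul gB ZB N TB (pB p) + (S2 - (- S3 - S4 + S5))); last by ring.
congr (_ + _); rewrite /S1 /S2 /S3 /S4 /S5 -!sumrN -!big_split/= -sumrB.
apply: eq_bigr => j _; rewrite (fiber_cov_derivE j sT Up) /horizontal_coef.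
have GE : inner gB TB (G j) = lie TB (f j).
  by apply/funext => b; rewrite inner_sym// /inner -GP.
(* Likewise the second derivative of [f j] along [TB] and [ZB] is split through the gradient [G j],
   and its part not tensorial in [TB] cancels. *)
have := koszul_compat sgB ZB TB (G j) (pB p); rewrite GE => <-.
rewrite -(koszul_compat (sgF j) (ZF j) (YF j) (TF j)) -(koszul_compat (sgF j) (ZF j) (XF j) (TF j)).
rewrite metricZl// gG uZTF uXYF.
set c := (f j (pB p))^-1.
set m := gF j (pF j p) (kZT j) (kXY j).
(* The contraction is sorted by powers of [c]. In the linear terms the representing vectors turn
   products into Koszul forms. *)
have -> : gF j (pF j p)
    (kZT j + c *: (lie ZB (f j) (pB p) *: TF j (pF j p) + lie TB (f j) (pB p) *: ZF j (pF j p)))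
    (kXY j + c *: (lie XB (f j) (pB p) *: YF j (pF j p) + lie YB (f j) (pB p) *: XF j (pF j p))) =
  m + c * (lB XB j p * koszul (gF j) (ZF j) (TF j) (YF j) (pF j p)
     + lB YB j p * koszul (gF j) (ZF j) (TF j) (XF j) (pF j p)
     + lB ZB j p * koszul (gF j) (XF j) (YF j) (TF j) (pF j p)
     + lB TB j p * koszul (gF j) (XF j) (YF j) (ZF j) (pF j p))
  + c ^+ 2 * (lB ZB j p * lB XB j p * iF j (YF j) (TF j) p
     + lB ZB j p * lB YB j p * iF j (XF j) (TF j) p
     + lB TB j p * lB XB j p * iF j (ZF j) (YF j) p
     + lB TB j p * lB YB j p * iF j (ZF j) (XF j) p).
  rewrite !(metricDl (sgF j), metricDr (sgF j), metricZl (sgF j), metricZr (sgF j)) -!kZTP.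
  rewrite !(metricC (sgF j) _ (kXY j)) -!kXYP -/m.
  rewrite (metricC (sgF j) (TF j _) (YF j _)) (metricC (sgF j) (TF j _) (XF j _)).
  rewrite (metricC (sgF j) (kXY j)) -/m.
  rewrite /lB /iF /inner /=.
  ring.
have fP : fB j p ^+ 2 * c = fB j p by exact: sqr_mulV.
(* [e j] is known only at points of constant signature of the fibre. These are available when [f j]
   is nonzero; otherwise the factor [fB j p ^+ 2] kills both sides. *)
have fe : fB j p ^+ 2 * e j (TF j) (pF j p) =
    fB j p ^+ 2 * (lie (ZF j) (koszul (gF j) (XF j) (YF j) (TF j)) (pF j p) - m).
  have [f0|f0] := eqVneq (f j (pB p)) 0; first by rewrite /fB /= f0 expr0n !mul0r.
  rewrite eC; last exact: (constant_signature_fiber sgB sgF sf f0 cs).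
  by rewrite (cov_derivE (sgF j) (kZTP j) (kXYP j)).
apply/esym; apply: fiber_identity => //.
(* For the terms quadratic in [c] the factor [f ^+ 2 * c ^+ 2] is 1 where [f j] is nonzero. At a
   zero it is 0, but each term is a product of two derivatives of [f j] and a fibre inner product,
   so [warping_zero] annihilates it. *)
have [f0|f0] := eqVneq (f j (pB p)) 0.
  have [df|gz] := warping_zero sgB sgF sf f0 cs.
    by rewrite /lB /= /lie !df !(mul0r, mulr0, addr0).
  by rewrite /iF /= /inner !gz !(mulr0, addr0).
by rewrite /c -exprMn /fB /= divff// expr1n mul1r.
Qed.

(** Both sides are tensorial in [T], the right one by [cov_deriv_expand], so the comparison on frame
    fields suffices. *)
Lemma warped_cov_deriv_on : cov_deriv_on g U Z (koszul g X Y) warped_cov_deriv.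
Proof.
move=> T p Up cs.
have rep S S' SB SB' SF SF' (sS : splits_on U S SB SF) (sS' : splits_on U S' SB' SF') :
    represented_on g U (koszul g S S').
  by apply: (koszul_warped_represented sS sS') => j q; exact: rF.
have [v rv] := rep _ _ _ _ _ _ sX sY p Up.
have repE a b : represented_on g U (koszul g (E a) (E b)) by exact: rep (sE a) (sE b).
have repZ S : exists u : tangent p, represents g u (koszul g Z S).
  exact: (koszul_represented sgW fr repE).
rewrite (cov_deriv_expand sgW T (koszul_one_form sgW X Y) fr Up rv repZ).
rewrite (one_form_frame warped_cov_deriv_one_form T fr Up).
by apply: eq_bigr => a _; rewrite warped_cov_deriv_frame.
Qed.

End Triple.
End Frame.

Lemma warped_semi_regular : (forall j, semi_regular (gF j)) -> semi_regular g.
Proof.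
move=> srF; apply: (semi_regular_local sgW) => p.
have [U [E [x [EB [EF [fr Up rB rF _]]]]]] := product_frame p.
have sE A : splits_on U (E A) (EB A) (fun j => EF j A) by split=> [|j]; [exact: rB|exact: rF].
have rK j (S T : vfield (F j)) q : exists u : tangent q, represents (gF j) u (koszul (gF j) S T).
  by have [/(_ S T)[_ r] _] := srF j; exact: r.
have /choice[G GP] : forall j, exists W : vfield B, forall b, represents gB (W b) (fun T => lie T (f j)).
  by move=> j; apply: sharp => //; exact: one_form_d.
exists U, E, x; split=> // [a b|a b c].
  by apply: (koszul_warped_represented fr sE GP (sE a) (sE b)) => j q; exact: rK.
have [N NP] := sharp sgB ngB (koszul_one_form sgB (EB a) (EB b)).
have e_ex j := cid2 ((srF j).2 (EF j a) (EF j b) (EF j c)).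
pose e j := s2val (e_ex j).
have eA j : Abullet (gF j) (e j) := s2valP (e_ex j).
have eC j := s2valP' (e_ex j).
exists (warped_cov_deriv G (EB a) (EB b) (EB c) (fun j => EF j a) (fun j => EF j b) (fun j => EF j c) N e); split.
- exact: (warped_cov_deriv_one_form _ _ _ _ _ _ _ _ eA).
- exact: (warped_cov_deriv_represented _ _ _ _ _ _ _ rK _ eA).
- exact: (warped_cov_deriv_on fr sE GP (sE a) (sE b) (sE c) rK NP eA eC).
Qed.

End WarpedConnection.

Theorem theorem5p4 (R : realType) (B : manifold R) (gB : tensor02 B)
    (l : nat) (F : 'I_l -> manifold R) (gF : forall j : 'I_l, tensor02 (F j))
    (f : 'I_l -> B -> R) :
  semi_riemannian gB -> nondegenerate_metric gB ->
  (forall j : 'I_l, semi_riemannian (gF j)) ->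
  (forall j : 'I_l, semi_regular (gF j)) ->
  (forall j : 'I_l, smooth (f j)) ->
  semi_riemannian (warped_metric gB f gF) /\
  semi_regular (warped_metric gB f gF).
Proof.
move=> sgB ngB sgF srF sf; split; first exact: warped_semi_riemannian.
exact: warped_semi_regular.
Qed.
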